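(* Gap rigidity fails for the pair $(\Delta^2,\Delta\times\{0\})$, where $\Delta\subset\mathbb C$ is the unit disk and $\Delta\times\{0\}\subset\Delta^2$ is the standard totally geodesic embedding. That is: for every $\epsilon>0$ there exist a torsion-free discrete group $\Gamma$ of biholomorphic automorphisms of $\Delta^2$ and a compact complex curve $S\subset X=\Delta^2/\Gamma$ which is $\epsilon$-geodesic and modeled on $(\Delta^2,\Delta\times\{0\})$, but which is not totally geodesic.
   Context: Let $\Omega$ be a bounded symmetric domain equipped with a canonical (invariant Kähler–Einstein) metric, here $\Delta^2$ with the product of Poincaré metrics, and let $i:D\hookrightarrow\Omega$ be a totally geodesic holomorphic embedding of a bounded symmetric domain $D$. For $X=\Omega/\Gamma$, $\Gamma$ a torsion-free discrete group of automorphisms, a compact complex submanifold $S\subset X$ is called $\epsilon$-geodesic if the norm of its second fundamental form in $X$ is uniformly bounded by $\epsilon$. For $\epsilon$ small such an $S$ locally resembles exactly one model $(\Omega,D;i)$ (up to $\mathrm{Aut}(\Omega)$); $S$ is said to be modeled on $(\Omega,D;i)$ if, for every point of a lift $\widetilde S\subset\Omega$ of $S$, after moving that point to a base point by an automorphism of $\Omega$, the piece of $\widetilde S$ in a fixed geodesic ball is close (as complex-analytic subvarieties) to the corresponding piece of $i(D)$. Gap rigidity holds for $(\Omega,D;i)$ if there is $\epsilon>0$ such that for every such $X$, every $\epsilon$-geodesic compact complex submanifold $S\subset X$ modeled on $(\Omega,D;i)$ is totally geodesic. *)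

(* Defs.v *)
From HB Require Import structures.
From mathcomp Require Import all_boot all_order all_algebra.
From mathcomp Require Import all_classical all_reals all_analysis.
From mathcomp Require Import complex.
Set Implicit Arguments. Unset Strict Implicit. Unset Printing Implicit Defensive.
Import Order.TTheory GRing.Theory Num.Theory.
Import numFieldNormedType.Exports.
Local Open Scope classical_set_scope.
Local Open Scope ring_scope.
Local Open Scope complex_scope.

Section BidiskDefs.
Variable R : realType.
Local Notation C := (R[i]).

Definition nc (z : C) : R := ComplexField.Normc.normc z.
Definition cconj (z : C) : C := conjc z.

Definition bidisk (p : C * C) : Prop := nc p.1 < 1 /\ nc p.2 < 1.

Definition mob (a u : C) (z : C) : C := u * (z - a) / (1 - cconj a * z).

(** All biholomorphic automorphisms of Delta^2 (Cartan): products of disk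
    automorphisms, possibly composed with the swap of coordinates. *)
Definition aut_formula (s : bool) (a1 u1 a2 u2 : C) (p : C * C) : C * C :=
  if s then (mob a1 u1 p.2, mob a2 u2 p.1) else (mob a1 u1 p.1, mob a2 u2 p.2).

Definition is_aut (g : C * C -> C * C) : Prop :=
  exists (s : bool) (a1 u1 a2 u2 : C),
    [/\ nc a1 < 1, nc a2 < 1, nc u1 = 1, nc u2 = 1 &
        forall p, bidisk p -> g p = aut_formula s a1 u1 a2 u2 p].

Definition eqD (g h : C * C -> C * C) : Prop := forall p, bidisk p -> g p = h p.

Definition aut_group (G : set (C * C -> C * C)) : Prop :=
  [/\ (forall g, G g -> is_aut g),
      G id,
      (forall g h, G g -> G h -> G (g \o h)) &
      (forall g, G g -> exists h, [/\ G h, eqD (h \o g) id & eqD (g \o h) id])].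

Definition torsion_free (G : set (C * C -> C * C)) : Prop :=
  forall g (n : nat), G g -> (0 < n)%N -> eqD (iter n g) id -> eqD g id.

(** discrete in Aut(Delta^2) (compact-open topology): the identity is isolated,
    i.e. some basic neighbourhood {g | sup_K |g - id| < d} of id, with K a
    closed polydisk of radius r < 1, contains no other element of G. *)
Definition discrete_group (G : set (C * C -> C * C)) : Prop :=
  exists r d : R, [/\ 0 < r, r < 1, 0 < d &
    forall g, G g ->
      (forall p, nc p.1 <= r -> nc p.2 <= r ->
         nc ((g p).1 - p.1) < d /\ nc ((g p).2 - p.2) < d) ->
      eqD g id].

Definition holo_on (c : C) (rho : R) (f : C -> C) : Prop :=
  forall w, nc (w - c) < rho ->
    derivable (f : C^o -> C^o) w 1 /\
    derivable ((fun v => 'D_1 (f : C^o -> C^o) v) : C^o -> C^o) w 1.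

Definition d1 (f : C -> C) (w : C) : C := 'D_1 (f : C^o -> C^o) w.
Definition d2 (f : C -> C) (w : C) : C :=
  'D_1 ((fun v => 'D_1 (f : C^o -> C^o) v) : C^o -> C^o) w.

(** A closed complex submanifold of dimension 1 of Delta^2: closed in Delta^2
    and locally (in a polydisk around each of its points) the graph of a
    holomorphic function over one of the two coordinate axes. *)
Definition cplx_curve (S : set (C * C)) : Prop :=
  [/\ (forall p, S p -> bidisk p),
      (forall p, bidisk p ->
         (forall e : R, 0 < e -> exists q, S q /\ nc (q.1 - p.1) < e /\ nc (q.2 - p.2) < e) ->
         S p) &
      (forall p, S p -> exists (eta : R) (f : C -> C) (b : bool),
         0 < eta /\
         if b then
           holo_on p.1 eta f /\
           forall q : C * C, nc (q.1 - p.1) < eta -> nc (q.2 - p.2) < eta ->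
             (S q <-> q.2 = f q.1)
         else
           holo_on p.2 eta f /\
           forall q : C * C, nc (q.1 - p.1) < eta -> nc (q.2 - p.2) < eta ->
             (S q <-> q.1 = f q.2))].

(** S is the (Gamma-invariant) preimage in Delta^2 of a nonempty compact
    complex curve of X = Delta^2 / Gamma. *)
Definition compact_curve_lift (G : set (C * C -> C * C)) (S : set (C * C)) : Prop :=
  [/\ cplx_curve S,
      (exists p, S p),
      (forall g p, G g -> S p -> S (g p)) &
      (exists r : R, r < 1 /\
         forall p, S p -> exists g q, [/\ G g, S q, nc q.1 <= r, nc q.2 <= r & p = g q])].

Definition curve_param (S : set (C * C)) (rho : R) (f1 f2 : C -> C) : Prop :=
  [/\ 0 < rho, holo_on 0 rho f1, holo_on 0 rho f2 &
      forall w, nc w < rho -> S (f1 w, f2 w) /\ (d1 f1 w, d1 f2 w) != (0, 0)].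

(** Product of Poincare metrics h_i = (1 - |z_i|^2)^-2 |dz_i|^2 on Delta^2. *)
Definition hmet (z : C) : C := ((1 - nc z ^+ 2) ^- 2)%:C.
(** Christoffel symbol Gamma^z_zz = d_z log h *)
Definition chr (z : C) : C := ((2 : R) / (1 - nc z ^+ 2))%:C * cconj z.
Definition hinner (z X Y : C * C) : C :=
  hmet z.1 * X.1 * cconj Y.1 + hmet z.2 * X.2 * cconj Y.2.

(** squared norm |sigma|^2 of the second fundamental form of the curve
    parametrized by (f1, f2) at the parameter w:
    T = phi'(w), A = nabla_T T, N = normal part of A,
    |sigma|^2 = |N|^2 / |T|^4. *)
Definition sff_sq (f1 f2 : C -> C) (w : C) : R :=
  let z := (f1 w, f2 w) in
  let T := (d1 f1 w, d1 f2 w) in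
  let A := (d2 f1 w + chr z.1 * (T.1 ^+ 2), d2 f2 w + chr z.2 * (T.2 ^+ 2)) in
  let c := hinner z A T / hinner z T T in
  let N := (A.1 - c * T.1, A.2 - c * T.2) in
  complex.Re (hinner z N N) / (complex.Re (hinner z T T)) ^+ 2.

Definition eps_geodesic (eps : R) (S : set (C * C)) : Prop :=
  forall rho f1 f2 w, curve_param S rho f1 f2 -> nc w < rho ->
    sff_sq f1 f2 w <= eps ^+ 2.

Definition totally_geodesic (S : set (C * C)) : Prop :=
  forall rho f1 f2 w, curve_param S rho f1 f2 -> nc w < rho -> sff_sq f1 f2 w = 0.

(** Poincare distance from 0 for the metric |dz|^2/(1-|z|^2)^2 *)
Definition pdist0 (t : R) : R := ln ((1 + t) / (1 - t)) / 2.
Definition geo_ball (p : C * C) : Prop :=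
  bidisk p /\ pdist0 (nc p.1) ^+ 2 + pdist0 (nc p.2) ^+ 2 < 1.

(** S is modeled on (Delta^2, Delta x {0}) with closeness threshold d: for every
    point p of S there is an automorphism g with g p = 0 such that, in the fixed
    geodesic ball, g(S) and Delta x {0} are d-close (Hausdorff sense). *)
Definition modeled_horizontal (d : R) (S : set (C * C)) : Prop :=
  forall p, S p -> exists g, [/\ is_aut g, g p = (0, 0),
     (forall q, S q -> geo_ball (g q) -> nc (g q).2 < d) &
     (forall x : C, geo_ball (x, 0) ->
        exists q, [/\ S q, nc ((g q).1 - x) < d & nc (g q).2 < d])].

End BidiskDefs.

(* Main.v *)
(* Let L = Z[i] and let F : Delta -> C be the universal branched covering of the plane with
   branching of order two over every point of L.  It exists because it is the limit of finite
   towers of two-sheeted branched coverings, normal by a Landau-type bound: |G'(0)| <= 48 for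
   every holomorphic G on Delta that takes each value in L with even multiplicities only.
   If F / n takes a value in L then F does too, so F / n again takes each value in L with even
   multiplicities, and it lifts to a holomorphic f : Delta -> Delta with F o f = F / n.
   The map f is equivariant for the lifts of the translations by n L.  The lifts of the
   translations by a sublattice of finite index form a cocompact group, in which a sign
   character cuts out a torsion-free subgroup of index at most two; it acts on the graph S of f
   with compact quotient.

   The derivative of F is bounded in the Poincare metric, hence f contracts as n grows:
   recentred at (z, f z), it tends to 0 on compact sets, uniformly in z.  This makes S close to
   Delta x {0} and, by Cauchy estimates, its second fundamental form small.  Where F takes the
   value 1, which is not in n L, F is critical and f is therefore critical with f'' <> 0, so S
   is not totally geodesic there. *)

Require Import Defs.
From HB Require Import structures.
From mathcomp Require Import all_boot all_order all_algebra.
From mathcomp Require Import all_classical all_reals all_analysis.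
From mathcomp Require Import complex.
From mathcomp Require Import ring lra zify.
Set Implicit Arguments. Unset Strict Implicit. Unset Printing Implicit Defensive.
Import Order.TTheory GRing.Theory Num.Theory.
Import numFieldNormedType.Exports.
Local Open Scope classical_set_scope.
Local Open Scope ring_scope.

(** Give the plane a cone point of order two at each point of L. Division by n is then an orbifold
    map, because the preimage n L of L lies in L; the cone points outside n L go to smooth points,
    which is where the lift [f] is critical. The source C / n L has n^2 cone points, the target C /
    L has one and the map has degree one: this explains the contraction. The obstacle is torsion.
    The half-turns about the points over L are deck transformations over the translation 0, so no
    restriction on translations removes them. A sign, read off from square roots of (F - l)(F - l -
    1), is attached to deck transformations instead, and half-turns have sign -1. The second factor
    needs no such care: an element of the final group is determined on the bidisk by its first
    component. The analysis avoids contour integrals: a maximum principle obtained from second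
    differences is applied on annuli to quotients by high powers of z, and yields the Schwarz lemma,
    the Cauchy estimates and the identity theorem. Multiplicities are not counted either: even
    multiplicity means that a holomorphic square root exists locally. *)

Arguments nc : simpl never.

(** * The modulus of complex numbers *)

Section ComplexModulus.
Variable R : realType.
Local Notation C := (R[i]).
Implicit Types (x y z w : C) (r : R).

Lemma nc_sqr z : nc z ^+ 2 = complex.Re z ^+ 2 + complex.Im z ^+ 2.
Proof. by case: z => a b; rewrite /nc /= sqr_sqrtr // addr_ge0 ?sqr_ge0. Qed.

Lemma nc_ge0 z : 0 <= nc z.
Proof. by case: z => a b; rewrite /nc /= sqrtr_ge0. Qed.

Lemma nc0 : nc (0 : C) = 0.
Proof. exact: ComplexField.Normc.normc0. Qed.

Lemma nc1 : nc (1 : C) = 1.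
Proof. exact: ComplexField.Normc.normc1. Qed.

Lemma ncM x y : nc (x * y) = nc x * nc y.
Proof. exact: ComplexField.Normc.normcM. Qed.

Lemma ncV x : nc x^-1 = (nc x)^-1.
Proof. exact: ComplexField.Normc.normcV. Qed.

Lemma nc_div x y : nc (x / y) = nc x / nc y.
Proof. by rewrite ncM ncV. Qed.

Lemma ncN x : nc (- x) = nc x.
Proof. exact: normcN. Qed.

Lemma ncD x y : nc (x + y) <= nc x + nc y.
Proof. exact: le_normcD. Qed.

Lemma ncB x y : nc (x - y) <= nc x + nc y.
Proof. by rewrite -(ncN y) ncD. Qed.

Lemma nc_distC x y : nc (x - y) = nc (y - x).
Proof. by rewrite -ncN opprB. Qed.

Lemma ncX x n : nc (x ^+ n) = nc x ^+ n.
Proof. by elim: n => [|n IH]; rewrite ?expr0 ?nc1 // !exprS ncM IH. Qed.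

Lemma nc_eq0 x : (nc x == 0) = (x == 0).
Proof.
apply/idP/idP => [/eqP|/eqP ->]; last by rewrite nc0.
by move/ComplexField.Normc.eq0_normc => ->.
Qed.

Lemma nc_gt0 x : (0 < nc x) = (x != 0).
Proof. by rewrite lt_def nc_eq0 nc_ge0 andbT. Qed.

Lemma nc_real r : nc (r%:C%C : C) = `|r|.
Proof. by rewrite /nc /= expr0n /= addr0 sqrtr_sqr. Qed.

Lemma nc_nat n : nc (n%:R : C) = n%:R.
Proof.
have -> : (n%:R : C) = (n%:R : R)%:C%C by rewrite rmorph_nat.
by rewrite nc_real ger0_norm // ler0n.
Qed.

Lemma nc_conj x : nc (cconj x) = nc x.
Proof. by case: x => a b; rewrite /nc /cconj /= sqrrN. Qed.

Lemma mul_cconj x : x * cconj x = (nc x ^+ 2)%:C%C.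
Proof.
rewrite nc_sqr; case: x => a b; apply/eqP; rewrite eq_complex /cconj /=.
by apply/andP; split; apply/eqP; ring.
Qed.

Lemma ncB_ge x y : nc x - nc y <= nc (x - y).
Proof. by rewrite lerBlDr -{1}(subrK y x) ncD. Qed.

Lemma ncD_ge x y : nc x - nc y <= nc (x + y).
Proof. by rewrite -(ncN y) -{2}(opprK y) ncB_ge. Qed.

Lemma nc_triangle x y z : nc (x - z) <= nc (x - y) + nc (y - z).
Proof. by rewrite -{1}(subrK y x) -addrA ncD. Qed.

Lemma Re_le_nc x : `|complex.Re x| <= nc x.
Proof.
rewrite -(@ler_pXn2r _ 2) ?nnegrE ?nc_ge0 // nc_sqr real_normK ?num_real //.
by rewrite lerDl sqr_ge0.
Qed.

Lemma Im_le_nc x : `|complex.Im x| <= nc x.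
Proof.
rewrite -(@ler_pXn2r _ 2) ?nnegrE ?nc_ge0 // nc_sqr real_normK ?num_real //.
by rewrite lerDr sqr_ge0.
Qed.

Lemma nc_le_ReIm x : nc x <= `|complex.Re x| + `|complex.Im x|.
Proof.
rewrite -(@ler_pXn2r _ 2) ?nnegrE ?nc_ge0 ?addr_ge0 // nc_sqr.
rewrite sqrrD !real_normK ?num_real // -addrA lerD2l lerDr.
by rewrite mulrn_wge0 // mulr_ge0.
Qed.

Lemma ReM x y :
  complex.Re (x * y) = complex.Re x * complex.Re y - complex.Im x * complex.Im y.
Proof. by case: x; case: y. Qed.

Lemma ReD x y : complex.Re (x + y) = complex.Re x + complex.Re y.
Proof. by case: x; case: y. Qed.

Lemma ReN x : complex.Re (- x) = - complex.Re x.
Proof. by case: x. Qed.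

Lemma ImM x y :
  complex.Im (x * y) = complex.Re x * complex.Im y + complex.Im x * complex.Re y.
Proof. by case: x; case: y. Qed.

Lemma ImD x y : complex.Im (x + y) = complex.Im x + complex.Im y.
Proof. by case: x; case: y. Qed.

Lemma ImN x : complex.Im (- x) = - complex.Im x.
Proof. by case: x. Qed.

Lemma eq_of_nc_small x y : (forall e : R, 0 < e -> nc (x - y) <= e) -> x = y.
Proof.
move=> H; apply/eqP; rewrite -subr_eq0 -nc_eq0 eq_le nc_ge0 andbT.
by apply/ler_addgt0Pl => e e0; rewrite addr0 H.
Qed.

End ComplexModulus.

(** * Complex derivatives and holomorphic functions *)

Section ComplexDerivative.
Variable R : realType.
Local Notation C := (R[i]).
Implicit Types (f g : C -> C) (z w l m : C).

Definition ccont f z := forall e : R, 0 < e ->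
  exists2 d : R, 0 < d & forall w, nc (w - z) < d -> nc (f w - f z) < e.

(** Carathéodory's form of the derivative: the product and chain rules become algebraic identities
    between slope functions. *)
Definition cdv f z l := exists phi : C -> C,
  [/\ forall w, f w = f z + phi w * (w - z), phi z = l & ccont phi z].

Lemma ccont_cst l z : ccont (fun=> l) z.
Proof. by move=> e e0; exists 1 => // w _; rewrite subrr nc0. Qed.

Lemma ccont_id z : ccont id z.
Proof. by move=> e e0; exists e. Qed.

Lemma ccontD f g z : ccont f z -> ccont g z -> ccont (fun w => f w + g w) z.
Proof.
move=> cf cg e e0; have e2 : 0 < e / 2 by lra.
have [d1 d10 h1] := cf _ e2; have [d2 d20 h2] := cg _ e2.
exists (Num.min d1 d2); first by rewrite lt_min d10.
move=> w; rewrite lt_min => /andP[w1 w2].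
have := h1 _ w1; have := h2 _ w2; rewrite opprD addrACA.
have := ncD (f w - f z) (g w - g z); lra.
Qed.

Lemma ccontN f z : ccont f z -> ccont (fun w => - f w) z.
Proof.
move=> cf e /cf[d d0 h]; exists d => // w /h.
by rewrite -opprD ncN.
Qed.

Lemma ccontB f g z : ccont f z -> ccont g z -> ccont (fun w => f w - g w) z.
Proof. by move=> cf cg; apply: ccontD => //; apply: ccontN. Qed.

Lemma ccontM f g z : ccont f z -> ccont g z -> ccont (fun w => f w * g w) z.
Proof.
move=> cf cg e e0.
set A := nc (g z) + 1; set B := nc (f z) + 1.
have A0 : 0 < A by rewrite /A; have := nc_ge0 (g z); lra.
have B0 : 0 < B by rewrite /B; have := nc_ge0 (f z); lra.
have [d1 d10 h1] := cf (e / 2 / A) ltac:(by rewrite !divr_gt0).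
have [d2 d20 h2] := cg (Num.min 1 (e / 2 / B)) ltac:(by rewrite lt_min ltr01 !divr_gt0).
exists (Num.min d1 d2); first by rewrite lt_min d10.
move=> w; rewrite lt_min => /andP[w1 w2].
have a1 := h1 _ w1; have := h2 _ w2; rewrite lt_min => /andP[a2 a3].
have -> : f w * g w - f z * g z = (f w - f z) * g w + f z * (g w - g z) by ring.
apply: (le_lt_trans (ncD _ _)); rewrite !ncM.
have gw : nc (g w) <= A.
  by rewrite /A; have := ncD_ge (g w) (- g z); rewrite ncN; lra.
have b1 : nc (f w - f z) * nc (g w) <= e / 2 / A * A.
  by apply: ler_pM => //; rewrite ?nc_ge0 ?ltW.
have b2 : nc (f z) * nc (g w - g z) < B * (e / 2 / B).
  have := nc_ge0 (f z); have := nc_ge0 (g w - g z) => u v.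
  apply: (@le_lt_trans _ _ (B * nc (g w - g z))); last by rewrite ltr_pM2l.
  by apply: ler_wpM2r => //; rewrite /B; lra.
rewrite divfK ?gt_eqF // in b1.
rewrite [B * (_ / _)]mulrC divfK ?gt_eqF // in b2; lra.
Qed.

Lemma ccont_comp f g z : ccont f z -> ccont g (f z) -> ccont (fun w => g (f w)) z.
Proof.
by move=> cf cg e /cg[d /cf[d' d'0 h1] h2]; exists d' => // w /h1 /h2.
Qed.

Lemma ccontV_id z : z != 0 -> ccont (fun w : C => w^-1) z.
Proof.
move=> z0 e e0; have nz : 0 < nc z by rewrite nc_gt0.
exists (Num.min (nc z / 2) (e * (nc z) ^+ 2 / 4)).
  by rewrite lt_min !divr_gt0 // mulr_gt0 // exprn_gt0.
move=> w; rewrite lt_min => /andP[w1 w2].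
have nw : nc z / 2 <= nc w.
  have := ncB_ge z w; rewrite nc_distC; lra.
have w0 : w != 0 by rewrite -nc_gt0; lra.
have -> : w^-1 - z^-1 = (z - w) / (w * z) by field; rewrite w0 z0.
rewrite nc_div ncM nc_distC ltr_pdivrMr; last by rewrite mulr_gt0 //; lra.
apply: (lt_le_trans w2).
have : e * (nc z / 2 * nc z) <= e * (nc w * nc z) by rewrite ler_pM2l // ler_pM2r.
have : 0 < e * nc z ^+ 2 by rewrite mulr_gt0 // exprn_gt0.
rewrite expr2; lra.
Qed.

Lemma ccontV f z : ccont f z -> f z != 0 -> ccont (fun w => (f w)^-1) z.
Proof. by move=> cf f0; apply: (ccont_comp cf) => //; exact: ccontV_id. Qed.

Lemma ccont_near f g z (d : R) : 0 < d -> (forall w, nc (w - z) < d -> f w = g w) ->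
  ccont f z -> ccont g z.
Proof.
move=> d0 fg cf e /cf[d' d'0 h]; exists (Num.min d d'); first by rewrite lt_min d0.
move=> w; rewrite lt_min => /andP[w1 w2]; rewrite -!fg ?subrr ?nc0 //.
exact: h.
Qed.

Lemma cdv_cont f z l : cdv f z l -> ccont f z.
Proof.
move=> [phi [fE _ cphi]]; apply: (@ccont_near (fun w => f z + phi w * (w - z)) _ _ 1) => //.
apply: ccontD; [exact: ccont_cst|apply: ccontM => //].
by apply: ccontB; [exact: ccont_id|exact: ccont_cst].
Qed.

Lemma cdv_cst l z : cdv (fun=> l) z 0.
Proof. by exists (fun=> 0); split=> // [w|]; [rewrite mul0r addr0|exact: ccont_cst]. Qed.

Lemma cdv_id z : cdv id z 1.
Proof.
exists (fun=> 1); split=> // [w|]; last exact: ccont_cst.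
by rewrite mul1r /= addrC subrK.
Qed.

Lemma cdvD f g z l m : cdv f z l -> cdv g z m -> cdv (fun w => f w + g w) z (l + m).
Proof.
move=> [p [fE <- cp]] [q [gE <- cq]]; exists (fun w => p w + q w); split=> //.
  by move=> w; rewrite (fE w) (gE w); ring.
exact: ccontD.
Qed.

Lemma cdvM f g z l m : cdv f z l -> cdv g z m ->
  cdv (fun w => f w * g w) z (l * g z + f z * m).
Proof.
move=> df dg; have cg := cdv_cont dg; move: df dg => [p [fE <- cp]] [q [gE <- cq]].
exists (fun w => p w * g w + f z * q w); split=> //.
  by move=> w; rewrite (fE w) (gE w); ring.
by apply: ccontD; apply: ccontM => //; exact: ccont_cst.
Qed.

Lemma cdvZ c f z l : cdv f z l -> cdv (fun w => c * f w) z (c * l).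
Proof.
move=> df; have := cdvM (cdv_cst c z) df.
by rewrite mul0r add0r.
Qed.

Lemma cdv_mulc c z : cdv (fun w => c * w) z c.
Proof. by have := cdvZ c (cdv_id z); rewrite mulr1. Qed.

Lemma cdvN f z l : cdv f z l -> cdv (fun w => - f w) z (- l).
Proof.
move=> [p [fE <- cp]]; exists (fun w => - p w); split=> //.
  by move=> w; rewrite (fE w); ring.
exact: ccontN.
Qed.

Lemma cdvB f g z l m : cdv f z l -> cdv g z m -> cdv (fun w => f w - g w) z (l - m).
Proof. by move=> df dg; apply: cdvD => //; apply: cdvN. Qed.

Lemma cdv_comp f g z l m : cdv f z l -> cdv g (f z) m ->
  cdv (fun w => g (f w)) z (m * l).
Proof.
move=> df; have cf := cdv_cont df; move: df => [p [fE <- cp]] [q [gE <- cq]].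
exists (fun w => q (f w) * p w); split=> //.
  by move=> w; rewrite (gE (f w)) {2}(fE w); ring.
by apply: ccontM => //; apply: (ccont_comp cf).
Qed.

Lemma cdv_near f g z l (d : R) : 0 < d -> (forall w, nc (w - z) < d -> f w = g w) ->
  cdv f z l -> cdv g z l.
Proof.
move=> d0 fg [p [fE <- cp]].
exists (fun w => if w == z then p z else (g w - g z) / (w - z)); split.
- move=> w; case: eqP => [->|/eqP wz]; first by rewrite subrr mulr0 addr0.
  by rewrite divfK ?subr_eq0 // addrC subrK.
- by rewrite eqxx.
- apply: (ccont_near d0 _ cp) => w wd; case: eqP => [->//|/eqP wz].
  rewrite -!fg ?subrr ?nc0 // (fE w) addrAC subrr add0r mulfK ?subr_eq0 //.
Qed.

Lemma cdvV_id z : z != 0 -> cdv (fun w : C => w^-1) z (- z ^- 2).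
Proof.
move=> z0; have nz : 0 < nc z by rewrite nc_gt0.
(* The slope identity is required at every [w], and it fails at [w = 0], whose inverse is 0 by
   convention; [g] agrees with the inverse near [z]. *)
pose g (w : C) := z^-1 + (- (w^-1 * z^-1)) * (w - z).
apply: (@cdv_near g _ _ _ (nc z)) => //.
  move=> w wz; rewrite /g.
  have w0 : w != 0.
    rewrite -nc_gt0; have := ncB_ge z w; rewrite nc_distC; lra.
  by field; rewrite w0 z0.
exists (fun w => - (w^-1 * z^-1)); split.
- by move=> w; rewrite /g subrr mulr0 addr0.
- by rewrite -invfM -expr2.
- by apply: ccontN; apply: ccontM; [exact: ccontV_id|exact: ccont_cst].
Qed.

Lemma cdvV f z l : cdv f z l -> f z != 0 ->
  cdv (fun w => (f w)^-1) z (- (f z) ^- 2 * l).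
Proof. by move=> df f0; apply: (cdv_comp df); exact: cdvV_id. Qed.

Lemma cdv_eps f z l : cdv f z l -> forall e : R, 0 < e ->
  exists2 d : R, 0 < d & forall w, nc (w - z) < d ->
    nc (f w - f z - l * (w - z)) <= e * nc (w - z).
Proof.
move=> [p [fE <- cp]] e /cp[d d0 h]; exists d => // w /h wd.
rewrite (fE w) [_ + _ - f z]addrAC subrr add0r -mulrBl ncM.
by rewrite ler_wpM2r ?nc_ge0 // ltW.
Qed.

Lemma eps_cdv f z l : (forall e : R, 0 < e ->
  exists2 d : R, 0 < d & forall w, nc (w - z) < d ->
    nc (f w - f z - l * (w - z)) <= e * nc (w - z)) -> cdv f z l.
Proof.
move=> H; exists (fun w => if w == z then l else (f w - f z) / (w - z)); split.
- move=> w; case: eqP => [->|/eqP wz]; first by rewrite subrr mulr0 addr0.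
  by rewrite divfK ?subr_eq0 // addrC subrK.
- by rewrite eqxx.
- move=> e e0; have [d d0 h] := H (e / 2) ltac:(lra); exists d => // w wd.
  rewrite eqxx; case: eqP => [_|/eqP wz]; first by rewrite subrr nc0.
  have wz0 : w - z != 0 by rewrite subr_eq0.
  have := h _ wd.
  have -> : (f w - f z) / (w - z) - l = (f w - f z - l * (w - z)) / (w - z) by field.
  rewrite nc_div => b; rewrite ltr_pdivrMr ?nc_gt0 //; apply: (le_lt_trans b).
  by rewrite ltr_pM2r ?nc_gt0 //; lra.
Qed.

Lemma cdv_uniq f z l m : cdv f z l -> cdv f z m -> l = m.
Proof.
move=> df dg; apply: eq_of_nc_small => e e0.
have [d1 d10 h1] := cdv_eps df (e := e / 2) ltac:(lra).
have [d2 d20 h2] := cdv_eps dg (e := e / 2) ltac:(lra).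
pose t := Num.min d1 d2 / 2.
have t0 : 0 < t by rewrite divr_gt0 // lt_min d10.
have tC : nc (t%:C%C : C) = t by rewrite nc_real gtr0_norm.
have td : t < d1 /\ t < d2.
  have : Num.min d1 d2 <= d1 /\ Num.min d1 d2 <= d2 by rewrite !ge_min !lexx orbT.
  by rewrite /t in t0 *; lra.
pose w := z + t%:C%C.
have wz : w - z = t%:C%C by rewrite /w addrAC subrr add0r.
have := h1 w; have := h2 w; rewrite wz tC => /(_ td.2) b2 /(_ td.1) b1.
rewrite -(ler_pM2r t0) -{1}tC -ncM.
have -> : (l - m) * t%:C%C = (f w - f z - m * t%:C%C) - (f w - f z - l * t%:C%C) by ring.
apply: (le_trans (ncB _ _)); lra.
Qed.

End ComplexDerivative.

(** * The mean value inequality *)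

Section MeanValue.
Variable R : realType.
Local Notation C := (R[i]).
Implicit Types (f g : C -> C) (x y z w : C).

(** Compactness of an interval in the form of Cousin's lemma: an additive property of intervals that
    holds for all short intervals around each tag [u] holds globally. It serves every continuation
    argument along a segment or across a disc. *)
Lemma cousin (P : R -> R -> Prop) (a b : R) : a <= b ->
  (forall s c t, s <= c -> c <= t -> P s c -> P c t -> P s t) ->
  (forall u, a <= u -> u <= b -> exists2 d, 0 < d & forall s t,
     u - d < s -> s <= u -> u <= t -> t < u + d -> a <= s -> t <= b -> P s t) ->
  P a b.
Proof.
move=> ab Padd Ploc.
pose A := [set t | [/\ a <= t, t <= b & P a t]].
have Aa : A a.
  by split=> //; have [d d0 h] := Ploc a (lexx _) ab; apply: h => //; lra.
have hsA : has_sup A by split; [exists a|exists b => t []].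
have ubA t : A t -> t <= sup A by move=> At; apply: (ub_le_sup _ At); exact: hsA.2.
have ac : a <= sup A by exact: ubA.
have cb : sup A <= b by apply: ge_sup; [exists a|move=> t []].
have [d d0 h] := Ploc _ ac cb.
have [t [at_ tb Pat] tc] := sup_adherent d0 hsA.
have tc' : t <= sup A by apply: ubA.
pose t' := Num.min b (sup A + d / 2).
have ct' : sup A <= t' by rewrite le_min cb /=; lra.
have t'c : t' < sup A + d by rewrite gt_min; apply/orP; right; lra.
have Pt' : P a t'.
  apply: (Padd _ t) => //; first exact: (le_trans tc').
  by apply: h => //; rewrite ge_min lexx.
have : A t' by split=> //; [exact: (le_trans ac)|rewrite ge_min lexx].
move/ubA => t'c'.
suff -> : b = t' by [].
rewrite /t' in t'c' *; case: (leP b (sup A + d / 2)) t'c' => //; lra.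
Qed.

Definition seg x y (t : R) : C := x + t%:C%C * (y - x).

Lemma seg0 x y : seg x y 0 = x.
Proof. by rewrite /seg mul0r addr0. Qed.

Lemma seg1 x y : seg x y 1 = y.
Proof. by rewrite /seg mul1r addrC subrK. Qed.

Lemma nc_segB x y s t : nc (seg x y t - seg x y s) = `|t - s| * nc (y - x).
Proof.
have -> : seg x y t - seg x y s = (t - s)%:C%C * (y - x).
  by rewrite /seg rmorphB /=; ring.
by rewrite ncM nc_real.
Qed.

Lemma nc_seg_le x y t (r : R) : 0 <= t -> t <= 1 -> nc x <= r -> nc y <= r ->
  nc (seg x y t) <= r.
Proof.
move=> t0 t1 xr yr.
have -> : seg x y t = (1 - t)%:C%C * x + t%:C%C * y by rewrite /seg rmorphB /= ; ring.
apply: (le_trans (ncD _ _)); rewrite !ncM !nc_real !ger0_norm //; last lra.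
have : (1 - t) * nc x <= (1 - t) * r by apply: ler_wpM2l => //; lra.
have : t * nc y <= t * r by apply: ler_wpM2l.
lra.
Qed.

Lemma nc_seg_lt x y t (r : R) : 0 <= t -> t <= 1 -> nc x < r -> nc y < r ->
  nc (seg x y t) < r.
Proof.
move=> t0 t1 xr yr; apply: (@le_lt_trans _ _ (Num.max (nc x) (nc y))).
  by apply: nc_seg_le => //; rewrite le_max lexx ?orbT.
by rewrite gt_max xr yr.
Qed.

Lemma segBc x y t c : seg x y t - c = seg (x - c) (y - c) t.
Proof. by rewrite /seg; ring. Qed.

(** Rolle's theorem fails for complex values. The bound with [M + e] in place of [M] is additive
    over subintervals and holds locally by differentiability at the tag, so [cousin] applies; then
    [e] tends to 0. *)
Lemma mean_value f f' x y (M : R) :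
  (forall t, 0 <= t -> t <= 1 -> cdv f (seg x y t) (f' (seg x y t))) ->
  (forall t, 0 <= t -> t <= 1 -> nc (f' (seg x y t)) <= M) ->
  nc (f y - f x) <= M * nc (y - x).
Proof.
move=> df bf; apply/ler_addgt0Pl => e0 e00.
set L := nc (y - x); have L0 : 0 <= L by exact: nc_ge0.
pose e := e0 / (L + 1).
have e_gt0 : 0 < e by rewrite divr_gt0 //; lra.
suff : nc (f (seg x y 1) - f (seg x y 0)) <= (M + e) * L * (1 - 0).
  rewrite seg0 seg1 => h; apply: (le_trans h).
  rewrite subr0 mulr1 mulrDl addrC lerD2r /e mulrAC ler_pdivrMr; last lra.
  by rewrite ler_pM2l //; lra.
apply: (@cousin (fun s t => nc (f (seg x y t) - f (seg x y s)) <= (M + e) * L * (t - s))) => //.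
  move=> s c t sc ct h1 h2.
  have := nc_triangle (f (seg x y t)) (f (seg x y c)) (f (seg x y s)); lra.
move=> u u0 u1; have [d d0 h] := cdv_eps (df u u0 u1) e_gt0.
exists (d / (L + 1)); first by rewrite divr_gt0 //; lra.
have key t : `|t - u| < d / (L + 1) ->
    nc (f (seg x y t) - f (seg x y u)) <= (M + e) * L * `|t - u|.
  move=> tu.
  have ltd : nc (seg x y t - seg x y u) < d.
    rewrite nc_segB; move: tu; rewrite ltr_pdivlMr; last lra.
    apply: le_lt_trans; apply: ler_wpM2l => //; rewrite -/L; lra.
  have h1 := h _ ltd.
  have h2 := bf _ u0 u1.
  have := ncD (f (seg x y t) - f (seg x y u) - f' (seg x y u) * (seg x y t - seg x y u))
              (f' (seg x y u) * (seg x y t - seg x y u)).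
  rewrite subrK ncM => h3.
  have : nc (f' (seg x y u)) * nc (seg x y t - seg x y u) <=
         M * nc (seg x y t - seg x y u) by apply: ler_wpM2r => //; exact: nc_ge0.
  rewrite nc_segB -/L in h1 h3 *; lra.
move=> s t us su ut tu _ _.
have ks := key s; have kt := key t; rewrite ger0_norm ?subr_ge0 // in kt.
rewrite ler0_norm ?subr_le0 // opprB in ks.
have := kt ltac:(lra); have := ks ltac:(lra).
have := nc_triangle (f (seg x y t)) (f (seg x y u)) (f (seg x y s)).
rewrite (nc_distC (f (seg x y u))); lra.
Qed.

End MeanValue.

(** * Holomorphic functions on open sets *)

Section Holomorphic.
Variable R : realType.
Local Notation C := (R[i]).
Implicit Types (f g : C -> C) (x y z w : C) (U V : set C).

Definition disc (c : C) (r : R) : set C := [set z | nc (z - c) < r].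

Definition copen U := forall z, U z -> exists2 r : R, 0 < r & disc z r `<=` U.

Definition cconvex U := forall x y t, U x -> U y -> 0 <= t -> t <= 1 -> U (seg x y t).

Lemma disc_open c r : copen (disc c r).
Proof.
move=> z zr; rewrite /disc /= in zr; exists (r - nc (z - c)); first lra.
move=> w; rewrite /disc /=; have := nc_triangle w z c; lra.
Qed.

Lemma disc_convex c r : cconvex (disc c r).
Proof. by move=> x y t xd yd t0 t1; rewrite /disc /= segBc; exact: nc_seg_lt. Qed.

Lemma disc_center c (r : R) : 0 < r -> disc c r c.
Proof. by rewrite /disc /= subrr nc0. Qed.

Lemma disc_mono c r r' : r <= r' -> disc c r `<=` disc c r'.
Proof. by move=> rr z /lt_le_trans; exact. Qed.

Lemma disc0E r z : disc 0 r z = (nc z < r) :> Prop.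
Proof. by rewrite /disc /= subr0. Qed.

Definition dv f z : C := xget 0 [set l | cdv f z l].

Lemma dvP f z l : cdv f z l -> cdv f z (dv f z).
Proof. by move=> h; apply: (@xgetPex _ 0 [set l | cdv f z l]); exists l. Qed.

Lemma dvE f z l : cdv f z l -> dv f z = l.
Proof. by move=> h; apply: (cdv_uniq (dvP h)). Qed.

(* Asking for complex derivatives of every order from the start makes Cauchy's integral
   formula unnecessary. *)
Fixpoint Hn n U f : Prop :=
  if n is m.+1 then (forall z, U z -> cdv f z (dv f z)) /\ Hn m U (dv f) else True.

Definition Hol U f := forall n, Hn n U f.

Lemma dv_near f g z (d : R) : 0 < d -> (forall w, nc (w - z) < d -> f w = g w) ->
  dv f z = dv g z.
Proof.
move=> d0 fg; congr (xget _ _); apply/seteqP; split=> l /=.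
  exact: (cdv_near d0 fg).
by apply: (cdv_near d0) => w /fg.
Qed.

Lemma Hn_ext n U f g : copen U -> (forall z, U z -> f z = g z) -> Hn n U f -> Hn n U g.
Proof.
move=> oU; elim: n f g => // n IH f g fg [df Hf]; split.
  move=> z Uz; have [r r0 rU] := oU z Uz.
  by apply: dvP; apply: (cdv_near r0 _ (df z Uz)) => w /rU /fg.
apply: IH Hf => z Uz; have [r r0 rU] := oU z Uz.
by apply: (dv_near r0) => w /rU /fg.
Qed.

Lemma Hn_sub n U V f : V `<=` U -> Hn n U f -> Hn n V f.
Proof. by move=> VU; elim: n f => // n IH f [df /IH ?]; split=> // z /VU /df. Qed.

Lemma HnS n U f : Hn n.+1 U f -> Hn n U f.
Proof. by elim: n f => // n IH f [df /IH ?]. Qed.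

Lemma Hn_intro n U f f' : copen U -> (forall z, U z -> cdv f z (f' z)) -> Hn n U f' ->
  Hn n.+1 U f.
Proof.
move=> oU df Hf'; split; first by move=> z /df /dvP.
by apply: Hn_ext Hf' => // z /df /dvE ->.
Qed.

Lemma Hn_cst n U c : copen U -> Hn n U (fun=> c).
Proof.
move=> oU; elim: n c => // n IH c.
by apply: (@Hn_intro _ _ _ (fun=> 0)) => // z _; exact: cdv_cst.
Qed.

Lemma Hn_id n U : copen U -> Hn n U id.
Proof.
case: n => // n oU; apply: (@Hn_intro _ _ _ (fun=> 1)) => //; last exact: Hn_cst.
by move=> z _; exact: cdv_id.
Qed.

Lemma HnD n U f g : copen U -> Hn n U f -> Hn n U g -> Hn n U (fun z => f z + g z).
Proof.
move=> oU; elim: n f g => // n IH f g [df Hf] [dg Hg].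
apply: (@Hn_intro _ _ _ (fun z => dv f z + dv g z)) => //; last exact: IH.
by move=> z Uz; apply: cdvD; [exact: df|exact: dg].
Qed.

Lemma HnM n U f g : copen U -> Hn n U f -> Hn n U g -> Hn n U (fun z => f z * g z).
Proof.
move=> oU; elim: n f g => // n IH f g Hf Hg.
apply: (@Hn_intro _ _ _ (fun z => dv f z * g z + f z * dv g z)) => //.
  by move=> z Uz; apply: cdvM; [exact: Hf.1|exact: Hg.1].
by apply: HnD => //; apply: IH; [exact: Hf.2|exact: HnS|exact: HnS|exact: Hg.2].
Qed.

Lemma HnV n U f : copen U -> (forall z, U z -> f z != 0) -> Hn n U f ->
  Hn n U (fun z => (f z)^-1).
Proof.
move=> oU f0; elim: n => // n IH Hf.
have Hi := IH (HnS Hf).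
apply: (@Hn_intro _ _ _ (fun z => (-1) * ((f z)^-1 * (f z)^-1) * dv f z)) => //.
  move=> z Uz; have := cdvV (Hf.1 z Uz) (f0 z Uz).
  by rewrite -exprVn expr2 mulN1r.
apply: HnM => //; last exact: Hf.2.
by apply: HnM => //; [exact: Hn_cst|exact: HnM].
Qed.

Lemma Hn_comp n U V f g : copen U -> copen V -> (forall z, U z -> V (f z)) ->
  Hn n U f -> Hn n V g -> Hn n U (fun z => g (f z)).
Proof.
move=> oU oV UV; elim: n f g UV => // n IH f g UV Hf Hg.
apply: (@Hn_intro _ _ _ (fun z => dv g (f z) * dv f z)) => //.
  by move=> z Uz; apply: cdv_comp; [exact: Hf.1|apply: Hg.1; exact: UV].
by apply: HnM => //; [apply: IH => //; [exact: HnS|exact: Hg.2]|exact: Hf.2].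
Qed.

Lemma Hn_local n U f : (forall z, U z -> exists V, V z /\ Hn n V f) -> Hn n U f.
Proof.
elim: n f => // n IH f H; split; first by move=> z /H[V [Vz [/(_ z Vz)]]].
by apply: IH => z /H[V [Vz [_ ?]]]; exists V.
Qed.

Lemma Hol_ext U f g : copen U -> (forall z, U z -> f z = g z) -> Hol U f -> Hol U g.
Proof. by move=> oU fg Hf n; exact: (Hn_ext oU fg). Qed.

Lemma Hol_sub U V f : V `<=` U -> Hol U f -> Hol V f.
Proof. by move=> VU Hf n; exact: (Hn_sub VU). Qed.

Lemma Hol_cdv U f z : Hol U f -> U z -> cdv f z (dv f z).
Proof. by move=> /(_ 1%N)[h _] /h. Qed.

Lemma Hol_dv U f : Hol U f -> Hol U (dv f).
Proof. by move=> Hf n; have [] := Hf n.+1. Qed.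

Lemma Hol_cont U f z : Hol U f -> U z -> ccont f z.
Proof. by move=> Hf Uz; exact: (cdv_cont (Hol_cdv Hf Uz)). Qed.

Lemma Hol_cst U c : copen U -> Hol U (fun=> c).
Proof. by move=> oU n; exact: Hn_cst. Qed.

Lemma Hol_id U : copen U -> Hol U id.
Proof. by move=> oU n; exact: Hn_id. Qed.

Lemma HolD U f g : copen U -> Hol U f -> Hol U g -> Hol U (fun z => f z + g z).
Proof. by move=> oU Hf Hg n; exact: HnD. Qed.

Lemma HolM U f g : copen U -> Hol U f -> Hol U g -> Hol U (fun z => f z * g z).
Proof. by move=> oU Hf Hg n; exact: HnM. Qed.

Lemma HolZ U c f : copen U -> Hol U f -> Hol U (fun z => c * f z).
Proof. by move=> oU Hf; apply: HolM => //; exact: Hol_cst. Qed.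

Lemma HolN U f : copen U -> Hol U f -> Hol U (fun z => - f z).
Proof.
by move=> oU Hf; apply: (@Hol_ext _ (fun z => (-1) * f z)) => // [z _|];
  [rewrite mulN1r|exact: HolZ].
Qed.

Lemma HolB U f g : copen U -> Hol U f -> Hol U g -> Hol U (fun z => f z - g z).
Proof. by move=> oU Hf Hg; apply: HolD => //; exact: HolN. Qed.

Lemma HolBc U f c : copen U -> Hol U f -> Hol U (fun z => f z - c).
Proof. by move=> oU Hf; apply: HolB => //; exact: Hol_cst. Qed.

Lemma HolX U f m : copen U -> Hol U f -> Hol U (fun z => f z ^+ m).
Proof.
move=> oU Hf; elim: m => [|m IH]; first by apply: (@Hol_ext _ (fun=> 1)) => //; exact: Hol_cst.
apply: (@Hol_ext _ (fun z => f z * f z ^+ m)) => // [z _|]; first by rewrite exprS.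
exact: HolM.
Qed.

Lemma HolV U f : copen U -> (forall z, U z -> f z != 0) -> Hol U f ->
  Hol U (fun z => (f z)^-1).
Proof. by move=> oU f0 Hf n; exact: HnV. Qed.

Lemma Hol_div U f g : copen U -> (forall z, U z -> g z != 0) -> Hol U f -> Hol U g ->
  Hol U (fun z => f z / g z).
Proof. by move=> oU g0 Hf Hg; apply: HolM => //; exact: HolV. Qed.

Lemma Hol_comp U V f g : copen U -> copen V -> (forall z, U z -> V (f z)) ->
  Hol U f -> Hol V g -> Hol U (fun z => g (f z)).
Proof. by move=> oU oV UV Hf Hg n; exact: (Hn_comp oU oV). Qed.

Lemma Hol_local U f : (forall z, U z -> exists V, V z /\ Hol V f) -> Hol U f.
Proof. by move=> H n; apply: Hn_local => z /H[V [Vz HV]]; exists V. Qed.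

Lemma Hol_mean_value U f x y (M : R) : cconvex U -> Hol U f -> U x -> U y ->
  (forall w, U w -> nc (dv f w) <= M) -> nc (f y - f x) <= M * nc (y - x).
Proof.
move=> cU Hf Ux Uy bM; apply: (@mean_value _ _ (dv f)) => t t0 t1.
  by apply: Hol_cdv Hf _; exact: cU.
by apply: bM; exact: cU.
Qed.

End Holomorphic.

(** * Limits along a free ultrafilter *)

Section UltraLimit.
Variable R : realType.
Local Notation C := (R[i]).
Implicit Types (u v : nat -> C) (l m : C) (A B : set nat).

Lemma free_ultrafilter_nat : exists F : set_system nat, UltraFilter F /\ \oo `<=` F.
Proof. exact: ultraFilterLemma. Qed.

(* Limits along a fixed free ultrafilter replace the extraction of convergent
   subsequences: all bounded sequences converge at once. *)
Definition ufn : set_system nat := projT1 (cid free_ultrafilter_nat).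

Lemma ufn_ultra : UltraFilter ufn.
Proof. by rewrite /ufn; case: cid => F []. Qed.
Local Existing Instance ufn_ultra.

Lemma ufnI A B : ufn A -> ufn B -> ufn (fun n => A n /\ B n).
Proof. exact: filterI. Qed.

Lemma ufnS A B : (forall n, A n -> B n) -> ufn A -> ufn B.
Proof. exact: filterS. Qed.

Lemma ufnT A : (forall n, A n) -> ufn A.
Proof. by move=> h; apply: filterS filterT. Qed.

Lemma ufn_ge N : ufn [set n | (N <= n)%N].
Proof. by rewrite /ufn; case: cid => F /= [_]; apply; exact: nbhs_infty_ge. Qed.

Lemma ufn_ex A : ufn A -> exists n, A n.
Proof. exact: filter_ex. Qed.

Lemma ufn_orN A : ufn A \/ ufn (fun n => ~ A n).
Proof. exact: in_ultra_setVsetC. Qed.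

Definition isul u l := forall e : R, 0 < e -> ufn [set n | nc (u n - l) < e].

(** The limit is the supremum of the [x] with [x <= u n] for almost all [n]; the dichotomy of
    ultrafilters turns the failure of a lower bound into an upper bound. *)
Lemma real_ultralimit (u : nat -> R) (M : R) : ufn [set n | `|u n| <= M] ->
  exists l : R, forall e : R, 0 < e -> ufn [set n | `|u n - l| < e].
Proof.
move=> bu; pose E := [set x | ufn [set n | x <= u n]].
have E0 : E (- M) by apply: ufnS bu => n /=; rewrite ler_norml => /andP[].
have ubE x : E x -> x <= M.
  move=> Ex; have [n [/= xu]] := ufn_ex (ufnI Ex bu).
  by rewrite ler_norml => /andP[_]; exact: le_trans.
have hsE : has_sup E by split; [exists (- M)|exists M].
exists (sup E) => e e0.
have [x Ex xl] := sup_adherent e0 hsE.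
have [Ee|nEe] := ufn_orN [set n | sup E + e / 2 <= u n].
  have : sup E + e / 2 <= sup E by apply: ub_le_sup => //; exact: hsE.2.
  lra.
apply: ufnS (ufnI Ex nEe) => n [/= xu /negP]; rewrite -ltNge => ul.
by rewrite ltr_norml; apply/andP; split; lra.
Qed.

Lemma ultralimit u (M : R) : ufn [set n | nc (u n) <= M] -> exists l, isul u l.
Proof.
move=> bu.
have [a ha] := @real_ultralimit (fun n => complex.Re (u n)) M
  ltac:(by apply: ufnS bu => n /= h; apply: le_trans (Re_le_nc _) h).
have [b hb] := @real_ultralimit (fun n => complex.Im (u n)) M
  ltac:(by apply: ufnS bu => n /= h; apply: le_trans (Im_le_nc _) h).
exists (Complex a b) => e e0.
apply: ufnS (ufnI (ha (e / 2) ltac:(lra)) (hb (e / 2) ltac:(lra))) => n [/= h1 h2].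
apply: le_lt_trans (nc_le_ReIm _) _.
by rewrite ReD ImD ReN ImN /=; lra.
Qed.

Definition ulim u : C := xget 0 [set l | isul u l].

Lemma isul_uniq u l m : isul u l -> isul u m -> l = m.
Proof.
move=> hl hm; apply: eq_of_nc_small => e e0.
have [n [/= h1 h2]] := ufn_ex (ufnI (hl (e / 2) ltac:(lra)) (hm (e / 2) ltac:(lra))).
by have := nc_triangle l (u n) m; rewrite (nc_distC l (u n)); lra.
Qed.

Lemma ulimE u l : isul u l -> ulim u = l.
Proof.
move=> h; apply: (isul_uniq _ h).
by apply: (@xgetPex _ 0 [set l | isul u l]); exists l.
Qed.

Lemma ulimP u (M : R) : ufn [set n | nc (u n) <= M] -> isul u (ulim u).
Proof. by move=> /ultralimit[l h]; rewrite (ulimE h). Qed.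

Lemma isul_near u v l : ufn [set n | u n = v n] -> isul u l -> isul v l.
Proof.
by move=> uv h e e0; apply: ufnS (ufnI uv (h _ e0)) => n [/= <-].
Qed.

Lemma isul_cst l : isul (fun=> l) l.
Proof. by move=> e e0; apply: ufnT => n /=; rewrite subrr nc0. Qed.

Lemma isulD u v l m : isul u l -> isul v m -> isul (fun n => u n + v n) (l + m).
Proof.
move=> hl hm e e0.
apply: ufnS (ufnI (hl (e / 2) ltac:(lra)) (hm (e / 2) ltac:(lra))) => n [/= h1 h2].
rewrite opprD addrACA; have := ncD (u n - l) (v n - m); lra.
Qed.

Lemma isul_ccont (f : C -> C) u l : isul u l -> ccont f l -> isul (fun n => f (u n)) (f l).
Proof. by move=> hl cf e /cf[d d0 h]; apply: ufnS (hl _ d0) => n /h. Qed.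

Lemma isulZ c u l : isul u l -> isul (fun n => c * u n) (c * l).
Proof.
move=> hl; apply: (@isul_ccont (fun w => c * w)) => //.
by apply: ccontM; [exact: ccont_cst|exact: ccont_id].
Qed.

Lemma isulB u v l m : isul u l -> isul v m -> isul (fun n => u n - v n) (l - m).
Proof.
move=> hl hm; rewrite -mulN1r.
apply: (@isul_near (fun n => u n + (-1) * v n)); first by apply: ufnT => n /=; rewrite mulN1r.
by apply: isulD => //; exact: isulZ.
Qed.

Lemma isul_sqr u l : isul u l -> isul (fun n => u n ^+ 2) (l ^+ 2).
Proof.
move=> hl; apply: (@isul_ccont (fun w => w ^+ 2)) => //.
apply: (@ccont_near _ (fun w => w * w) _ _ 1) => //.
by apply: ccontM; exact: ccont_id.
Qed.

Lemma isul_le u l (M : R) : isul u l -> ufn [set n | nc (u n) <= M] -> nc l <= M.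
Proof.
move=> hl bu; apply/ler_addgt0Pl => e e0.
have [n [/= h1 h2]] := ufn_ex (ufnI (hl _ e0) bu).
by have := ncB_ge l (u n); rewrite nc_distC; lra.
Qed.

Lemma isul_ge u l (M : R) : isul u l -> ufn [set n | M <= nc (u n)] -> M <= nc l.
Proof.
move=> hl bu; apply/ler_addgt0Pl => e e0.
have [n [/= h1 h2]] := ufn_ex (ufnI (hl _ e0) bu).
by have := ncB_ge (u n) l; lra.
Qed.

Lemma inv_nat_small (e : R) : 0 < e -> ufn [set n | n.+1%:R^-1 < e].
Proof.
move=> e0; pose N := Num.truncn e^-1.
apply: ufnS (ufn_ge N) => n /= Nn.
rewrite invf_plt ?posrE ?ltr0n //; apply: (lt_le_trans (truncnS_gt _)).
by rewrite ler_nat ltnS.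
Qed.

(** Compactness of [K] is given as boundedness and closedness; any sequence in [K] then converges
    along [ufn] to a point of [K]. This is used twice: for values exceeding every integer, then for
    a maximising sequence. *)
Lemma extreme_value (K : set C) (v : C -> R) (B : R) :
  (exists z, K z) -> (forall z, K z -> nc z <= B) ->
  (forall z, (forall e : R, 0 < e -> exists2 w, K w & nc (w - z) < e) -> K z) ->
  (forall z, K z -> ccont (fun w => (v w)%:C%C) z) ->
  exists2 z, K z & forall w, K w -> v w <= v z.
Proof.
move=> [z0 Kz0] KB Kcl vc.
have lim_in (u : nat -> C) : (forall n, K (u n)) -> K (ulim u) /\ isul u (ulim u).
  move=> Ku; have hu : isul u (ulim u) by apply: (@ulimP _ B); apply: ufnT => n; exact: KB.
  split=> //; apply: Kcl => e /hu /ufn_ex[n /= h]; exists (u n) => //.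
have vlim (u : nat -> C) : (forall n, K (u n)) -> forall e : R, 0 < e ->
    ufn [set n | `|v (u n) - v (ulim u)| < e].
  move=> Ku e e0; have [Kl hl] := lim_in _ Ku.
  have := isul_ccont hl (vc _ Kl) e0; apply: ufnS => n /=.
  by rewrite -(rmorphB (real_complex R)) nc_real.
pose E := [set x | exists2 z, K z & v z = x].
have ubE : has_ubound E.
  apply: contrapT => nub.
  have ex (n : nat) : exists z, K z /\ n%:R <= v z.
    apply: contrapT => ne; apply: nub; exists n%:R => x [z Kz <-].
    by rewrite leNgt; apply/negP => /ltW ?; apply: ne; exists z.
  have [u uP] := choice ex.
  have h := vlim u (fun n => (uP n).1) 1 ltr01.
  pose N := Num.truncn (v (ulim u) + 1).
  have [n [/= h1 h2]] := ufn_ex (ufnI h (ufn_ge N.+1)).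
  have h3 := (uP n).2; have h4 : v (ulim u) + 1 < N.+1%:R := truncnS_gt _.
  have h5 : N.+1%:R <= n%:R :> R by rewrite ler_nat.
  have h6 : v (u n) - v (ulim u) < 1 by move: h1; rewrite ltr_norml => /andP[].
  have : v (u n) < v (u n) by lra.
  by rewrite ltxx.
have hsE : has_sup E by split=> //; exists (v z0), z0.
have ex (n : nat) : exists z, K z /\ sup E - n.+1%:R^-1 < v z.
  have n0 : 0 < n.+1%:R^-1 :> R by rewrite invr_gt0 ltr0n.
  by have [x [z Kz <-] h] := sup_adherent n0 hsE; exists z.
have [u uP] := choice ex; have Ku n := (uP n).1.
exists (ulim u); first by have [] := lim_in _ Ku.
move=> w Kw; apply: (@le_trans _ _ (sup E)); first by apply: ub_le_sup => //; exists w.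
apply/ler_addgt0Pl => e e0.
have [n [/= h1 h2]] := ufn_ex (ufnI (vlim _ Ku (e / 2) ltac:(lra))
   (inv_nat_small (e := e / 2) ltac:(lra))).
have := (uP n).2; move: h1 h2; set q := n.+1%:R^-1; rewrite ltr_norml => /andP[_ h1] h2 h3.
lra.
Qed.

End UltraLimit.

(** * The maximum principle *)

Section MaximumPrinciple.
Variable R : realType.
Local Notation C := (R[i]).
Implicit Types (f g : C -> C) (x y z w : C) (U V : set C).

Lemma ccont_nc f z : ccont f z -> ccont (fun w => (nc (f w))%:C%C) z.
Proof.
move=> cf e /cf[d d0 h]; exists d => // w /h; apply: le_lt_trans.
rewrite -(rmorphB (real_complex R)) nc_real ler_norml; apply/andP; split.
  by have := ncB_ge (f z) (f w); rewrite nc_distC; lra.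
exact: ncB_ge.
Qed.

Lemma ccont_ncid z : ccont (fun w : C => (nc w)%:C%C) z.
Proof. by apply: (@ccont_nc id); exact: ccont_id. Qed.

Lemma nc_parallelogram x y : nc (x + y) ^+ 2 + nc (x - y) ^+ 2 = 2 * nc x ^+ 2 + 2 * nc y ^+ 2.
Proof. by rewrite !nc_sqr !ReD !ImD !ReN !ImN; ring. Qed.

(** The derivative of [f] minus its quadratic polynomial is small compared with the distance to [z],
    by differentiability of [dv f]; the mean value inequality integrates this. *)
Lemma taylor_young f z (r : R) : 0 < r -> Hol (disc z r) f -> forall e : R, 0 < e ->
  exists2 d : R, 0 < d & forall w, nc (w - z) < d ->
  nc (f w - (f z + dv f z * (w - z) + dv (dv f) z / 2 * (w - z) ^+ 2)) <= e * nc (w - z) ^+ 2.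
Proof.
move=> r0 Hf e e0.
have zd : disc z r z by exact: disc_center.
have [d d0 h] := cdv_eps (Hol_cdv (Hol_dv Hf) zd) e0.
exists (Num.min d r); first by rewrite lt_min d0.
move=> w; rewrite lt_min => /andP[wd wr].
pose a := f z; pose b := dv f z; pose c := dv (dv f) z.
pose g y := f y - (a + b * (y - z) + c / 2 * ((y - z) * (y - z))).
have dg y : disc z r y -> cdv g y (dv f y - b - c * (y - z)).
  move=> yr.
  have -> : dv f y - b - c * (y - z) =
    dv f y - (0 + (0 * (y - z) + b * (1 - 0)) +
      (0 * ((y - z) * (y - z)) + c / 2 * ((1 - 0) * (y - z) + (y - z) * (1 - 0)))) by field.
  apply: cdvB; first exact: Hol_cdv Hf yr.
  have dyz : cdv (fun y => y - z) y (1 - 0).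
    by apply: cdvB; [exact: cdv_id|exact: cdv_cst].
  apply: cdvD; [apply: cdvD|].
  - exact: cdv_cst.
  - by apply: (@cdvM _ (fun=> b) (fun y => y - z)) => //; exact: cdv_cst.
  - apply: (@cdvM _ (fun=> c / 2) (fun y => (y - z) * (y - z))); first exact: cdv_cst.
    exact: (@cdvM _ (fun y => y - z) (fun y => y - z)).
have segd t : 0 <= t -> t <= 1 -> nc (seg z w t - z) <= nc (w - z).
  by move=> t0 t1; rewrite segBc; apply: nc_seg_le => //; rewrite subrr nc0 nc_ge0.
have -> : f w - (f z + dv f z * (w - z) + dv (dv f) z / 2 * (w - z) ^+ 2) = g w - g z.
  by rewrite /g /a /b /c; ring.
rewrite expr2 mulrA; apply: (@mean_value _ g (fun y => dv f y - b - c * (y - z))) => t t0 t1.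
  by apply: dg; exact: le_lt_trans (segd t t0 t1) _.
apply: (le_trans (h _ (le_lt_trans (segd t t0 t1) wd))).
by rewrite ler_pM2l // segd.
Qed.

(** Two uses of the mean value inequality; this costs the factor 1/2 of the sharp bound. *)
Lemma taylor_bound f z (r K : R) w : Hol (disc z r) f -> disc z r w ->
  (forall y, disc z r y -> nc (dv (dv f) y) <= K) ->
  nc (f w - f z - dv f z * (w - z)) <= K * nc (w - z) ^+ 2.
Proof.
move=> Hf wr bK.
have segd t : 0 <= t -> t <= 1 -> nc (seg z w t - z) <= nc (w - z).
  by move=> t0 t1; rewrite segBc; apply: nc_seg_le => //; rewrite subrr nc0 nc_ge0.
have r0 : 0 < r by apply: le_lt_trans (nc_ge0 _) wr.
have zr : disc z r z by exact: disc_center.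
have segr t : 0 <= t -> t <= 1 -> disc z r (seg z w t).
  by move=> t0 t1; apply: disc_convex.
have -> : f w - f z - dv f z * (w - z) =
  (f w - dv f z * w) - (f z - dv f z * z) by ring.
rewrite expr2 mulrA.
apply: (@mean_value _ (fun y => f y - dv f z * y) (fun y => dv f y - dv f z)) => t t0 t1.
  apply: cdvB; first by apply: (Hol_cdv Hf); exact: segr.
  exact: cdv_mulc.
apply: (@le_trans _ _ (K * nc (seg z w t - z))).
  apply: (Hol_mean_value (@disc_convex R z r) (Hol_dv Hf)) => //; exact: segr.
apply: ler_wpM2l; last exact: segd.
exact: le_trans (nc_ge0 _) (bK z zr).
Qed.

(* The Laplacian of |f|^2 + eta |z|^2 is 4 |f'|^2 + 4 eta > 0: this is tested with the
   second differences in the directions 1 and i. *)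
Lemma no_interior_max f z (r eta : R) : 0 < r -> 0 < eta -> Hol (disc z r) f ->
  ~ (forall w, disc z r w ->
       nc (f w) ^+ 2 + eta * nc w ^+ 2 <= nc (f z) ^+ 2 + eta * nc z ^+ 2).
Proof.
move=> r0 eta0 Hf Hmax.
set a := f z; set b := dv f z; set c := dv (dv f) z / 2.
pose A := nc a + nc b + nc c + 1.
have A0 : 0 < A by rewrite /A; have := nc_ge0 a; have := nc_ge0 b; have := nc_ge0 c; lra.
(* The four Taylor errors [2 * A * (e * t ^+ 2)] then add up to [2 * eta * t ^+ 2], half of the
   [4 * eta * t ^+ 2] gained by the term [eta * nc z ^+ 2] in the four directions. *)
pose e := eta / (4 * A).
have e0 : 0 < e by rewrite divr_gt0 // mulr_gt0.
have [d d0 h] := taylor_young r0 Hf e0.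
pose t := Num.min 1 (Num.min r d) / 2.
have t0 : 0 < t by rewrite divr_gt0 // !lt_min ltr01 r0.
have [t1 tr td] : [/\ t < 1, t < r & t < d].
  have : Num.min 1 (Num.min r d) <= 1 /\ Num.min 1 (Num.min r d) <= r /\
         Num.min 1 (Num.min r d) <= d by rewrite !ge_min !lexx !orbT.
  by rewrite /t in t0 *; split; lra.
have low (k : C) : nc k = t -> nc (a + b * k + c * k ^+ 2) ^+ 2 - 2 * A * (e * t ^+ 2) <=
    nc (f (z + k)) ^+ 2.
  move=> kt; have := h (z + k); rewrite [z + k - z]addrAC subrr add0r kt => /(_ td) h1.
  set p := a + _ + _ in h1 *.
  have pA : nc p <= A.
    apply: le_trans (ncD _ _) _; rewrite ncM ncX kt.
    have : nc (a + b * k) <= nc a + nc b * t by apply: le_trans (ncD _ _) _; rewrite ncM kt.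
    have : nc b * t <= nc b by rewrite ler_piMr ?nc_ge0 // ltW.
    have : nc c * t ^+ 2 <= nc c by rewrite ler_piMr ?nc_ge0 // exprn_ile1 // ltW.
    rewrite /A; lra.
  have q0 : 0 <= e * t ^+ 2 by rewrite mulr_ge0 ?ltW // exprn_gt0.
  have pf : nc p <= nc (f (z + k)) + e * t ^+ 2.
    have := ncB_ge p (f (z + k)); rewrite nc_distC; lra.
  have p0 := nc_ge0 p; have f0 := nc_ge0 (f (z + k)).
  have m1 : nc p * (e * t ^+ 2) <= A * (e * t ^+ 2) by apply: ler_wpM2r.
  have [le1|gt1] := leP (nc p) (e * t ^+ 2).
    have : nc p * nc p <= nc p * (e * t ^+ 2) by apply: ler_wpM2l.
    have : 0 <= nc (f (z + k)) ^+ 2 by rewrite sqr_ge0.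
    rewrite (expr2 (nc p)); nra.
  have : (nc p - e * t ^+ 2) ^+ 2 <= nc (f (z + k)) ^+ 2.
    by rewrite ler_pXn2r // ?nnegrE; lra.
  have : 0 <= (e * t ^+ 2) ^+ 2 by rewrite sqr_ge0.
  rewrite [(nc p - _) ^+ 2]sqrrB; set q := e * t ^+ 2 in m1 *; nra.
have disck (k : C) : nc k = t -> disc z r (z + k).
  by move=> kt; rewrite /disc /= addrAC subrr add0r kt.
pose T : C := t%:C%C; pose I : C := Complex 0 1.
have I2 : I ^+ 2 = -1 by rewrite sqr_i.
have nI : nc I = 1 by rewrite /nc /= expr0n expr1n /= add0r sqrtr1.
have nT : nc T = t by rewrite nc_real gtr0_norm.
have nIT : nc (I * T) = t by rewrite ncM nI mul1r.
have l1 := low T nT; have l2 := low (- T); rewrite ncN in l2; have {}l2 := l2 nT.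
have l3 := low (I * T) nIT; have l4 := low (- (I * T)); rewrite ncN in l4.
have {}l4 := l4 nIT.
have m1 := Hmax _ (disck T nT); have m2 := disck (- T); rewrite ncN in m2.
have {}m2 := Hmax _ (m2 nT).
have m3 := Hmax _ (disck _ nIT); have m4 := disck (- (I * T)); rewrite ncN in m4.
have {}m4 := Hmax _ (m4 nIT).
have E1 := nc_parallelogram (a + c * T ^+ 2) (b * T).
have E2 := nc_parallelogram (a - c * T ^+ 2) (b * (I * T)).
have E3 := nc_parallelogram a (c * T ^+ 2).
have E4 := nc_parallelogram z T.
have E5 := nc_parallelogram z (I * T).
have r1 : a + b * T + c * T ^+ 2 = a + c * T ^+ 2 + b * T by ring.
have r2 : a + b * (- T) + c * (- T) ^+ 2 = a + c * T ^+ 2 - b * T by ring.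
have r3 : a + b * (I * T) + c * (I * T) ^+ 2 = a - c * T ^+ 2 + b * (I * T).
  by rewrite exprMn I2; ring.
have r4 : a + b * (- (I * T)) + c * (- (I * T)) ^+ 2 = a - c * T ^+ 2 - b * (I * T).
  by rewrite sqrrN exprMn I2; ring.
rewrite r1 in l1; rewrite r2 in l2; rewrite r3 in l3; rewrite r4 in l4.
rewrite nIT in E5; rewrite nT in E4.
have c1 : 0 <= nc (c * T ^+ 2) ^+ 2 by rewrite sqr_ge0.
have c2 : 0 <= nc (b * T) ^+ 2 by rewrite sqr_ge0.
have c3 : 0 <= nc (b * (I * T)) ^+ 2 by rewrite sqr_ge0.
have F1 : 8 * A * (e * t ^+ 2) = 2 * (eta * t ^+ 2).
  by rewrite /e; field; rewrite gt_eqF.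
have F2 : 0 < eta * t ^+ 2 by rewrite mulr_gt0 // exprn_gt0.
have G1 : eta * (nc (z + T) ^+ 2 + nc (z - T) ^+ 2) = eta * (2 * nc z ^+ 2 + 2 * t ^+ 2).
  by rewrite E4.
have G2 : eta * (nc (z + I * T) ^+ 2 + nc (z - I * T) ^+ 2) =
          eta * (2 * nc z ^+ 2 + 2 * t ^+ 2).
  by rewrite E5.
rewrite -/a in m1 m2 m3 m4.
lra.
Qed.

(** The perturbation [eta * nc z ^+ 2] makes |f|^2 strictly subharmonic, so the maximum over [K]
    falls on a point where the bound [M] is given; then [eta] tends to 0. *)
Lemma max_principle (K : set C) f (M B : R) :
  (forall z, K z -> nc z <= B) ->
  (forall z, (forall e : R, 0 < e -> exists2 w, K w & nc (w - z) < e) -> K z) ->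
  (forall z, K z -> ccont f z) ->
  (forall z, K z -> nc (f z) <= M \/
     exists2 r : R, 0 < r & disc z r `<=` K /\ Hol (disc z r) f) ->
  forall z, K z -> nc (f z) <= M.
Proof.
move=> KB Kcl cf bd z Kz.
have main (eta : R) : 0 < eta -> 0 <= M /\ nc (f z) ^+ 2 <= M ^+ 2 + eta * B ^+ 2.
  move=> eta0; pose v w := nc (f w) ^+ 2 + eta * nc w ^+ 2.
  have vc w : K w -> ccont (fun w => (v w)%:C%C) w.
    move=> Kw; apply: (@ccont_near _ (fun w => (nc (f w))%:C%C * (nc (f w))%:C%C +
       eta%:C%C * ((nc w)%:C%C * (nc w)%:C%C)) _ _ 1) => //.
      by move=> y _; rewrite /v !expr2 rmorphD /= !rmorphM.
    have c1 := ccont_nc (cf w Kw); have c2 := @ccont_ncid w.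
    apply: ccontD; first exact: ccontM.
    by apply: ccontM; [exact: ccont_cst|exact: ccontM].
  have [w Kw wmax] := extreme_value (ex_intro _ z Kz) KB Kcl vc.
  have [le|[r r0 [rK Hr]]] := bd w Kw; last first.
    by exfalso; apply: (no_interior_max r0 eta0 Hr) => y /rK /wmax.
  have M0 : 0 <= M by apply: le_trans (nc_ge0 _) le.
  split=> //; have := wmax z Kz; rewrite /v.
  have : 0 <= eta * nc z ^+ 2 by rewrite mulr_ge0 ?sqr_ge0 // ltW.
  have : nc (f w) ^+ 2 <= M ^+ 2 by rewrite ler_pXn2r ?nnegrE ?nc_ge0.
  have : eta * nc w ^+ 2 <= eta * B ^+ 2.
    rewrite ler_pM2l // ler_pXn2r ?nnegrE ?nc_ge0 //; first exact: KB.
    by apply: le_trans (nc_ge0 z) (KB _ Kz).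
  lra.
have [M0 _] := main 1 ltr01.
rewrite -(@ler_pXn2r _ 2) ?nnegrE ?nc_ge0 //.
apply/ler_addgt0Pl => e e0.
have B0 : 0 < B ^+ 2 + 1 by have := sqr_ge0 B; lra.
have [_ h] := main (e / (B ^+ 2 + 1)) ltac:(by rewrite divr_gt0).
apply: (le_trans h); rewrite addrC lerD2r mulrAC ler_pdivrMr // ler_pM2l //; lra.
Qed.

End MaximumPrinciple.

(** * The Schwarz lemma, Cauchy estimates and the identity theorem *)

Section Schwarz.
Variable R : realType.
Local Notation C := (R[i]).
Implicit Types (f g : C -> C) (x y z w c : C) (U V : set C).

Lemma pow_unbounded (a N : R) : 1 < a -> exists k : nat, N < a ^+ k.
Proof.
move=> a1.
have bern k : 1 + k%:R * (a - 1) <= a ^+ k.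
  elim: k => [|k IH]; first by rewrite mul0r addr0 expr0.
  have k0 : 0 <= k%:R * (a - 1) * (a - 1) by rewrite !mulr_ge0 ?ler0n //; lra.
  have : a * (1 + k%:R * (a - 1)) <= a ^+ k.+1 by rewrite exprS ler_pM2l //; lra.
  rewrite -natr1; lra.
pose k := (Num.truncn (N / (a - 1))).+1; exists k.
apply: lt_le_trans (bern k).
have : N / (a - 1) < k%:R by exact: truncnS_gt.
rewrite ltr_pdivrMr; last lra.
lra.
Qed.

Lemma nc_closed_le (K : set C) (r : R) z : (forall w, K w -> nc w <= r) ->
  (forall e : R, 0 < e -> exists2 w, K w & nc (w - z) < e) -> nc z <= r.
Proof.
move=> Kr h; apply/ler_addgt0Pl => e /h[w /Kr wr wz].
by have := ncB_ge z w; rewrite nc_distC; lra.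
Qed.

Lemma nc_closed_ge (K : set C) (r : R) z : (forall w, K w -> r <= nc w) ->
  (forall e : R, 0 < e -> exists2 w, K w & nc (w - z) < e) -> r <= nc z.
Proof.
move=> Kr h; apply/ler_addgt0Pl => e /h[w /Kr wr wz].
by have := ncB_ge w z; lra.
Qed.

Definition annulus (a b : R) : set C := [set z | a < nc z /\ nc z < b].

Lemma annulus_open a b : copen (annulus a b).
Proof.
move=> z [az zb]; exists (Num.min (nc z - a) (b - nc z)).
  by rewrite lt_min; apply/andP; split; lra.
move=> w; rewrite /disc /= lt_min => /andP[w1 w2].
by have := ncB_ge w z; have := ncB_ge z w; rewrite nc_distC; split; lra.
Qed.

Lemma annulus_max f (a a' b b' M : R) z : a < a' -> b' < b ->
  Hol (annulus a b) f -> (forall w, nc w = a' \/ nc w = b' -> a' <= b' -> nc (f w) <= M) ->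
  a' <= nc z -> nc z <= b' -> nc (f z) <= M.
Proof.
move=> aa bb Hf bd az zb.
apply: (@max_principle _ [set w | a' <= nc w /\ nc w <= b'] f M b') => //.
- by move=> w [].
- by move=> w h; split; [apply: nc_closed_ge h|apply: nc_closed_le h] => y [].
- by move=> w [w1 w2]; apply: (Hol_cont Hf); split; lra.
move=> w [w1 w2].
have [E|ne1] := eqVneq (nc w) a'; first by left; apply: bd; [left|lra].
have [E|ne2] := eqVneq (nc w) b'; first by left; apply: bd; [right|lra].
have w3 : a' < nc w by rewrite lt_def ne1.
have w4 : nc w < b' by rewrite lt_def eq_sym ne2.
right; have [r r0 rw] := @annulus_open a' b' w (conj w3 w4).
exists r => //; split; first by move=> y /rw[/ltW ? /ltW].
by apply: Hol_sub Hf => y /rw[y1 y2]; split; lra.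
Qed.

Lemma Hol_bounded f c (r r' : R) : r' < r -> Hol (disc c r) f ->
  exists2 M : R, 0 <= M & forall z, nc (z - c) <= r' -> nc (f z) <= M.
Proof.
move=> rr Hf.
have [r'0|r'0] := ltP r' 0.
  by exists 0 => // z; have := nc_ge0 (z - c); lra.
have [z0 _ zmax] := @extreme_value _ [set z | nc (z - c) <= r'] (fun z => nc (f z)) (r' + nc c)
  ltac:(by exists c; rewrite /= subrr nc0)
  ltac:(by move=> z /= h; have := ncB_ge z c; lra)
  ltac:(by move=> z h; apply: (@nc_closed_le [set w | nc w <= r']) => // e /h[w wr wz];
         exists (w - c) => //; rewrite opprB addrA subrK)
  ltac:(by move=> z /= h; apply: ccont_nc; apply: (Hol_cont Hf); exact: le_lt_trans h rr).
by exists (nc (f z0)) => [|z /zmax //]; exact: nc_ge0.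
Qed.

Lemma cdv_le f z l (r K : R) : 0 < r -> cdv f z l ->
  (forall w, nc (w - z) < r -> nc (f w - f z) <= K * nc (w - z)) -> nc l <= K.
Proof.
move=> r0 df bd; apply/ler_addgt0Pl => e e0.
have [d d0 h] := cdv_eps df e0.
pose t := Num.min d r / 2.
have t0 : 0 < t by rewrite divr_gt0 // lt_min d0.
have td : t < d /\ t < r.
  have : Num.min d r <= d /\ Num.min d r <= r by rewrite !ge_min !lexx orbT.
  by rewrite /t in t0 *; lra.
pose w := z + t%:C%C.
have wz : w - z = t%:C%C by rewrite /w addrAC subrr add0r.
have wt : nc (w - z) = t by rewrite wz nc_real gtr0_norm.
have h1 := h w; have h2 := bd w; rewrite wt in h1 h2.
have {}h1 := h1 td.1; have {}h2 := h2 td.2.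
rewrite -(ler_pM2r t0) -{1}wt -ncM.
have -> : l * (w - z) = (f w - f z) - (f w - f z - l * (w - z)) by ring.
apply: le_trans (ncB _ _) _; lra.
Qed.

(** The singularity of g(z)/z at 0 is not removed. The quotient g^(k+1)/z^k is small on small
    circles, so the maximum principle on annuli bounds it by its values on the outer circle; with
    [y = |g z| / M] and [s = |z| / r'] this reads [y ^+ k.+1 <= s ^+ k] for all [k], hence
    [y <= s]. *)
Lemma schwarz0 g (rho M : R) : 0 < rho -> Hol (disc 0 rho) g -> g 0 = 0 ->
  (forall z, nc z < rho -> nc (g z) <= M) ->
  forall z, nc z < rho -> nc (g z) <= M / rho * nc z.
Proof.
move=> rho0 Hg g0 bM z zr.
have M0 : 0 <= M by apply: le_trans (nc_ge0 (g 0)) (bM 0 _); rewrite nc0.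
have [->|zn0] := eqVneq z 0; first by rewrite g0 !nc0 mulr0.
have nz : 0 < nc z by rewrite nc_gt0.
rewrite mulrAC ler_pdivlMr //.
have [M00|Mn0] := eqVneq M 0.
  have := bM z zr; rewrite M00 mul0r => h.
  have -> : nc (g z) = 0 by apply/le_anti; rewrite h nc_ge0.
  by rewrite mul0r.
have {Mn0}Mp : 0 < M by rewrite lt_def Mn0.
suff main r' : nc z < r' -> r' < rho -> nc (g z) * r' <= M * nc z.
  rewrite leNgt; apply/negP => gt1.
  have gp : 0 < nc (g z).
    rewrite lt_def nc_ge0 andbT; apply: contraTneq gt1 => ->.
    by rewrite mul0r -leNgt mulr_ge0 // ltW.
  pose s := M * nc z / nc (g z).
  have srho : s < rho by rewrite ltr_pdivrMr // [rho * _]mulrC.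
  pose r' := (Num.max s (nc z) + rho) / 2.
  have mx : Num.max s (nc z) < rho by rewrite gt_max srho.
  have mz : nc z <= Num.max s (nc z) by rewrite le_max lexx orbT.
  have ms : s <= Num.max s (nc z) by rewrite le_max lexx.
  have := main r' ltac:(rewrite /r'; lra) ltac:(rewrite /r'; lra).
  rewrite mulrC -ler_pdivlMr // -/s /r'; lra.
move=> zr' r'rho; have r'0 : 0 < r' by lra.
pose y := nc (g z) / M; pose s := nc z / r'.
have s0 : 0 < s by rewrite divr_gt0.
suff ys : y <= s by move: ys; rewrite /y /s ler_pdivrMr // mulrAC ler_pdivlMr // [nc z * M]mulrC.
rewrite leNgt; apply/negP => ltsy.
have y0 : 0 < y by lra.
have key k : y ^+ k.+1 <= s ^+ k.
  pose h w := g w ^+ k.+1 / w ^+ k.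
  pose N := M ^+ k.+1 / r' ^+ k.
  have N0 : 0 < N by rewrite divr_gt0 // exprn_gt0.
  have zd : disc 0 rho 0 by exact: disc_center.
  have [d d0 hd] := cdv_eps (Hol_cdv Hg zd) ltr01.
  pose L := nc (dv g 0) + 1.
  have L0 : 0 < L by rewrite /L; have := nc_ge0 (dv g 0); lra.
  (* On the circle of radius [dl] the quotient is at most [(L * dl) ^+ k.+1 / dl ^+ k = L ^+ k.+1 *
     dl], which the last term keeps below [N]. *)
  pose dl := Num.min (Num.min (d / 2) (nc z)) (N / L ^+ k.+1).
  have dl0 : 0 < dl by rewrite !lt_min nz !divr_gt0 // exprn_gt0.
  have [dld dlz dlN] : [/\ dl <= d / 2, dl <= nc z & dl <= N / L ^+ k.+1].
    by rewrite /dl !ge_min !lexx !orbT.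
  have Hh : Hol (annulus (dl / 2) rho) h.
    have oA := @annulus_open (dl / 2) rho.
    have Hg' : Hol (annulus (dl / 2) rho) g.
      by apply: Hol_sub Hg => w [_]; rewrite disc0E.
    apply: Hol_div => //; [|exact: HolX|by apply: HolX => //; exact: Hol_id].
    by move=> w [w1 _]; rewrite expf_neq0 // -nc_gt0; lra.
  have bh : nc (h z) <= N.
    apply: (annulus_max (a := dl / 2) (a' := dl) (b := rho) (b' := r')) => //; last exact: ltW.
      lra.
    move=> w [wE|wE] _; rewrite /h nc_div !ncX wE.
      have gw : nc (g w) <= L * dl.
        have := hd w; rewrite subr0 wE g0 subr0 => /(_ ltac:(lra)) h1.
        have := ncD (g w - dv g 0 * w) (dv g 0 * w); rewrite subrK ncM wE /L; lra.
      rewrite ler_pdivrMr ?exprn_gt0 //.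
      apply: (@le_trans _ _ ((L * dl) ^+ k.+1)); first by rewrite ler_pXn2r ?nnegrE ?nc_ge0 // mulr_ge0 // ltW.
      rewrite exprMn [dl ^+ k.+1]exprS mulrA ler_pM2r ?exprn_gt0 //.
      by rewrite mulrC -ler_pdivlMr ?exprn_gt0.
    rewrite /N ler_pM2r ?invr_gt0 ?exprn_gt0 // ler_pXn2r ?nnegrE ?nc_ge0 //.
    by apply: bM; rewrite wE.
  move: bh; rewrite /h /N nc_div !ncX /y /s !expr_div_n.
  rewrite ler_pdivrMr ?exprn_gt0 // => bh.
  by rewrite ler_pdivrMr ?exprn_gt0 // mulrAC [nc z ^+ k * _]mulrC mulrAC.
have [k hk] := pow_unbounded (y^-1) (a := y / s) ltac:(by rewrite ltr_pdivlMr // mul1r).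
have h1 : (y / s) ^+ k * y <= 1.
  by rewrite expr_div_n mulrAC ler_pdivrMr ?exprn_gt0 // mul1r mulrC -exprS key.
move: hk; rewrite -(ltr_pM2r y0) mulVf ?gt_eqF //; lra.
Qed.

Lemma disc_shift c (r : R) z : disc 0 r z -> disc c r (z + c).
Proof. by rewrite /disc /= subr0 addrK. Qed.

Lemma Hol_shift c (r : R) g : Hol (disc c r) g -> Hol (disc 0 r) (fun z => g (z + c)).
Proof.
move=> Hg; apply: (Hol_comp (@disc_open R 0 r) (@disc_open R c r)) => //.
  by move=> z; exact: disc_shift.
apply: HolD; [exact: disc_open|apply: Hol_id; exact: disc_open|apply: Hol_cst; exact: disc_open].
Qed.

Lemma schwarz_disc g c (rho M : R) : 0 < rho -> Hol (disc c rho) g ->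
  (forall z, disc c rho z -> nc (g z - g c) <= M) ->
  forall z, disc c rho z -> nc (g z - g c) <= M / rho * nc (z - c).
Proof.
move=> rho0 Hg bM z zr.
have H0 : Hol (disc 0 rho) (fun z => g (z + c) - g c).
  by apply: HolBc; [exact: disc_open|exact: Hol_shift].
have := schwarz0 rho0 H0 (M := M); rewrite add0r subrr => /(_ erefl) h.
have := h _ (z - c); rewrite subrK; apply=> // w wr.
by apply: bM; apply: disc_shift; rewrite disc0E.
Qed.

Lemma cauchy_center g c (rho M : R) : 0 < rho -> Hol (disc c rho) g ->
  (forall z, disc c rho z -> nc (g z - g c) <= M) -> nc (dv g c) <= M / rho.
Proof.
move=> rho0 Hg bM; apply: (cdv_le rho0); first exact: (Hol_cdv Hg (disc_center _ rho0)).
by move=> w wr; exact: schwarz_disc.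
Qed.

(** The factor 2 comes from applying the Schwarz lemma to [g - g c]. *)
Lemma cauchy_estimate g c (rho M : R) : 0 < rho -> Hol (disc c rho) g ->
  (forall z, disc c rho z -> nc (g z) <= M) -> nc (dv g c) <= 2 * M / rho.
Proof.
move=> rho0 Hg bM; apply: (cauchy_center rho0) => // z zr.
have := bM z zr; have := bM c (disc_center _ rho0); have := ncB (g z) (g c); lra.
Qed.

(** Without power series: f(w + c)/w^k vanishes on an inner circle, so the maximum principle gives
    |f z| <= M (|z - c| / r')^k for every [k]. *)
Lemma vanish_disc f c (dl r : R) : 0 < dl -> Hol (disc c r) f ->
  (forall z, disc c dl z -> f z = 0) -> forall z, disc c r z -> f z = 0.
Proof.
move=> dl0 Hf f0 z zr.
have [zd|zd] := ltP (nc (z - c)) dl; first exact: f0.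
pose r' := (nc (z - c) + r) / 2.
have zr' : nc (z - c) < r' by rewrite /r'; rewrite /disc /= in zr; lra.
have r'r : r' < r by rewrite /r'; rewrite /disc /= in zr; lra.
clearbody r'; have [M M0 bM] := Hol_bounded r'r Hf.
have nz : 0 < nc (z - c) by lra.
have r'0 : 0 < r' by lra.
have key k : nc (f z) <= M * (nc (z - c) / r') ^+ k.
  pose h w := f (w + c) / w ^+ k.
  have Hh : Hol (annulus (dl / 4) r) h.
    have oA := @annulus_open (dl / 4) r.
    apply: Hol_div => //; last by apply: HolX => //; exact: Hol_id.
      by move=> w [w1 _]; rewrite expf_neq0 // -nc_gt0; lra.
    by apply: Hol_sub (Hol_shift Hf) => w [_]; rewrite disc0E.
  have : nc (h (z - c)) <= M / r' ^+ k.
    apply: (annulus_max (a := dl / 4) (a' := dl / 2) (b := r) (b' := r')) => //; try lra.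
    move=> w [wE|wE] _; rewrite /h nc_div ncX wE.
      rewrite f0 ?nc0 ?mul0r ?divr_ge0 ?exprn_ge0 // ?ltW //.
      by apply: disc_shift; rewrite disc0E wE; lra.
    by rewrite ler_pM2r ?invr_gt0 ?exprn_gt0 // bM // addrK wE.
  rewrite /h subrK nc_div ncX ler_pdivrMr ?exprn_gt0 //.
  by rewrite expr_div_n mulrA mulrAC.
apply/eqP; rewrite -nc_eq0; apply/negPn/negP => fz.
have fz0 : 0 < nc (f z) by rewrite lt_def fz nc_ge0.
have [k hk] := pow_unbounded (M / nc (f z)) (a := r' / nc (z - c))
  ltac:(by rewrite ltr_pdivlMr // mul1r).
pose q := (nc (z - c) / r') ^+ k.
have pq : (r' / nc (z - c)) ^+ k * q = 1.
  by rewrite /q -exprMn mulrA divfK ?gt_eqF // divff ?gt_eqF // expr1n.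
have q0 : 0 < q by rewrite exprn_gt0 // divr_gt0.
move: hk; rewrite ltr_pdivrMr // -(ltr_pM2l q0) mulrA [q * _ ^+ k]mulrC pq mul1r.
by have := key k; rewrite -/q; lra.
Qed.

(** Vanishing near a point is propagated along the segment from [z0] to [z] by overlapping discs of
    a common radius [r]. *)
Lemma identity_convex U f z0 (dl : R) : cconvex U -> copen U -> Hol U f -> U z0 -> 0 < dl ->
  (forall z, disc z0 dl z -> f z = 0) -> forall z, U z -> f z = 0.
Proof.
move=> cU oU Hf Uz0 dl0 f0 z Uz.
have [r0 r00 r0U] := oU _ Uz0; have [r1 r10 r1U] := oU _ Uz.
pose r := Num.min r0 r1.
have rp : 0 < r by rewrite lt_min r00.
(* A point near the segment lies on a translate of the segment whose end points are still in [U]. *)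
have tube t : 0 <= t -> t <= 1 -> disc (seg z0 z t) r `<=` U.
  move=> t0 t1 w wr.
  have -> : w = seg (z0 + (w - seg z0 z t)) (z + (w - seg z0 z t)) t by rewrite /seg; ring.
  apply: cU => //; [apply: r0U|apply: r1U]; rewrite /disc /= addrAC subrr add0r;
    by apply: lt_le_trans wr _; rewrite ge_min lexx ?orbT.
pose L := nc (z - z0).
have L0 : 0 <= L by exact: nc_ge0.
pose P (s t : R) := (exists2 d, 0 < d & forall w, disc (seg z0 z s) d w -> f w = 0) ->
  (exists2 d, 0 < d & forall w, disc (seg z0 z t) d w -> f w = 0).
have [] : P 0 1.
- apply: cousin => // [s c t _ _ h1 h2 /h1 /h2 //|u u0 u1].
  exists (r / (2 * (L + 1))); first by rewrite divr_gt0 // mulr_gt0 //; lra.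
  move=> s t us su ut tu s0 t1 [d d0 fd].
  have close : nc (seg z0 z t - seg z0 z s) < r.
    rewrite nc_segB -/L.
    have : (t - s) * (L + 1) < r.
      have : (t - s) < 2 * (r / (2 * (L + 1))) by lra.
      have -> : 2 * (r / (2 * (L + 1))) = r / (L + 1).
        by field; rewrite gt_eqF //; lra.
      by rewrite ltr_pdivlMr //; lra.
    rewrite ger0_norm; last lra.
    have : 0 <= (t - s) by lra.
    nra.
  have vs : forall w, disc (seg z0 z s) r w -> f w = 0.
    apply: (vanish_disc d0 _ fd); apply: Hol_sub Hf; apply: tube; lra.
  exists (r - nc (seg z0 z t - seg z0 z s)); first lra.
  move=> w wd; apply: vs; rewrite /disc /= in wd *.
  have := nc_triangle w (seg z0 z t) (seg z0 z s); lra.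
- by exists dl => // w; rewrite seg0; exact: f0.
by move=> d d0; rewrite seg1; apply; exact: disc_center.
Qed.

(** If [f] and [g] differ at a point they differ near it, so [f + g] vanishes there, and then on [U]
    by the identity theorem. *)
Lemma sqrt_unique U f g : cconvex U -> copen U -> Hol U f -> Hol U g ->
  (forall z, U z -> f z ^+ 2 = g z ^+ 2) ->
  (forall z, U z -> f z = g z) \/ (forall z, U z -> f z = - g z).
Proof.
move=> cU oU Hf Hg fg.
have [|/existsNP[z0 /not_implyP[Uz0 /eqP ne]]] := pselect (forall z, U z -> f z = g z); first by left.
right => z Uz; apply/eqP; rewrite -subr_eq0 opprK; apply/eqP.
have Hm : Hol U (fun z => f z - g z) by exact: HolB.
have Hp : Hol U (fun z => f z + g z) by exact: HolD.
have np : 0 < nc (f z0 - g z0) by rewrite nc_gt0 subr_eq0.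
have [d d0 hd] := Hol_cont Hm Uz0 np; have [r r0 rU] := oU _ Uz0.
apply: (@identity_convex U (fun z => f z + g z) z0 (Num.min d r)) => //.
  by rewrite lt_min d0.
move=> w; rewrite /disc /= lt_min => /andP[wd wr].
have nz : f w - g w != 0.
  rewrite -nc_gt0; have := hd _ wd.
  have := ncB_ge (f z0 - g z0) (f w - g w); rewrite (nc_distC (f z0 - g z0) (f w - g w)); lra.
have := fg _ (rU _ wr) => /eqP; rewrite -subr_eq0 subr_sqr mulf_eq0 (negbTE nz) /=.
by move/eqP.
Qed.

End Schwarz.

(** * Limits and square roots of holomorphic functions *)

Section LimitsOfHolomorphic.
Variable R : realType.
Local Notation C := (R[i]).
Implicit Types (f g h : C -> C) (x y z w c : C) (U V : set C) (fs : nat -> C -> C).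

(** Holomorphy and bound are asked for almost all [n] only, depending on the disc: the members of a
    sequence may be under control only on domains that exhaust [U]. *)
Definition locally_bounded fs U := forall z, U z -> exists r M : R,
  [/\ 0 < r, disc z r `<=` U &
      ufn [set n | Hol (disc z r) (fs n) /\ forall w, disc z r w -> nc (fs n w) <= M]].

Definition ulf fs z := ulim (fun n => fs n z).

Lemma disc_sub_half c (r : R) w : disc c (r / 2) w -> disc w (r / 2) `<=` disc c r.
Proof. by move=> wc z zw; rewrite /disc /= in wc zw *; have := nc_triangle z w c; lra. Qed.

Lemma locally_bounded_dv fs U : locally_bounded fs U ->
  locally_bounded (fun n => dv (fs n)) U.
Proof.
move=> bf z /bf[r [M [r0 rU ub]]]; exists (r / 2), (2 * M / (r / 2)); split; first lra.
  by apply: subset_trans rU; apply: disc_mono; lra.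
apply: ufnS ub => n [Hn bn]; split.
  by apply: Hol_sub (Hol_dv Hn); apply: disc_mono; lra.
move=> w wr; have sub := disc_sub_half wr.
apply: cauchy_estimate; first lra.
  exact: Hol_sub Hn.
by move=> y /sub /bn.
Qed.

Lemma ulf_isul fs U z : locally_bounded fs U -> U z -> isul (fun n => fs n z) (ulf fs z).
Proof.
move=> bf /bf[r [M [r0 rU ub]]]; apply: (@ulimP _ _ M).
by apply: ufnS ub => n [_]; apply; exact: disc_center.
Qed.

(** Local bounds pass to the second derivatives by Cauchy estimates; the second order Taylor bound,
    uniform in [n], then survives the limit. This takes the place of the theorems of Montel and
    Weierstrass. *)
Lemma ulf_cdv fs U z : locally_bounded fs U -> U z ->
  cdv (ulf fs) z (ulf (fun n => dv (fs n)) z).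
Proof.
move=> bf Uz; have b1 := locally_bounded_dv bf; have b2 := locally_bounded_dv b1.
have [r [M [r0 rU ub]]] := b2 z Uz.
have [r' [M' [r'0 _ ub']]] := bf z Uz.
have [n0 [[_ h0] _]] := ufn_ex (ufnI ub ub').
have M0 : 0 <= M by apply: le_trans (nc_ge0 _) (h0 z (disc_center _ r0)).
pose rr := Num.min r r'.
have rr0 : 0 < rr by rewrite lt_min r0.
have rr1 : rr <= r /\ rr <= r' by rewrite !ge_min !lexx orbT.
have bound w : disc z rr w ->
    nc (ulf fs w - ulf fs z - ulf (fun n => dv (fs n)) z * (w - z)) <= M * nc (w - z) ^+ 2.
  move=> wr; have Uw : U w by apply: rU; exact: (disc_mono rr1.1 wr).
  apply: (@isul_le _ (fun n => fs n w - fs n z - (w - z) * dv (fs n) z)).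
    apply: isulB; first by apply: isulB; exact: (ulf_isul bf).
    by rewrite [X in isul _ X]mulrC; apply: isulZ; exact: (ulf_isul b1).
  apply: ufnS (ufnI ub ub') => n [[_ h1] [h2 _]] /=.
  rewrite [(w - z) * _]mulrC; apply: (@taylor_bound _ _ _ rr) => //.
    by apply: Hol_sub h2; apply: disc_mono; exact: rr1.2.
  by move=> y /(disc_mono rr1.1); exact: h1.
apply: eps_cdv => e e0; exists (Num.min rr (e / (M + 1))).
  by rewrite lt_min rr0 divr_gt0 //; lra.
move=> w; rewrite lt_min => /andP[w1 w2]; apply: le_trans (bound w w1) _.
rewrite expr2 mulrA; apply: ler_wpM2r; first exact: nc_ge0.
move: w2; rewrite ltr_pdivlMr; last lra.
have := nc_ge0 (w - z); nra.
Qed.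

Lemma Hol_ulf fs U : copen U -> locally_bounded fs U -> Hol U (ulf fs).
Proof.
move=> oU bf n; elim: n fs bf => // n IH fs bf.
apply: (@Hn_intro _ _ _ _ (ulf (fun n => dv (fs n)))) => //.
  by move=> z Uz; exact: (ulf_cdv bf).
by apply: IH; exact: locally_bounded_dv.
Qed.

Lemma dv_ulf fs U z : locally_bounded fs U -> U z ->
  dv (ulf fs) z = ulf (fun n => dv (fs n)) z.
Proof. by move=> bf Uz; apply: dvE; exact: (ulf_cdv bf). Qed.

(** The functions have a common Lipschitz constant near [l]. *)
Lemma isul_ulf_comp fs U (u : nat -> C) l : locally_bounded fs U -> U l -> isul u l ->
  isul (fun n => fs n (u n)) (ulf fs l).
Proof.
move=> bf Ul ul e e0; have [r [M [r0 rU ub]]] := locally_bounded_dv bf Ul.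
have [r' [M' [r'0 _ ub']]] := bf l Ul.
have [n0 [[_ h0] _]] := ufn_ex (ufnI ub ub').
have M0 : 0 <= M by apply: le_trans (nc_ge0 _) (h0 l (disc_center _ r0)).
pose rr := Num.min r r'.
have rr0 : 0 < rr by rewrite lt_min r0.
have rr1 : rr <= r /\ rr <= r' by rewrite !ge_min !lexx orbT.
pose e1 := Num.min rr (e / 2 / (M + 1)).
have e10 : 0 < e1 by rewrite lt_min rr0 !divr_gt0 //; lra.
have := ulf_isul bf Ul (e := e / 2) ltac:(lra).
move=> hl; apply: ufnS (ufnI (ufnI ub ub') (ufnI (ul _ e10) hl)) => n /=.
move=> [[[_ h1] [h2 _]] []]; rewrite lt_min => /andP[u1 u2] h3.
have : nc (fs n (u n) - fs n l) <= M * nc (u n - l).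
  apply: (Hol_mean_value (@disc_convex R l rr)) => //.
  - by apply: Hol_sub h2; apply: disc_mono; exact: rr1.2.
  - exact: disc_center.
  - by move=> y /(disc_mono rr1.1); exact: h1.
have : M * nc (u n - l) <= e / 2.
  move: u2; rewrite ltr_pdivlMr; last lra.
  by have := nc_ge0 (u n - l); nra.
by have := nc_triangle (fs n (u n)) (fs n l) (ulf fs l); lra.
Qed.

End LimitsOfHolomorphic.

(** * Holomorphic square roots on discs *)

Section SquareRoots.
Variable R : realType.
Local Notation C := (R[i]).
Implicit Types (f g h X Y : C -> C) (x y z w c : C) (U V : set C).

Definition rsqrt w : C := if 0 <= complex.Re (sqrtc w) then sqrtc w else - sqrtc w.

Lemma sqr_rsqrt w : rsqrt w ^+ 2 = w.
Proof. by rewrite /rsqrt; case: ifP => _; rewrite ?sqrrN sqr_sqrtc. Qed.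

Lemma Re_rsqrt_ge0 w : 0 <= complex.Re (rsqrt w).
Proof.
rewrite /rsqrt; case: ifP => // /negbT; rewrite -ltNge ReN oppr_ge0; exact: ltW.
Qed.

Definition rhp : set C := [set w | 0 < complex.Re w].

Lemma Re_rsqrt_gt0 w : rhp w -> 0 < complex.Re (rsqrt w).
Proof.
rewrite /rhp /= => w0; rewrite lt_def Re_rsqrt_ge0 andbT; apply: contraTneq w0 => E.
by rewrite -(sqr_rsqrt w) expr2 ReM E mul0r sub0r -leNgt oppr_le0 -expr2 sqr_ge0.
Qed.

Lemma rhp_open : copen rhp.
Proof.
move=> z z0; exists (complex.Re z) => // w; rewrite /disc /rhp /= => wz.
have := Re_le_nc (w - z); rewrite ler_norml ReD ReN => /andP[+ _]; rewrite /rhp /= in z0; lra.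
Qed.

Lemma Re_gt0_neq0 w : 0 < complex.Re w -> w != 0.
Proof. by move=> h; apply: contraTneq h => ->; rewrite ltxx. Qed.

(** The slope is [(rsqrt w + rsqrt z)^-1], whose denominator stays away from 0 because both real
    parts are nonnegative and that at [z] is positive. *)
Lemma cdv_rsqrt z : rhp z -> cdv rsqrt z (2 * rsqrt z)^-1.
Proof.
move=> z0; have rz := Re_rsqrt_gt0 z0.
have nz w : rsqrt w + rsqrt z != 0.
  by apply: Re_gt0_neq0; rewrite ReD; have := Re_rsqrt_ge0 w; lra.
exists (fun w => (rsqrt w + rsqrt z)^-1).
have E w : rsqrt w = rsqrt z + (rsqrt w + rsqrt z)^-1 * (w - z).
  apply/eqP; rewrite -subr_eq0 -[X in _ * (X - _)]sqr_rsqrt -[X in _ * (_ - X)]sqr_rsqrt.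
  by rewrite subr_sqr [_ * (rsqrt w + _)]mulrC mulKf //; apply/eqP; ring.
split=> //; first by congr (_^-1); ring.
apply: ccontV; last exact: nz.
apply: ccontD; last exact: ccont_cst.
move=> e e0; exists (e * complex.Re (rsqrt z)); first by rewrite mulr_gt0.
move=> w wz; rewrite (E w) addrAC subrr add0r ncM ncV mulrC ltr_pdivrMr ?nc_gt0 //.
apply: lt_le_trans wz _; rewrite ler_pM2l //.
have := Re_le_nc (rsqrt w + rsqrt z); rewrite ReD ler_norml => /andP[_].
by have := Re_rsqrt_ge0 w; lra.
Qed.

Lemma Hol_rsqrt : Hol rhp rsqrt.
Proof.
elim=> // n IH; apply: (@Hn_intro _ _ _ _ (fun z => (2 * rsqrt z)^-1)).
- exact: rhp_open.
- exact: cdv_rsqrt.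
apply: HnV; first exact: rhp_open.
  by move=> z /Re_rsqrt_gt0 /Re_gt0_neq0 h; rewrite mulf_neq0 // pnatr_eq0.
by apply: HnM => //; [exact: rhp_open|apply: Hn_cst; exact: rhp_open].
Qed.

Definition has_sqrt X V := exists2 h, Hol V h & forall w, V w -> h w ^+ 2 = X w.

(** For a holomorphic [X], not identically zero near [z], this says that the order of vanishing at
    [z] is even, possibly 0. *)
Definition lsq X z := exists2 r : R, 0 < r & has_sqrt X (disc z r).

Lemma has_sqrt_sub X U V : V `<=` U -> has_sqrt X U -> has_sqrt X V.
Proof. by move=> VU [h Hh hE]; exists h => [|w /VU /hE //]; exact: Hol_sub Hh. Qed.

Lemma has_sqrt_lsq X U z : copen U -> has_sqrt X U -> U z -> lsq X z.
Proof. by move=> oU hX /oU[r r0 rU]; exists r => //; exact: has_sqrt_sub hX. Qed.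

Lemma lsq_near X Y z (d : R) : 0 < d -> (forall w, nc (w - z) < d -> X w = Y w) ->
  lsq X z -> lsq Y z.
Proof.
move=> d0 XY [r r0 [h Hh hE]]; exists (Num.min d r); first by rewrite lt_min d0.
exists h.
  by apply: Hol_sub Hh; apply: disc_mono; rewrite ge_min lexx orbT.
by move=> w; rewrite /disc /= lt_min => /andP[w1 w2]; rewrite -XY // hE.
Qed.

Lemma lsqM X Y z : lsq X z -> lsq Y z -> lsq (fun w => X w * Y w) z.
Proof.
move=> [r r0 [h Hh hE]] [s s0 [k Hk kE]]; exists (Num.min r s); first by rewrite lt_min r0.
have [m1 m2] : Num.min r s <= r /\ Num.min r s <= s by rewrite !ge_min !lexx orbT.
exists (fun w => h w * k w).
  by apply: HolM; [exact: disc_open|apply: Hol_sub Hh|apply: Hol_sub Hk]; exact: disc_mono.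
move=> w wd; rewrite exprMn hE ?kE //; [exact: (disc_mono m2)|exact: (disc_mono m1)].
Qed.

Lemma lsq_nz U X z : copen U -> Hol U X -> U z -> X z != 0 -> lsq X z.
Proof.
move=> oU HX Uz Xz; pose Y w := X w / X z.
have HY : Hol U Y.
  apply: (@Hol_ext _ _ (fun w => (X z)^-1 * X w)) => //; last exact: HolZ.
  by move=> w _; rewrite mulrC.
have Y1 : Y z = 1 by rewrite /Y divff.
have [r r0 rU] := oU z Uz; have [d d0 hd] := Hol_cont HY Uz ltr01.
exists (Num.min r d); first by rewrite lt_min r0.
have [m1 m2] : Num.min r d <= r /\ Num.min r d <= d by rewrite !ge_min !lexx orbT.
exists (fun w => sqrtc (X z) * rsqrt (Y w)); last first.
  by move=> w _; rewrite exprMn sqr_sqrtc sqr_rsqrt /Y mulrC divfK.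
apply: HolZ; first exact: disc_open.
apply: (Hol_comp (@disc_open R z _) rhp_open _ _ Hol_rsqrt).
  move=> w /(disc_mono m2)/hd; rewrite Y1 => h; rewrite /rhp /=.
  have := Re_le_nc (Y w - 1); rewrite ler_norml ReD ReN /= => /andP[+ _]; lra.
by apply: Hol_sub HY; apply: subset_trans rU; exact: disc_mono.
Qed.

Lemma lsq_comp U X f z : copen U -> Hol U f -> U z -> lsq X (f z) -> lsq (fun w => X (f w)) z.
Proof.
move=> oU Hf Uz [r r0 [h Hh hE]].
have [s s0 sU] := oU z Uz; have [d d0 hd] := Hol_cont Hf Uz r0.
exists (Num.min s d); first by rewrite lt_min s0.
have [m1 m2] : Num.min s d <= s /\ Num.min s d <= d by rewrite !ge_min !lexx orbT.
have fr w : disc z (Num.min s d) w -> disc (f z) r (f w) by move/(disc_mono m2)/hd.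
exists (fun w => h (f w)); last by move=> w /fr /hE.
apply: (Hol_comp (@disc_open R _ _) (@disc_open R (f z) r) fr _ Hh).
by apply: Hol_sub Hf; apply: subset_trans sU; exact: disc_mono.
Qed.

Lemma openI U V : copen U -> copen V -> copen (U `&` V).
Proof.
move=> oU oV z [/oU[r r0 rU] /oV[s s0 sV]]; exists (Num.min r s); first by rewrite lt_min r0.
have [m1 m2] : Num.min r s <= r /\ Num.min r s <= s by rewrite !ge_min !lexx orbT.
by move=> w wd; split; [apply: rU|apply: sV]; [exact: (disc_mono m1)|exact: (disc_mono m2)].
Qed.

Lemma convexI U V : cconvex U -> cconvex V -> cconvex (U `&` V).
Proof. by move=> cU cV x y t [Ux Vx] [Uy Vy] t0 t1; split; [exact: cU|exact: cV]. Qed.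

(** The intersection is convex, so the two roots differ there by one global sign, which is absorbed
    into the second root. *)
Lemma glue_sqrt X U V : copen U -> cconvex U -> copen V -> cconvex V ->
  has_sqrt X U -> has_sqrt X V -> has_sqrt X (U `|` V).
Proof.
move=> oU cU oV cV [h Hh hE] [k Hk kE].
have [k' Hk' [k'E hk']] : exists2 k', Hol V k' & (forall w, V w -> k' w ^+ 2 = X w) /\
    forall w, U w -> V w -> h w = k' w.
  have [e|e] := @sqrt_unique _ (U `&` V) h k (convexI cU cV) (openI oU oV)
    ltac:(by apply: Hol_sub Hh => ? []) ltac:(by apply: Hol_sub Hk => ? [])
    ltac:(by move=> z [Uz Vz]; rewrite hE // kE).
  - by exists k => //; split=> // w Uw Vw; exact: e.
  - exists (fun w => - k w); first exact: HolN.
    by split=> [w Vw|w Uw Vw]; [rewrite sqrrN kE|exact: e].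
exists (fun w => if `[< U w >] then h w else k' w).
  apply: Hol_local => z [Uz|Vz]; [exists U|exists V]; split=> //.
    by apply: (@Hol_ext _ _ h) => // w Uw; rewrite asboolT.
  by apply: (@Hol_ext _ _ k') => // w Vw; case: asboolP => // Uw; rewrite hk'.
by move=> w; case: asboolP => [Uw _|nU [//|Vw]]; [exact: hE|exact: k'E].
Qed.

Definition vstrip (a b : R) : set C := [set w | a < complex.Re w /\ complex.Re w < b].
Definition hstrip (a b : R) : set C := [set w | a < complex.Im w /\ complex.Im w < b].

Lemma Re_seg x y t : complex.Re (seg x y t) =
  complex.Re x + t * (complex.Re y - complex.Re x).
Proof. by rewrite /seg ReD ReM ReD ReN /= mul0r subr0. Qed.

Lemma Im_seg x y t : complex.Im (seg x y t) =
  complex.Im x + t * (complex.Im y - complex.Im x).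
Proof. by rewrite /seg ImD ImM ImD ImN /= mul0r addr0. Qed.

Lemma interval_convex (a b p q t : R) : a < p < b -> a < q < b -> 0 <= t -> t <= 1 ->
  a < p + t * (q - p) /\ p + t * (q - p) < b.
Proof.
move=> /andP[ap pb] /andP[aq qb] t0 t1; have [pq|qp] := leP p q.
  have : 0 <= t * (q - p) by rewrite mulr_ge0 //; lra.
  have : t * (q - p) <= q - p by rewrite ler_piMl //; lra.
  by move=> *; split; lra.
have : 0 <= t * (p - q) by rewrite mulr_ge0 //; lra.
have : t * (p - q) <= p - q by rewrite ler_piMl //; lra.
by move=> *; split; lra.
Qed.

Lemma vstrip_convex a b : cconvex (vstrip a b).
Proof.
move=> x y t [x1 x2] [y1 y2] t0 t1; rewrite /vstrip /= Re_seg.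
by apply: interval_convex => //; apply/andP.
Qed.

Lemma hstrip_convex a b : cconvex (hstrip a b).
Proof.
move=> x y t [x1 x2] [y1 y2] t0 t1; rewrite /hstrip /= Im_seg.
by apply: interval_convex => //; apply/andP.
Qed.

Lemma vstrip_open a b : copen (vstrip a b).
Proof.
move=> z [az zb]; exists (Num.min (complex.Re z - a) (b - complex.Re z)).
  by rewrite lt_min; apply/andP; split; lra.
move=> w; rewrite /disc /= lt_min => /andP[w1 w2].
have := Re_le_nc (w - z); rewrite ler_norml ReD ReN => /andP[u1 u2].
by split; lra.
Qed.

Lemma hstrip_open a b : copen (hstrip a b).
Proof.
move=> z [az zb]; exists (Num.min (complex.Im z - a) (b - complex.Im z)).
  by rewrite lt_min; apply/andP; split; lra.
move=> w; rewrite /disc /= lt_min => /andP[w1 w2].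
have := Im_le_nc (w - z); rewrite ler_norml ImD ImN => /andP[u1 u2].
by split; lra.
Qed.

(** Simple connectedness of the disc is used through gluing of convex pieces: boxes are stacked into
    thin columns, then columns are put side by side, with one application of [cousin] for each
    direction. *)
Lemma has_sqrt_smaller X c (r r' : R) : r' < r ->
  (forall z, disc c r z -> lsq X z) -> has_sqrt X (disc c r').
Proof.
move=> r'r loc.
have [r'0|r'0] := leP r' 0.
  exists (fun=> 0) => [|w]; first by apply: Hol_cst; exact: disc_open.
  by rewrite /disc /= => h; exfalso; have := nc_ge0 (w - c); lra.
pose E := disc c r'.
have oE : copen E by exact: disc_open.
have cE : cconvex E by exact: disc_convex.
(* Every point of the plane is treated, since the intervals of [cousin] leave the disc. Beyond
   radius [r], a disc of radius [r - r'] misses [E] and any function will do. *)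
have local p : exists2 d : R, 0 < d & has_sqrt X (disc p d `&` E).
  have [pr|pr] := ltP (nc (p - c)) r.
    have [d d0 hX] := loc p pr; exists d => //.
    by apply: has_sqrt_sub hX => w [].
  exists (r - r'); first lra.
  exists (fun=> 0) => [|w [/= w1 w2]].
    by apply: Hol_cst; apply: openI => //; exact: disc_open.
  exfalso; rewrite /disc /E /disc /= in w1 w2; have := nc_triangle p w c; rewrite (nc_distC p w); lra.
have column (x0 : R) : exists2 d : R, 0 < d & has_sqrt X (E `&` vstrip (x0 - d) (x0 + d)).
  (* The margin [d] beyond [s] and [t] makes consecutive pieces overlap, so that their union covers
     the strip. *)
  pose P s t := exists2 d : R, 0 < d &
     has_sqrt X (E `&` vstrip (x0 - d) (x0 + d) `&` hstrip (s - d) (t + d)).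
  have [] : P (complex.Im c - r) (complex.Im c + r).
  - apply: cousin; first lra.
      move=> s m t sm mt [d1 d10 h1] [d2 d20 h2]; exists (Num.min d1 d2).
        by rewrite lt_min d10.
      have [m1 m2] : Num.min d1 d2 <= d1 /\ Num.min d1 d2 <= d2.
        by rewrite !ge_min !lexx orbT.
      move: m1 m2; set d := Num.min d1 d2 => m1 m2.
      have d0 : 0 < d by rewrite lt_min d10.
      pose S := E `&` vstrip (x0 - d) (x0 + d).
      have oS : copen S by apply: openI => //; exact: vstrip_open.
      have cS : cconvex S by apply: convexI => //; exact: vstrip_convex.
      have k1 : has_sqrt X (S `&` hstrip (s - d) (m + d)).
        apply: has_sqrt_sub h1 => w [[Ew [/= v1 v2]] [/= v3 v4]].
        by split; [split=> //; split|split]; rewrite /=; lra.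
      have k2 : has_sqrt X (S `&` hstrip (m - d) (t + d)).
        apply: has_sqrt_sub h2 => w [[Ew [/= v1 v2]] [/= v3 v4]].
        by split; [split=> //; split|split]; rewrite /=; lra.
      have := glue_sqrt (openI oS (@hstrip_open _ _)) (convexI cS (@hstrip_convex _ _))
        (openI oS (@hstrip_open _ _)) (convexI cS (@hstrip_convex _ _)) k1 k2.
      apply: has_sqrt_sub => w [Sw [/= v3 v4]].
      have [lt|ge] := ltP (complex.Im w) (m + d); [left|right]; split=> //; split=> //=; lra.
    move=> y0 _ _; have [d d0 hX] := local (Complex x0 y0).
    exists (d / 4); first lra.
    move=> s t s1 s2 t1 t2 _ _; exists (d / 4); first lra.
    apply: has_sqrt_sub hX => w [[Ew [/= v1 v2]] [/= v3 v4]]; split=> //.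
    rewrite /disc /=; apply: le_lt_trans (nc_le_ReIm _) _; rewrite ReD ReN ImD ImN /=.
    have : `|complex.Re w - x0| < d / 4 by rewrite ltr_norml; apply/andP; split; lra.
    have : `|complex.Im w - y0| < d / 2 by rewrite ltr_norml; apply/andP; split; lra.
    lra.
  move=> d d0 hX; exists d => //; apply: has_sqrt_sub hX => w [Ew vw]; split=> //.
  have := Im_le_nc (w - c); rewrite ler_norml ImD ImN => /andP[u1 u2].
  by rewrite /E /disc /= in Ew; split=> /=; lra.
pose P s t := exists2 d : R, 0 < d & has_sqrt X (E `&` vstrip (s - d) (t + d)).
have [] : P (complex.Re c - r) (complex.Re c + r).
- apply: cousin; first lra.
    move=> s m t sm mt [d1 d10 h1] [d2 d20 h2]; exists (Num.min d1 d2).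
      by rewrite lt_min d10.
    have [m1 m2] : Num.min d1 d2 <= d1 /\ Num.min d1 d2 <= d2.
      by rewrite !ge_min !lexx orbT.
    move: m1 m2; set d := Num.min d1 d2 => m1 m2.
    have d0 : 0 < d by rewrite lt_min d10.
    have k1 : has_sqrt X (E `&` vstrip (s - d) (m + d)).
      apply: has_sqrt_sub h1 => w [Ew [/= v1 v2]].
      by split=> //; split; rewrite /=; lra.
    have k2 : has_sqrt X (E `&` vstrip (m - d) (t + d)).
      apply: has_sqrt_sub h2 => w [Ew [/= v1 v2]].
      by split=> //; split; rewrite /=; lra.
    have := glue_sqrt (openI oE (@vstrip_open _ _)) (convexI cE (@vstrip_convex _ _))
      (openI oE (@vstrip_open _ _)) (convexI cE (@vstrip_convex _ _)) k1 k2.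
    apply: has_sqrt_sub => w [Sw [/= v3 v4]].
    have [lt|ge] := ltP (complex.Re w) (m + d); [left|right]; split=> //; split=> //=; lra.
  move=> x0 _ _; have [d d0 hX] := column x0.
  exists (d / 2); first lra.
  move=> s t s1 s2 t1 t2 _ _; exists (d / 2); first lra.
  by apply: has_sqrt_sub hX => w [Ew [/= v1 v2]]; split=> //; split=> /=; lra.
move=> d d0 hX; apply: has_sqrt_sub hX => w Ew; split=> //.
have := Re_le_nc (w - c); rewrite ler_norml ReD ReN => /andP[u1 u2].
by rewrite /E /disc /= in Ew; split=> /=; lra.
Qed.

(** Roots on the smaller discs converge along the ultrafilter, and a limit of roots is a root: their
    signs need not be matched. *)
Lemma global_sqrt X c (r : R) : Hol (disc c r) X ->
  (forall z, disc c r z -> lsq X z) -> has_sqrt X (disc c r).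
Proof.
move=> HX loc.
have ex (n : nat) : exists h, Hol (disc c (r - n.+1%:R^-1)) h /\
    forall w, disc c (r - n.+1%:R^-1) w -> h w ^+ 2 = X w.
  have [] := @has_sqrt_smaller X c r (r - n.+1%:R^-1) _ loc.
    by rewrite ltrBlDr ltrDl invr_gt0 ltr0n.
  by move=> h Hh hE; exists h.
have [hs hsP] := choice ex.
have bnd : locally_bounded hs (disc c r).
  move=> z zr; rewrite /disc /= in zr; pose d := (r - nc (z - c)) / 2.
  have d0 : 0 < d by rewrite /d; lra.
  have zd : nc (z - c) + d < r by rewrite /d; lra.
  have sub : disc z d `<=` disc c r.
    by move=> w; rewrite /disc /=; have := nc_triangle w z c; lra.
  have [M M0 bM] := @Hol_bounded _ X c r (nc (z - c) + d) zd HX.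
  exists d, (M + 1); split=> //.
  apply: ufnS (inv_nat_small (e := d) d0) => n /= nd.
  have sub' : disc z d `<=` disc c (r - n.+1%:R^-1).
    move=> w; rewrite /disc /=; have := nc_triangle w z c; rewrite /d in nd *.
    move: nd; set q := n.+1%:R^-1; lra.
  split; first by apply: Hol_sub (hsP n).1.
  move=> w wd; have wr : nc (w - c) <= nc (z - c) + d.
    by have := nc_triangle w z c; rewrite /disc /= in wd; lra.
  have := bM w wr; rewrite -((hsP n).2 w (sub' _ wd)) ncX.
  by have := nc_ge0 (hs n w); nra.
exists (ulf hs); first by apply: Hol_ulf => //; exact: disc_open.
move=> w wr; apply: isul_uniq (isul_sqr (ulf_isul bnd wr)) _.
apply: isul_near (isul_cst (X w)).
rewrite /disc /= in wr.
apply: ufnS (inv_nat_small (e := r - nc (w - c)) ltac:(lra)) => n /= nd.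
rewrite (hsP n).2 // /disc /=; move: nd; set q := n.+1%:R^-1; lra.
Qed.

End SquareRoots.

(** * The branched covering of the plane by the disc *)

Section Landau.
Variable R : realType.
Local Notation C := (R[i]).
Implicit Types (f g h G : C -> C) (x y z w c l : C) (U V : set C).

Definition inLat l := exists a b : int, l = Complex a%:~R b%:~R.

Lemma nearest_int (x : R) : exists a : int, `|x - a%:~R| <= 1 / 2.
Proof.
exists (Num.floor (x + 1 / 2)); rewrite ler_norml.
have := floor_itv (x + 1 / 2); rewrite intrD => /andP[h1 h2].
by apply/andP; split; lra.
Qed.

(** The covering radius is the square root of 1/2; 3/4 is a rational bound for it. *)
Lemma nearest_lattice w : exists2 l, inLat l & nc (w - l) <= 3 / 4.
Proof.
have [a ha] := nearest_int (complex.Re w); have [b hb] := nearest_int (complex.Im w).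
exists (Complex a%:~R b%:~R); first by exists a, b.
have p0 : 0 <= 3 / 4 :> R by lra.
rewrite -(@ler_pXn2r _ 2) ?nnegrE ?nc_ge0 //.
rewrite nc_sqr ReD ReN ImD ImN /=.
have sq (t : R) : `|t| <= 1 / 2 -> t ^+ 2 <= 1 / 4.
  by rewrite -real_normK ?num_real // => h; have := normr_ge0 t; nra.
have := sq _ ha; have := sq _ hb; lra.
Qed.

(** A short step in the direction of Newton's method; it replaces the open mapping theorem. *)
Lemma decrease_modulus f w (r : R) : 0 < r -> cdv f w (dv f w) -> dv f w != 0 -> f w != 0 ->
  exists2 y, disc w r y & nc (f y) < nc (f w).
Proof.
move=> r0 df d0 f0; have nf : 0 < nc (f w) by rewrite nc_gt0.
have nd : 0 < nc (dv f w) by rewrite nc_gt0.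
have [e e0 he] := cdv_eps df (e := nc (dv f w) / 2) ltac:(lra).
pose q := f w / dv f w.
have nq : 0 < nc q by rewrite nc_div divr_gt0.
pose s := Num.min (1 / 2) (Num.min r e / (2 * nc q)).
have s0 : 0 < s by rewrite lt_min; apply/andP; split; [lra|rewrite divr_gt0 ?lt_min ?r0 // mulr_gt0].
have [s1 s2] : s <= 1 / 2 /\ s <= Num.min r e / (2 * nc q) by rewrite !ge_min !lexx orbT.
have m0 : 0 < Num.min r e by rewrite lt_min r0.
have [m1 m2] : Num.min r e <= r /\ Num.min r e <= e by rewrite !ge_min !lexx orbT.
have sq : s * nc q <= Num.min r e / 2.
  by move: s2; rewrite ler_pdivlMr ?mulr_gt0 //; lra.
pose y := w - s%:C%C * q.
have yw : y - w = - (s%:C%C * q) by rewrite /y addrAC subrr add0r.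
have nyw : nc (y - w) = s * nc q by rewrite yw ncN ncM nc_real gtr0_norm.
exists y; first by rewrite /disc /= nyw; lra.
have := he y; rewrite nyw => /(_ ltac:(lra)).
have -> : dv f w * (y - w) = - (s%:C%C * f w) by rewrite yw /q; field.
have E : nc (dv f w) / 2 * (s * nc q) = s * nc (f w) / 2.
  by rewrite /q nc_div; field; rewrite gt_eqF.
rewrite E => h1.
have := ncD (f y - f w - - (s%:C%C * f w)) ((1 - s)%:C%C * f w).
have -> : f y - f w - - (s%:C%C * f w) + (1 - s)%:C%C * f w = f y.
  by rewrite rmorphB /=; ring.
rewrite ncM nc_real ger0_norm; last lra.
nra.
Qed.

Lemma lsq_zero_dv X z : lsq X z -> X z = 0 -> cdv X z 0.
Proof.
move=> [r r0 [h Hh hE]] X0; have zr := disc_center z r0.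
have h0 : h z = 0 by apply/eqP; rewrite -sqrf_eq0 hE // X0.
apply: (@cdv_near _ (fun w => h w * h w) _ _ _ r) => //.
have E : dv h z * h z + h z * dv h z = 0 by rewrite h0 mulr0 mul0r addr0.
by have := cdvM (Hol_cdv Hh zr) (Hol_cdv Hh zr); rewrite E.
Qed.

Definition even_over (L : set C) G U := Hol U G /\
  forall l z, L l -> U z -> lsq (fun w => G w - l) z.

(* Bloch's argument: where (1 - |z|)|g'(z)| is maximal, g is injective on a disc whose
   image contains a disc of proportional radius; if that exceeds the covering radius of
   the lattice, g takes a lattice value with multiplicity one. *)
Lemma landau G : even_over inLat G (disc 0 1) -> nc (dv G 0) <= 48.
Proof.
move=> [HG evG]; rewrite leNgt; apply/negP => big.
(* Shrinking by [r < 1] makes [g] holomorphic beyond the closed unit disc and keeps its derivative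
   at 0 larger than 48 in modulus. *)
pose r := (48 / nc (dv G 0) + 1) / 2.
have q1 : 48 / nc (dv G 0) < 1 by rewrite ltr_pdivrMr ?mul1r //; lra.
have q0 : 0 < 48 / nc (dv G 0) by rewrite divr_gt0 //; lra.
have [r0 r1] : 0 < r /\ r < 1 by rewrite /r; lra.
have rG : 48 < r * nc (dv G 0).
  have : 48 / nc (dv G 0) < r by rewrite /r; lra.
  by rewrite ltr_pdivrMr //; lra.
pose g z := G (r%:C%C * z).
have nr : nc (r%:C%C : C) = r by rewrite nc_real gtr0_norm.
have rr1 : 1 < r^-1 by rewrite invf_gt1.
have rdisc z : disc 0 r^-1 z -> disc 0 1 (r%:C%C * z).
  by rewrite !disc0E ncM nr => h; rewrite -ltr_pdivlMl // mulr1.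
have Hrz : Hol (disc 0 r^-1) (fun z => r%:C%C * z).
  by apply: HolZ; [exact: disc_open|apply: Hol_id; exact: disc_open].
have Hg : Hol (disc 0 r^-1) g.
  exact: (Hol_comp (@disc_open R _ _) (@disc_open R _ _) rdisc Hrz HG).
have dgE z : disc 0 r^-1 z -> dv g z = dv G (r%:C%C * z) * r%:C%C.
  move=> zr; apply: dvE; apply: (@cdv_comp _ (fun z => r%:C%C * z) G); last first.
    by apply: (Hol_cdv HG); exact: rdisc.
  exact: cdv_mulc.
have unit_sub z : nc z <= 1 -> disc 0 r^-1 z by rewrite disc0E => h; lra.
have [zs /= zs1 zmax] := @extreme_value _ [set z : C | nc z <= 1]
   (fun z => nc (dv g z) * (1 - nc z)) 1
  ltac:(by exists 0; rewrite /= nc0) ltac:(by [])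
  ltac:(by move=> z h; apply: (nc_closed_le _ h))
  ltac:(move=> z /= z1; apply: (@ccont_near _ (fun w => (nc (dv g w))%:C%C * (1 - (nc w)%:C%C)) _ _ 1) => //;
    [by move=> w _; rewrite rmorphM rmorphB
    |apply: ccontM; [by apply: ccont_nc; apply: (Hol_cont (Hol_dv Hg)); exact: unit_sub
                    |by apply: ccontB; [exact: ccont_cst|exact: ccont_ncid]]]).
set a := dv g zs in zmax.
have m48 : 48 < nc a * (1 - nc zs).
  apply: lt_le_trans (zmax 0 _); last by rewrite /= nc0.
  rewrite nc0 subr0 mulr1 dgE ?mulr0; last by apply: unit_sub; rewrite nc0.
  by rewrite ncM nr mulrC.
have a0 := nc_ge0 a.
have zs_lt : nc zs < 1 by rewrite lt_neqAle zs1 andbT; apply: contraTneq m48 => ->; rewrite subrr mulr0 -leNgt.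
have na : 0 < nc a.
  by rewrite lt_def a0 andbT; apply: contraTneq m48 => ->; rewrite mul0r -leNgt.
pose t := (1 - nc zs) / 2.
have t0 : 0 < t by rewrite /t; lra.
have m24 : 24 < nc a * t by rewrite /t; lra.
have dsub w : disc zs t w -> nc w <= 1.
  by rewrite /disc /= => h; have := ncB_ge w zs; rewrite /t in h; lra.
have bdg w : disc zs t w -> nc (dv g w) <= 2 * nc a.
  move=> wt; have := zmax w (dsub w wt).
  have : t <= 1 - nc w by rewrite /disc /= in wt; have := ncB_ge w zs; rewrite /t in wt *; lra.
  have -> : 1 - nc zs = 2 * t by rewrite /t; field.
  have := nc_ge0 (dv g w) => d0 t1 h.
  have : nc (dv g w) * t <= nc a * (2 * t) by apply: le_trans h; apply: ler_wpM2l.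
  rewrite [nc a * (2 * t)]mulrA (ler_pM2r t0); lra.
have Hg' : Hol (disc zs t) g by apply: Hol_sub Hg => w /dsub; exact: unit_sub.
(* The derivative varies by at most [3 * nc a] on the disc of radius [t]; by the Schwarz lemma the
   sixth of this radius leaves [nc a / 2]. *)
have close w : nc (w - zs) <= t / 6 -> nc (dv g w - a) <= nc a / 2.
  move=> wt.
  have h : nc (dv g w - a) <= 3 * nc a / t * nc (w - zs).
    apply: (schwarz_disc t0 (Hol_dv Hg')); last by rewrite /disc /=; lra.
    by move=> y yt; have := ncB (dv g y) a; have := bdg y yt; lra.
  apply: le_trans h _; rewrite mulrAC ler_pdivrMr //.
  have : 3 * nc a * nc (w - zs) <= 3 * nc a * (t / 6) by rewrite ler_pM2l //; lra.
  lra.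
have dg0 w : nc (w - zs) <= t / 6 -> dv g w != 0.
  move=> wt; rewrite -nc_gt0; have := close w wt; have := ncB_ge a (dv g w).
  rewrite (nc_distC a); lra.
(* The displacement is at least [nc a * t / 12], and [nc a * t > 24]: this is where 48 comes
   from. *)
have far w : nc (w - zs) = t / 6 -> 2 < nc (g w - g zs).
  move=> wt.
  have : nc ((g w - a * w) - (g zs - a * zs)) <= nc a / 2 * nc (w - zs).
    have sd u : 0 <= u -> u <= 1 -> nc (seg zs w u - zs) <= t / 6.
      by move=> u0 u1; rewrite segBc; apply: nc_seg_le => //; rewrite ?subrr ?nc0 ?wt //; lra.
    apply: (@mean_value _ (fun y => g y - a * y) (fun y => dv g y - a)) => u u0 u1.
      apply: cdvB; first by apply: (Hol_cdv Hg'); rewrite /disc /=; have := sd u u0 u1; lra.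
      exact: cdv_mulc.
    by apply: close; exact: sd.
  have := ncB_ge (a * (w - zs)) (g w - a * w - (g zs - a * zs) + a * (w - zs)).
  rewrite ncM wt.
  have -> : g w - a * w - (g zs - a * zs) + a * (w - zs) = g w - g zs by ring.
  have -> : a * (w - zs) - (g w - g zs) = - (g w - a * w - (g zs - a * zs)) by ring.
  rewrite ncN; lra.
have [l Ll ln] := nearest_lattice (g zs).
(* The closest approach to [l] is interior, since [g] is more than 2 away from [g zs] on the
   boundary while [g zs] is within 3/4 of [l]. It is then a zero of [g - l], and a simple one. *)
have [ws /= ws1 wmin] := @extreme_value _ [set w : C | nc (w - zs) <= t / 6]
   (fun z => - nc (g z - l)) (t / 6 + nc zs)
  ltac:(by exists zs; rewrite /= subrr nc0; lra)
  ltac:(by move=> z /= h; have := ncB_ge z zs; lra)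
  ltac:(by move=> z h; apply: (@nc_closed_le _ [set w | nc w <= t / 6]) => // e /h[w wr wz];
         exists (w - zs) => //; rewrite opprB addrA subrK)
  ltac:(move=> z /= z1; apply: (@ccont_near _ (fun w => - (nc (g w - l))%:C%C) _ _ 1) => //;
    [by move=> w _; rewrite rmorphN
    |apply: ccontN; apply: ccont_nc; apply: ccontB; last exact: ccont_cst;
     by apply: (Hol_cont Hg'); rewrite /disc /=; lra]).
have wmin0 := wmin zs ltac:(by rewrite /= subrr nc0; lra).
have ws_lt : nc (ws - zs) < t / 6.
  rewrite lt_neqAle ws1 andbT; apply/eqP => E; have := far _ E.
  have := ncB_ge (g ws - g zs) (l - g zs); rewrite opprB addrA subrK (nc_distC l); lra.
have gl : g ws = l.
  apply/eqP; rewrite -subr_eq0; apply/negPn/negP => ne.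
  have dgl : cdv (fun w => g w - l) ws (dv g ws).
    rewrite -[X in cdv _ _ X]subr0; apply: cdvB; last exact: cdv_cst.
    by apply: (Hol_cdv Hg'); rewrite /disc /=; lra.
  have [] := @decrease_modulus (fun w => g w - l) ws (t / 6 - nc (ws - zs)).
  - lra.
  - exact: dvP dgl.
  - by rewrite (dvE dgl); exact: dg0.
  - exact: ne.
  move=> y yd lt; have := wmin y; rewrite /disc /= in yd.
  have := nc_triangle y ws zs => tr /(_ ltac:(lra)); lra.
have /negP := dg0 ws ws1; apply.
have ws2 : disc 0 r^-1 ws by apply: unit_sub; apply: dsub; rewrite /disc /=; lra.
have lsg : lsq (fun w => g w - l) ws.
  by apply: (@lsq_comp _ (disc 0 r^-1) (fun y => G y - l) (fun z => r%:C%C * z));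
    [exact: disc_open|exact: Hrz|exact: ws2|apply: evG => //; exact: rdisc].
have := lsq_zero_dv lsg; rewrite gl subrr => /(_ erefl) d0.
have d1 : cdv (fun w => g w - l) ws (dv g ws - 0).
  by apply: cdvB; [exact: (Hol_cdv Hg)|exact: cdv_cst].
by rewrite -[dv g ws]subr0 (cdv_uniq d1 d0).
Qed.

Lemma landau_disc G c (r : R) : 0 < r -> even_over inLat G (disc c r) -> nc (dv G c) <= 48 / r.
Proof.
move=> r0 [HG evG].
have nr : nc (r%:C%C : C) = r by rewrite nc_real gtr0_norm.
have rdisc z : disc 0 1 z -> disc c r (c + r%:C%C * z).
  by rewrite disc0E /disc /= [c + _]addrC addrK ncM nr => h; rewrite -ltr_pdivlMl // mulVf ?gt_eqF.
have Hrz : Hol (disc 0 1) (fun z => c + r%:C%C * z).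
  apply: HolD; [exact: disc_open|apply: Hol_cst; exact: disc_open|].
  by apply: HolZ; [exact: disc_open|apply: Hol_id; exact: disc_open].
have Hg : Hol (disc 0 1) (fun z => G (c + r%:C%C * z)).
  exact: (Hol_comp (@disc_open R _ _) (@disc_open R _ _) rdisc Hrz HG).
have z0 : disc (0 : C) 1 0 by rewrite disc0E nc0.
have E : dv (fun z => G (c + r%:C%C * z)) 0 = dv G c * r%:C%C.
  apply: dvE; apply: (@cdv_comp _ (fun z => c + r%:C%C * z) G); last first.
    by rewrite mulr0 addr0; apply: (Hol_cdv HG); exact: disc_center.
  rewrite -[X in cdv _ _ X]add0r.
  by apply: cdvD; [exact: cdv_cst|exact: cdv_mulc].
have := @landau (fun z => G (c + r%:C%C * z)); rewrite E ncM nr -ler_pdivlMr //.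
apply; split=> // l z Ll zd.
by apply: (@lsq_comp _ (disc 0 1) (fun y => G y - l) (fun z => c + r%:C%C * z));
    [exact: disc_open|exact: Hrz|exact: zd|apply: evG => //; exact: rdisc].
Qed.

End Landau.

(** * Disc automorphisms and holomorphic self-maps of the disc *)

Section Mobius.
Variable R : realType.
Local Notation C := (R[i]).
Implicit Types (a b c x y z w : C).

Definition udisc : set C := disc 0 1.

Lemma udiscE z : udisc z = (nc z < 1) :> Prop.
Proof. exact: disc0E. Qed.

Lemma udisc0 : udisc 0.
Proof. by rewrite udiscE nc0. Qed.

Lemma udisc_open : copen udisc.
Proof. exact: disc_open. Qed.

Lemma udisc_convex : cconvex udisc.
Proof. exact: disc_convex. Qed.

(** The automorphism [mob a 1], which sends [a] to 0; its inverse is [mb (- a)]. *)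
Definition mb a z : C := (z - a) / (1 - cconj a * z).

Lemma cconjN a : cconj (- a) = - cconj a.
Proof. by case: a. Qed.

Lemma mb_identity a z :
  nc (1 - cconj a * z) ^+ 2 - nc (z - a) ^+ 2 = (1 - nc a ^+ 2) * (1 - nc z ^+ 2).
Proof. by rewrite !nc_sqr; case: a => a1 a2; case: z => z1 z2 /=; ring. Qed.

Lemma nc_sqr_lt1 z : nc z < 1 -> nc z ^+ 2 < 1.
Proof. by move=> h; have := nc_ge0 z; nra. Qed.

Lemma mb_den a z : nc a < 1 -> nc z < 1 -> 1 - cconj a * z != 0.
Proof.
move=> a1 z1; rewrite -nc_gt0; have := ncB_ge 1 (cconj a * z).
rewrite nc1 ncM nc_conj; have := nc_ge0 a; have := nc_ge0 z => z0 a0.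
have : nc a * nc z < 1 by apply: le_lt_trans a1; rewrite ler_piMr // ltW.
lra.
Qed.

Lemma one_sub_mb a z : nc a < 1 -> nc z < 1 ->
  1 - nc (mb a z) ^+ 2 = (1 - nc a ^+ 2) * (1 - nc z ^+ 2) / nc (1 - cconj a * z) ^+ 2.
Proof.
move=> a1 z1; rewrite -mb_identity /mb nc_div expr_div_n mulrBl divff //.
by rewrite expf_neq0 // nc_eq0 mb_den.
Qed.

Lemma mb_lt1 a z : nc a < 1 -> nc z < 1 -> nc (mb a z) < 1.
Proof.
move=> a1 z1; rewrite -(@ltr_pXn2r _ 2) ?nnegrE ?nc_ge0 // expr1n -subr_gt0 one_sub_mb //.
apply: divr_gt0; first by apply: mulr_gt0; rewrite subr_gt0 nc_sqr_lt1.
by apply: exprn_gt0; rewrite nc_gt0 mb_den.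
Qed.

Lemma mb_self a : mb a a = 0.
Proof. by rewrite /mb subrr mul0r. Qed.

Lemma mb_0 a : mb a 0 = - a.
Proof. by rewrite /mb mulr0 subr0 sub0r divr1. Qed.

Lemma one_sub_aa a : nc a < 1 -> 1 - a * cconj a != 0.
Proof. by move=> a1; rewrite mulrC mb_den. Qed.

Lemma mbK a z : nc a < 1 -> nc z < 1 -> mb (- a) (mb a z) = z.
Proof.
move=> a1 z1; have d := mb_den a1 z1; have e := one_sub_aa a1.
rewrite /mb cconjN; move: (cconj a) d e => k d e; field; rewrite d /=.
have -> : 1 - k * z - - k * (z - a) = 1 - a * k by ring.
by [].
Qed.

Lemma mbNK a z : nc a < 1 -> nc z < 1 -> mb a (mb (- a) z) = z.
Proof. by move=> a1 z1; rewrite -{1}(opprK a) mbK // ncN. Qed.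

Lemma mb_sub a x y : nc a < 1 -> nc x < 1 -> nc y < 1 ->
  mb a x - mb a y = (x - y) * ((1 - a * cconj a) / ((1 - cconj a * x) * (1 - cconj a * y))).
Proof.
move=> a1 x1 y1; have := mb_den a1 x1; have := mb_den a1 y1; rewrite /mb.
by move: (cconj a) => k dy dx; field; rewrite dx dy.
Qed.

Lemma Hol_mb a : nc a < 1 -> Hol udisc (mb a).
Proof.
move=> a1; have oD := udisc_open; apply: Hol_div => //.
- by move=> z; rewrite udiscE; exact: mb_den.
- by apply: HolBc => //; exact: Hol_id.
- by apply: HolB => //; [exact: Hol_cst|apply: HolZ => //; exact: Hol_id].
Qed.

Lemma cdv_mb a z : nc a < 1 -> nc z < 1 ->
  cdv (mb a) z ((1 - a * cconj a) / (1 - cconj a * z) ^+ 2).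
Proof.
move=> a1 z1; have d := mb_den a1 z1.
have h1 : cdv (fun w => w - a) z (1 - 0) by apply: cdvB; [exact: cdv_id|exact: cdv_cst].
have h2 : cdv (fun w => 1 - cconj a * w) z (0 - cconj a).
  by apply: cdvB; [exact: cdv_cst|exact: cdv_mulc].
have := cdvM h1 (cdvV h2 d).
suff -> : (1 - 0) * (1 - cconj a * z)^-1 +
   (z - a) * (- (1 - cconj a * z) ^- 2 * (0 - cconj a)) =
   (1 - a * cconj a) / (1 - cconj a * z) ^+ 2 by [].
by move: (cconj a) d => k d; field.
Qed.

Lemma dv_mb0 a : nc a < 1 -> dv (mb a) 0 = 1 - a * cconj a.
Proof.
move=> a1; have z1 : nc (0 : C) < 1 by rewrite nc0.
by rewrite (dvE (cdv_mb a1 z1)) mulr0 subr0 expr1n divr1.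
Qed.

Lemma dv_mb_self a : nc a < 1 -> dv (mb a) a = (1 - a * cconj a)^-1.
Proof.
move=> a1; rewrite (dvE (cdv_mb a1 a1)) [cconj a * a]mulrC.
by have := one_sub_aa a1; move: (cconj a) => k e; field.
Qed.

Definition selfmap (f : C -> C) := Hol udisc f /\ forall z, udisc z -> udisc (f z).

Lemma selfmap_comp f g : selfmap f -> selfmap g -> selfmap (fun z => f (g z)).
Proof.
move=> [Hf fd] [Hg gd]; split=> [|z /gd /fd //].
exact: (Hol_comp udisc_open udisc_open gd Hg Hf).
Qed.

Lemma selfmap_mb a : nc a < 1 -> selfmap (mb a).
Proof. by move=> a1; split=> [|z]; [exact: Hol_mb|rewrite !udiscE; exact: mb_lt1]. Qed.

Lemma selfmap_id : selfmap id.
Proof. by split=> //; apply: Hol_id; exact: udisc_open. Qed.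

Lemma selfmap_schwarz f z : selfmap f -> f 0 = 0 -> nc z < 1 -> nc (f z) <= nc z.
Proof.
move=> [Hf fd] f0 z1; rewrite -[X in _ <= X]mul1r -[X in X * _]divr1.
apply: schwarz0 => // w w1; apply/ltW; rewrite -udiscE; apply: fd.
by rewrite udiscE.
Qed.

Lemma selfmap_dv0 f : selfmap f -> f 0 = 0 -> nc (dv f 0) <= 1.
Proof.
move=> sf f0; apply: (cdv_le ltr01); first exact: (Hol_cdv sf.1 udisc0).
by move=> w; rewrite subr0 f0 subr0 mul1r => w1; exact: selfmap_schwarz.
Qed.

End Mobius.

(** * Finite towers of two-sheeted branched coverings *)

Section Tower.
Variable R : realType.
Local Notation C := (R[i]).
Implicit Types (a b c l x y z w : C) (F G phi X Y : C -> C) (L B : set C).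
Local Notation D := (@udisc R).

(* [dbl b] is the two-sheeted branched covering of the disc by itself with critical value b
   that fixes 0. *)
Definition dbl_c b : C := sqrtc (- b).
Definition dbl_N b z : C := mb (- dbl_c b) z.
Definition dbl b z : C := mb (- b) (dbl_N b z ^+ 2).

Lemma dbl_c_sqr b : dbl_c b ^+ 2 = - b.
Proof. exact: sqr_sqrtc. Qed.

Lemma nc_dbl_c_sqr b : nc (dbl_c b) ^+ 2 = nc b.
Proof. by rewrite -ncX dbl_c_sqr ncN. Qed.

Lemma nc_dbl_c b : nc b < 1 -> nc (dbl_c b) < 1.
Proof.
move=> b1; rewrite ltNge; apply/negP => h.
by have := nc_dbl_c_sqr b; nra.
Qed.

Lemma dbl_N_lt1 b z : nc b < 1 -> nc z < 1 -> nc (dbl_N b z) < 1.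
Proof. by move=> b1 z1; apply: mb_lt1 => //; rewrite ncN nc_dbl_c. Qed.

Lemma dbl_N2_lt1 b z : nc b < 1 -> nc z < 1 -> nc (dbl_N b z ^+ 2) < 1.
Proof. by move=> b1 z1; rewrite ncX nc_sqr_lt1 // dbl_N_lt1. Qed.

Lemma selfmap_dbl_N b : nc b < 1 -> selfmap (dbl_N b).
Proof. by move=> b1; apply: selfmap_mb; rewrite ncN nc_dbl_c. Qed.

Lemma selfmap_dbl b : nc b < 1 -> selfmap (dbl b).
Proof.
move=> b1; apply: (@selfmap_comp _ (mb (- b)) (fun z => dbl_N b z ^+ 2)).
  by apply: selfmap_mb; rewrite ncN.
split; first by apply: HolX; [exact: udisc_open|exact: (selfmap_dbl_N b1).1].
by move=> z; rewrite !udiscE; exact: dbl_N2_lt1.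
Qed.

Lemma dbl_0 b : dbl b 0 = 0.
Proof. by rewrite /dbl /dbl_N mb_0 opprK dbl_c_sqr mb_self. Qed.

Lemma dbl_fiber b x y : nc b < 1 -> nc x < 1 -> nc y < 1 ->
  dbl b x - dbl b y = (dbl_N b x ^+ 2 - dbl_N b y ^+ 2) *
   ((1 - b * cconj b) / ((1 + cconj b * dbl_N b x ^+ 2) * (1 + cconj b * dbl_N b y ^+ 2))).
Proof.
move=> b1 x1 y1; rewrite /dbl mb_sub ?dbl_N2_lt1 ?ncN //.
by rewrite cconjN !mulNr mulrN !opprK.
Qed.

Lemma dbl_den b x : nc b < 1 -> nc x < 1 -> 1 + cconj b * dbl_N b x ^+ 2 != 0.
Proof.
move=> b1 x1; have := @mb_den _ (- b) (dbl_N b x ^+ 2).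
by rewrite ncN cconjN mulNr opprK; apply=> //; exact: dbl_N2_lt1.
Qed.

(** The factor of [dbl b x - dbl b y] that never vanishes; the parity of a zero is therefore that of
    a difference of squares. *)
Definition dbl_unit b y x : C :=
  (1 - b * cconj b) / ((1 + cconj b * dbl_N b x ^+ 2) * (1 + cconj b * dbl_N b y ^+ 2)).

Lemma Hol_dbl_unit b y : nc b < 1 -> nc y < 1 -> Hol D (dbl_unit b y).
Proof.
move=> b1 y1; have oD := @udisc_open R; apply: Hol_div => //.
- by move=> z; rewrite udiscE => z1; rewrite mulf_neq0 // dbl_den.
- exact: Hol_cst.
- apply: HolM => //; last exact: Hol_cst.
  apply: HolD => //; [exact: Hol_cst|apply: HolZ => //; apply: HolX => //].
  exact: (selfmap_dbl_N b1).1.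
Qed.

Lemma dbl_unit_neq0 b y x : nc b < 1 -> nc y < 1 -> nc x < 1 -> dbl_unit b y x != 0.
Proof.
move=> b1 y1 x1; rewrite /dbl_unit mulf_neq0 ?one_sub_aa // invr_neq0 // mulf_neq0 //;
by rewrite dbl_den.
Qed.

(** The quotient of [dbl b x - dbl b y] by [x - y]; it is nonzero at [x = y] unless [y] is the
    critical point, so simple zeros stay simple. *)
Definition dbl_lin b y x : C := (1 - dbl_c b * cconj (dbl_c b)) /
   ((1 + cconj (dbl_c b) * x) * (1 + cconj (dbl_c b) * y)) *
   (dbl_N b x + dbl_N b y) * dbl_unit b y x.

Lemma dbl_den1 b x : nc b < 1 -> nc x < 1 -> 1 + cconj (dbl_c b) * x != 0.
Proof.
move=> b1 x1; have := @mb_den _ (- dbl_c b) x.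
by rewrite ncN cconjN mulNr opprK; apply=> //; exact: nc_dbl_c.
Qed.

Lemma dbl_factor b y x : nc b < 1 -> nc y < 1 -> nc x < 1 ->
  dbl b x - dbl b y = (x - y) * dbl_lin b y x.
Proof.
move=> b1 y1 x1; rewrite dbl_fiber // subr_sqr {1}/dbl_N {1}/dbl_N mb_sub ?ncN ?nc_dbl_c //.
rewrite cconjN !mulNr mulrN !opprK /dbl_lin /dbl_unit; ring.
Qed.

Lemma Hol_dbl_lin b y : nc b < 1 -> nc y < 1 -> Hol D (dbl_lin b y).
Proof.
move=> b1 y1; have oD := @udisc_open R; apply: HolM => //; last exact: Hol_dbl_unit.
apply: HolM => //; last first.
  by apply: HolD => //; [exact: (selfmap_dbl_N b1).1|exact: Hol_cst].
apply: Hol_div => //; [|exact: Hol_cst|].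
  by move=> z; rewrite udiscE => z1; rewrite mulf_neq0 // dbl_den1.
apply: HolM => //; last exact: Hol_cst.
by apply: HolD => //; [exact: Hol_cst|apply: HolZ => //; exact: Hol_id].
Qed.

Lemma dbl_critical b y : nc b < 1 -> nc y < 1 -> dbl_N b y = 0 -> dbl b y = b.
Proof. by move=> b1 y1 E; rewrite /dbl E expr0n /= mb_0 opprK. Qed.

Lemma dbl_critical_inv b y : nc b < 1 -> nc y < 1 -> dbl b y = b -> dbl_N b y = 0.
Proof.
move=> b1 y1 E; apply/eqP; rewrite -sqrf_eq0; apply/eqP.
rewrite -(@mbNK _ b (dbl_N b y ^+ 2)) ?dbl_N2_lt1 //.
by rewrite -/(dbl b y) E mb_self.
Qed.

Lemma dbl_lin_neq0 b y : nc b < 1 -> nc y < 1 -> dbl b y != b -> dbl_lin b y y != 0.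
Proof.
move=> b1 y1 E; rewrite /dbl_lin; apply: mulf_neq0; last exact: dbl_unit_neq0.
apply: mulf_neq0.
  apply: mulf_neq0; first by rewrite one_sub_aa // nc_dbl_c.
  by rewrite invr_neq0 // mulf_neq0 // dbl_den1.
rewrite -mulr2n mulrn_eq0 /=; apply: contra E => /eqP E.
by rewrite dbl_critical.
Qed.

(** With t the square root of |b|, the derivative at 0 has modulus 2t / (1 + t^2) < 1, as in Koebe's
    osculation method. *)
Lemma nc_dv_dbl b : nc b < 1 ->
  nc (dv (dbl b) 0) * (1 + nc b) = 2 * nc (dbl_c b).
Proof.
move=> b1; set c := dbl_c b; have c1 : nc c < 1 by exact: nc_dbl_c.
have z1 : nc (0 : C) < 1 by rewrite nc0.
have hN : cdv (dbl_N b) 0 (1 - c * cconj c).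
  have := @cdv_mb _ (- c) 0; rewrite ncN => /(_ c1 z1).
  by rewrite cconjN mulr0 subr0 expr1n divr1 mulrNN.
have N0 : dbl_N b 0 = c by rewrite /dbl_N mb_0 opprK.
have hN2 : cdv (fun z => dbl_N b z ^+ 2) 0 (2 * c * (1 - c * cconj c)).
  have := cdvM hN hN; rewrite N0 => h.
  have -> : 2 * c * (1 - c * cconj c) = (1 - c * cconj c) * c + c * (1 - c * cconj c) by ring.
  exact: h.
have hb : cdv (mb (- b)) (dbl_N b 0 ^+ 2) (1 - b * cconj b)^-1.
  have := @cdv_mb _ (- b) (- b); rewrite ncN => /(_ b1 b1).
  rewrite N0 dbl_c_sqr cconjN !mulrNN [cconj b * b]mulrC.
  have e := one_sub_aa b1.
  suff -> : (1 - b * cconj b) / (1 - b * cconj b) ^+ 2 = (1 - b * cconj b)^-1 by [].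
  by move: (cconj b) e => k e; field.
rewrite (dvE (cdv_comp hN2 hb)) !ncM ncV nc_nat !mul_cconj.
have nn (t : R) : t < 1 -> nc (1 - t%:C%C : C) = 1 - t.
  by move=> t1; rewrite -(rmorphB (real_complex R) 1 t) nc_real ger0_norm //; lra.
rewrite !nn ?nc_sqr_lt1 //.
rewrite nc_dbl_c_sqr; have b2 := nc_sqr_lt1 b1.
have b0 := nc_ge0 b.
by field; rewrite gt_eqF //; lra.
Qed.

(** Follows from 1 - 2t / (1 + t^2) = (1 - t)^2 / (1 + t^2), where 1 + t^2 <= 2. The bound is
    uniform in [b]. *)
Lemma nc_dv_dbl_le b (rho : R) : nc b <= rho -> rho < 1 ->
  nc (dv (dbl b) 0) <= 1 - (1 - Num.sqrt rho) ^+ 2 / 2.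
Proof.
move=> br r1; have b1 : nc b < 1 by lra.
have := nc_dv_dbl b1; rewrite -(nc_dbl_c_sqr b); set t := nc (dbl_c b).
have t0 : 0 <= t by exact: nc_ge0.
have ts : t <= Num.sqrt rho.
  rewrite -(@ler_pXn2r _ 2) ?nnegrE ?sqrtr_ge0 // sqr_sqrtr; last by apply: le_trans br; exact: nc_ge0.
  by rewrite /t nc_dbl_c_sqr.
have s1 : Num.sqrt rho < 1 by rewrite -[X in _ < X]sqrtr1 ltr_sqrt.
set s := Num.sqrt rho in ts s1 *; set d := nc _.
move=> E; have d0 : 0 <= d by exact: nc_ge0.
have h1 : (1 - s) ^+ 2 <= (1 - t) ^+ 2 by rewrite ler_pXn2r ?nnegrE //; lra.
have tt : 0 < 1 + t ^+ 2 by have := sqr_ge0 t; lra.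
rewrite -(ler_pM2r tt) E.
have h2 : 0 <= (1 - s) ^+ 2 by rewrite sqr_ge0.
have h3 : 0 <= t ^+ 2 <= 1 by rewrite sqr_ge0 exprn_ile1 //; lra.
have h4 : (1 - s) ^+ 2 * (1 + t ^+ 2) <= (1 - t) ^+ 2 * 2.
  by apply: ler_pM => //; lra.
have -> : (1 - (1 - s) ^+ 2 / 2) * (1 + t ^+ 2) =
   1 + t ^+ 2 - (1 - s) ^+ 2 * (1 + t ^+ 2) / 2 by ring.
have : (1 - t) ^+ 2 = 1 - 2 * t + t ^+ 2 by ring.
lra.
Qed.

(** Odd order of vanishing at [x]: one linear factor times a local square. *)
Definition lodd X x := exists2 Y, lsq Y x &
  exists2 d : R, 0 < d & forall w, nc (w - x) < d -> X w = (w - x) * Y w.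

(* F is a finite tower of two-sheeted coverings; B is the set of points where the values in L
   are still taken with odd multiplicity. *)
Record tower L F B := Tower {
  tw_self : selfmap F;
  tw_0 : F 0 = 0;
  tw_even : forall l x, L l -> D x ->
     lsq (fun w => F w - l) x \/ (B x /\ lodd (fun w => F w - l) x);
  tw_B : forall b, B b -> b != 0 /\ nc b < 1;
  tw_lift : forall G, even_over L G D -> selfmap G -> G 0 = 0 ->
    exists phi, [/\ even_over B phi D, selfmap phi, phi 0 = 0 &
                    forall z, D z -> G z = F (phi z)] }.

Lemma lsq_cst c z : lsq (fun=> c) z.
Proof.
exists 1 => //; exists (fun=> sqrtc c); first by apply: Hol_cst; exact: disc_open.
by move=> w _; rewrite sqr_sqrtc.
Qed.

Lemma lsq_sqr U f z : copen U -> Hol U f -> U z -> lsq (fun w => f w ^+ 2) z.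
Proof. by move=> oU Hf Uz; apply: (has_sqrt_lsq oU) => //; exists f. Qed.

Lemma tower_id L : (forall b, L b -> b != 0 /\ nc b < 1) -> tower L id L.
Proof.
move=> hL; have Hid : Hol D id by apply: Hol_id; exact: udisc_open.
split=> //.
  move=> l x Ll Dx; have [->|ne] := eqVneq x l.
    right; split=> //; exists (fun=> 1); first exact: lsq_cst.
    by exists 1 => // w _; rewrite mulr1.
  left; apply: (lsq_nz (@udisc_open R)) => //; last by rewrite subr_eq0.
  by apply: HolBc => //; exact: udisc_open.
by move=> G eG sG G0; exists G.
Qed.

(** The point over [b] itself is dropped: the branching of [dbl b] there turns odd multiplicity into
    even. *)
Definition next_branch b B : set C := [set y | [/\ nc y < 1, B (dbl b y) & dbl b y != b]].

(** Since [b] is in [B], the function [mb b \o phi] has only even zeros and a global root [h];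
    solving [phi = dbl b psi] for [psi] amounts to extracting this root, with the sign for which
    [psi 0 = 0]. *)
Lemma dbl_lift b B phi : nc b < 1 -> B b -> even_over B phi D -> selfmap phi -> phi 0 = 0 ->
  exists psi, [/\ even_over (next_branch b B) psi D, selfmap psi, psi 0 = 0 &
                  forall z, D z -> phi z = dbl b (psi z)].
Proof.
move=> b1 Bb [Hphi ev] [_ sphi] phi0; have oD := @udisc_open R.
have phi1 z : D z -> nc (phi z) < 1 by move/sphi; rewrite udiscE.
pose X z := mb b (phi z).
have HX : Hol D X by apply: (Hol_comp oD oD sphi Hphi); exact: Hol_mb.
have lX z : D z -> lsq X z.
  move=> Dz; apply: (lsqM (ev b z Bb Dz)); apply: (lsq_nz oD _ Dz).
    apply: HolV => //; first by move=> w /phi1; exact: mb_den.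
    by apply: HolB => //; [exact: Hol_cst|exact: HolZ].
  by rewrite invr_neq0 // mb_den // phi1.
have [h0 Hh0 h0E] := global_sqrt HX lX.
set c := dbl_c b; have c1 : nc c < 1 by exact: nc_dbl_c.
have [h Hh [hE hc]] : exists2 h, Hol D h & (forall z, D z -> h z ^+ 2 = X z) /\ h 0 = c.
  have : h0 0 ^+ 2 = c ^+ 2.
    by rewrite h0E; [rewrite /X phi0 mb_0 dbl_c_sqr|exact: udisc0].
  move/eqP; rewrite eqf_sqr => /orP[/eqP e|/eqP e]; first by exists h0.
  exists (fun z => - h0 z); first exact: HolN.
  by split=> [z Dz|]; rewrite ?sqrrN ?h0E // e opprK.
have h1 z : D z -> nc (h z) < 1.
  move=> Dz; rewrite ltNge; apply/negP => ge1.
  have : nc (h z ^+ 2) < 1 by rewrite hE // /X mb_lt1 // phi1.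
  by rewrite ncX; nra.
pose psi z := mb c (h z).
have psi1 z : D z -> nc (psi z) < 1 by move=> Dz; rewrite /psi mb_lt1 // h1.
have Hpsi : Hol D psi.
  by apply: (Hol_comp oD oD _ Hh (Hol_mb c1)) => z /h1; rewrite udiscE.
have psiE z : D z -> phi z = dbl b (psi z).
  move=> Dz; rewrite /dbl /dbl_N /psi mbK ?h1 // hE // /X mbK //; exact: phi1.
exists psi; split=> //; [|by split=> // z /psi1; rewrite udiscE|by rewrite /psi hc mb_self].
split=> // y z [y1 By yb] Dz.
have Hpy : Hol D (fun w => psi w - y) by exact: HolBc.
have [e|ne] := eqVneq (psi z) y; last first.
  by apply: (lsq_nz oD Hpy Dz); rewrite subr_eq0.
pose k w := dbl_lin b y (psi w).
have Hk : Hol D k.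
  by apply: (Hol_comp oD oD _ Hpsi (Hol_dbl_lin b1 y1)) => w /psi1; rewrite udiscE.
have kz : k z != 0 by rewrite /k e dbl_lin_neq0.
have fE w : D w -> phi w - dbl b y = (psi w - y) * k w.
  by move=> Dw; rewrite psiE // dbl_factor // psi1.
have nkz : 0 < nc (k z) by rewrite nc_gt0.
have [d d0 hd] := Hol_cont Hk Dz nkz; have [r r0 rD] := oD z Dz.
pose V := disc z (Num.min d r).
have oV : copen V by exact: disc_open.
have Vz : V z by apply: disc_center; rewrite lt_min d0.
have [m1 m2] : Num.min d r <= d /\ Num.min d r <= r by rewrite !ge_min !lexx orbT.
have VD : V `<=` D by apply: subset_trans rD; exact: disc_mono.
have kV w : V w -> k w != 0.
  move=> /(disc_mono m1)/hd h2; rewrite -nc_gt0.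
  have := ncB_ge (k z) (k w); rewrite nc_distC; lra.
have lk : lsq (fun w => (k w)^-1) z.
  apply: (lsq_nz oV _ Vz); last by rewrite invr_neq0.
  by apply: HolV => //; exact: Hol_sub Hk.
apply: (lsq_near (d := Num.min d r) _ _ (lsqM (ev _ z By Dz) lk)).
  by rewrite lt_min d0.
by move=> w Vw; rewrite fE ?mulfK ?kV //; exact: VD.
Qed.

Lemma tower_step L F B b : tower L F B -> B b ->
  tower L (fun z => F (dbl b z)) (next_branch b B).
Proof.
move=> tw Bb; have oD := @udisc_open R; have [b0 b1] := tw_B tw Bb.
have [Hs sD] := selfmap_dbl b1.
split.
- exact: selfmap_comp (tw_self tw) (selfmap_dbl b1).
- by rewrite dbl_0 (tw_0 tw).
- move=> l x Ll Dx; have x1 : nc x < 1 by rewrite -udiscE.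
  have [lF|[Bx [Y lY [d d0 YE]]]] := tw_even tw Ll (sD x Dx).
    by left; apply: (lsq_comp oD Hs Dx lF).
  have lYs : lsq (fun w => Y (dbl b w)) x by apply: (lsq_comp oD Hs Dx lY).
  have [d1 d10 hd1] := Hol_cont Hs Dx d0; have [r r0 rD] := oD x Dx.
  have [m1 m2] : Num.min d1 r <= d1 /\ Num.min d1 r <= r by rewrite !ge_min !lexx orbT.
  have m0 : 0 < Num.min d1 r by rewrite lt_min d10.
  (* At the critical point the linear factor pulls back to a square times a unit; elsewhere it pulls
     back to a simple factor. *)
  have [sb|sb] := eqVneq (dbl b x) b; [left|right].
    have N0 : dbl_N b x = 0 by exact: dbl_critical_inv.
    have lu : lsq (fun w => dbl_N b w ^+ 2 * dbl_unit b x w) x.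
      apply: lsqM; first exact: (lsq_sqr oD (selfmap_dbl_N b1).1).
      by apply: (lsq_nz oD (Hol_dbl_unit b1 x1) Dx); rewrite dbl_unit_neq0.
    apply: (lsq_near m0 _ (lsqM lu lYs)) => w wm.
    have Dw : D w by apply: rD; exact: (disc_mono m2 wm).
    rewrite YE; last by apply: hd1; exact: (lt_le_trans wm m1).
    have w1 : nc w < 1 by rewrite -udiscE.
    by rewrite dbl_fiber // N0 expr0n subr0 /dbl_unit N0 expr0n.
  split; first by split.
  exists (fun w => dbl_lin b x w * Y (dbl b w)).
    apply: lsqM => //; apply: (lsq_nz oD (Hol_dbl_lin b1 x1) Dx).
    exact: dbl_lin_neq0.
  exists (Num.min d1 r) => // w wm.
  have Dw : D w by apply: rD; exact: (disc_mono m2 wm).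
  rewrite YE; last by apply: hd1; exact: (lt_le_trans wm m1).
  have w1 : nc w < 1 by rewrite -udiscE.
  by rewrite (dbl_factor b1 x1) // mulrA.
- move=> y [y1 By _]; split=> //; apply: contraTneq (tw_B tw By).1 => ->.
  by rewrite dbl_0 eqxx.
- move=> G eG sG G0; have [phi [ephi sphi phi0 phiE]] := tw_lift tw eG sG G0.
  have [psi [epsi spsi psi0 psiE]] := dbl_lift b1 Bb ephi sphi phi0.
  by exists psi; split=> // z Dz; rewrite phiE // psiE.
Qed.

(** The map z -> r0 z avoids [L], so it lifts to some [phi] with r0 = F'(0) phi'(0), where |phi'(0)|
    <= 1 by the Schwarz lemma. *)
Lemma tower_dv_ge L F B (r0 : R) : 0 < r0 -> r0 < 1 -> (forall l, L l -> r0 <= nc l) ->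
  tower L F B -> r0 <= nc (dv F 0).
Proof.
move=> r00 r01 Lr tw; have oD := @udisc_open R.
pose G z : C := r0%:C%C * z.
have nG z : nc (G z) = r0 * nc z by rewrite ncM nc_real gtr0_norm.
have HG : Hol D G by apply: HolZ => //; exact: Hol_id.
have G1 z : D z -> nc (G z) < r0.
  by rewrite udiscE nG => h; rewrite -ltr_pdivlMl // mulVf ?gt_eqF.
have eG : even_over L G D.
  split=> // l z Ll Dz; apply: (lsq_nz oD _ Dz); first exact: HolBc.
  rewrite subr_eq0; apply: contraTneq (Lr l Ll) => <-.
  by rewrite -ltNge; exact: G1.
have sG : selfmap G by split=> // z /G1; rewrite udiscE; lra.
have [phi [_ sphi phi0 phiE]] := tw_lift tw eG sG ltac:(by rewrite /G mulr0).
have Dz0 := @udisc0 R.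
have E : r0%:C%C = dv F 0 * dv phi 0.
  have c1 : cdv G 0 r0%:C%C by exact: cdv_mulc.
  have c2 : cdv (fun z => F (phi z)) 0 (dv F 0 * dv phi 0).
    apply: cdv_comp; first exact: (Hol_cdv sphi.1 Dz0).
    by rewrite phi0; exact: (Hol_cdv (tw_self tw).1 Dz0).
  apply: (cdv_uniq c1); apply: (cdv_near ltr01 _ c2) => w.
  by rewrite -/(disc 0 1 w) => /phiE ->.
have := selfmap_dv0 sphi phi0; have := nc_ge0 (dv F 0).
have : nc (r0%:C%C : C) = nc (dv F 0) * nc (dv phi 0) by rewrite E ncM.
rewrite nc_real gtr0_norm // => -> d0 d1.
by rewrite ler_piMr.
Qed.

(** As long as some branch point has modulus at most [rho], one more step multiplies F'(0) by a
    factor of modulus at most q < 1; the lower bound [r0] stops this after finitely many steps. *)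
Lemma tower_exists L (r0 rho : R) : 0 < r0 -> r0 < 1 -> 0 < rho -> rho < 1 ->
  (forall l, L l -> r0 <= nc l /\ nc l < 1) ->
  exists F B, tower L F B /\ forall b, B b -> rho < nc b.
Proof.
move=> r00 r01 rho0 rho1 hL; apply: contrapT => none.
have L0 b : L b -> b != 0 /\ nc b < 1.
  by move=> /hL[h1 h2]; split=> //; rewrite -nc_gt0; lra.
pose q := 1 - (1 - Num.sqrt rho) ^+ 2 / 2.
have s1 : Num.sqrt rho < 1 by rewrite -[X in _ < X]sqrtr1 ltr_sqrt.
have s0 : 0 <= Num.sqrt rho by exact: sqrtr_ge0.
have [q0 q1] : 0 < q /\ q < 1 by rewrite /q; set s := Num.sqrt rho in s0 s1 *; split; nra.
have all_k (k : nat) : exists F B, tower L F B /\ nc (dv F 0) <= q ^+ k.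
  elim: k => [|k [F [B [tw dF]]]].
    exists id, L; split; first exact: tower_id.
    by rewrite expr0 (dvE (cdv_id 0)) nc1.
  have [b Bb brho] : exists2 b, B b & nc b <= rho.
    apply: contrapT => nb; apply: none; exists F, B; split=> // b Bb.
    by rewrite ltNge; apply/negP => h; apply: nb; exists b.
  have [_ b1] := tw_B tw Bb.
  exists (fun z => F (dbl b z)), (next_branch b B); split; first exact: tower_step.
  have Dz0 := @udisc0 R.
  have c2 : cdv (fun z => F (dbl b z)) 0 (dv F 0 * dv (dbl b) 0).
    apply: cdv_comp; first exact: (Hol_cdv (selfmap_dbl b1).1 Dz0).
    by rewrite dbl_0; exact: (Hol_cdv (tw_self tw).1 Dz0).
  rewrite (dvE c2) ncM exprSr; apply: ler_pM => //; rewrite ?nc_ge0 //.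
  exact: nc_dv_dbl_le.
have [k hk] := pow_unbounded (r0^-1) (a := q^-1) ltac:(by rewrite invf_gt1).
have [F [B [tw dF]]] := all_k k.
have := tower_dv_ge r00 r01 (fun l Ll => (hL l Ll).1) tw.
move: hk; rewrite exprVn ltf_pV2 ?posrE ?exprn_gt0 //; lra.
Qed.

End Tower.

(** * The universal covering branched over the lattice *)

Section Universal.
Variable R : realType.
Local Notation C := (R[i]).
Implicit Types (a b c l x y z w : C) (F G phi X Y : C -> C) (L B : set C).
Local Notation D := (@udisc R).
Local Notation Lat := (@inLat R).

Lemma inLat0 : Lat 0.
Proof. by exists 0, 0. Qed.

Lemma inLatD l m : Lat l -> Lat m -> Lat (l + m).
Proof. by move=> [a [b ->]] [a' [b' ->]]; exists (a + a'), (b + b'); rewrite !intrD. Qed.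

Lemma inLatN l : Lat l -> Lat (- l).
Proof. by move=> [a [b ->]]; exists (- a), (- b); rewrite !rmorphN. Qed.

Lemma inLatB l m : Lat l -> Lat m -> Lat (l - m).
Proof. by move=> hl /inLatN; exact: inLatD. Qed.

Lemma intr_norm_ge1 (a : int) : a != 0 -> 1 <= `|a%:~R| :> R.
Proof. by move=> a0; rewrite -intr_norm ler1z -gtz0_ge1 normr_gt0. Qed.

Lemma lattice_norm_ge1 l : Lat l -> l != 0 -> 1 <= nc l.
Proof.
move=> [a [b ->]] ne; have [a0|a0] := eqVneq a 0.
  have b0 : b != 0 by apply: contraNneq ne => ->; rewrite a0.
  exact: le_trans (intr_norm_ge1 b0) (Im_le_nc (Complex a%:~R b%:~R)).
exact: le_trans (intr_norm_ge1 a0) (Re_le_nc (Complex a%:~R b%:~R)).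
Qed.

Lemma lattice_isolated w : exists2 d : R, 0 < d /\ d <= 1 / 4 &
  forall l, Lat l -> l != w -> d <= nc (l - w).
Proof.
have [l0 Ll0 wl0] := nearest_lattice w.
have far l : Lat l -> l != l0 -> 1 / 4 <= nc (l - w).
  move=> Ll ne; have := lattice_norm_ge1 (inLatB Ll Ll0); rewrite subr_eq0 => /(_ ne).
  have := nc_triangle l w l0; lra.
have [e|ne] := eqVneq l0 w.
  by exists (1 / 4) => [|l Ll lw]; [split; lra|apply: far => //; rewrite e].
exists (Num.min (1 / 4) (nc (l0 - w))).
  by split; [rewrite lt_min nc_gt0 subr_eq0 ne andbT; lra|rewrite ge_min lexx].
move=> l Ll lw; have [->|ne'] := eqVneq l l0; first by rewrite ge_min lexx orbT.
by rewrite ge_min far.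
Qed.

Lemma even_over_sub L G U V : V `<=` U -> even_over L G U -> even_over L G V.
Proof. by move=> VU [HG ev]; split=> [|l z Ll /VU]; [exact: Hol_sub HG|exact: ev]. Qed.

Lemma even_over_comp L G f U V : copen U -> copen V -> Hol U f -> (forall z, U z -> V (f z)) ->
  even_over L G V -> even_over L (fun z => G (f z)) U.
Proof.
move=> oU oV Hf UV [HG ev]; split; first exact: (Hol_comp oU oV UV Hf HG).
move=> l z Ll Uz; apply: (@lsq_comp _ U (fun w => G w - l) f) => //.
by apply: ev => //; exact: UV.
Qed.

(** Landau's bound on the discs of radius [rho - s] centred on the segment from 0 to [z]. *)
Lemma landau_growth G (rho s : R) z : s < rho -> even_over Lat G (disc 0 rho) ->
  nc z <= s -> nc (G z - G 0) <= 48 / (rho - s) * nc z.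
Proof.
move=> srho ev zs; have [HG _] := ev.
rewrite -[X in _ * nc X]subr0.
have s0 : 0 <= s by apply: le_trans (nc_ge0 z) zs.
have sg t : 0 <= t -> t <= 1 -> nc (seg 0 z t) <= s.
  by move=> t0 t1; apply: nc_seg_le => //; rewrite nc0.
apply: (@mean_value _ G (dv G)) => t t0 t1; have st := sg t t0 t1.
  by apply: (Hol_cdv HG); rewrite disc0E; lra.
apply: landau_disc; first lra.
apply: even_over_sub ev => w; rewrite disc0E /disc /=.
by have := ncB_ge w (seg 0 z t); lra.
Qed.

(** In place of Hurwitz's theorem: the square roots on a fixed disc are themselves bounded, and
    their limit is a root of the limit. *)
Lemma lsq_ulf fs U z (r0 : R) : locally_bounded fs U -> U z -> 0 < r0 ->
  ufn [set n | forall w, disc z r0 w -> lsq (fs n) w] -> lsq (ulf fs) z.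
Proof.
move=> bf Uz r00 lf; have [r [M [rp rU ub]]] := bf z Uz.
pose rr := Num.min r r0.
have rr0 : 0 < rr by rewrite lt_min rp.
have [m1 m2] : rr <= r /\ rr <= r0 by rewrite !ge_min !lexx orbT.
have ex (n : nat) : exists h, (Hol (disc z r) (fs n) /\
    forall w, disc z r w -> nc (fs n w) <= M) ->
    (forall w, disc z r0 w -> lsq (fs n) w) ->
    Hol (disc z rr) h /\ forall w, disc z rr w -> h w ^+ 2 = fs n w.
  have [[[Hf _] lsf]|ngood] := pselect ((Hol (disc z r) (fs n) /\
    forall w, disc z r w -> nc (fs n w) <= M) /\ (forall w, disc z r0 w -> lsq (fs n) w)).
    have [] := @global_sqrt _ (fs n) z rr.
    - by apply: Hol_sub Hf; exact: disc_mono.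
    - by move=> w /(disc_mono m2); exact: lsf.
    by move=> h Hh hE; exists h.
  by exists (fun=> 0) => h1 h2; case: ngood.
have [hs hsP] := choice ex.
have good : ufn [set n | [/\ Hol (disc z rr) (hs n),
     (forall w, disc z rr w -> hs n w ^+ 2 = fs n w) &
     forall w, disc z rr w -> nc (fs n w) <= M]].
  apply: ufnS (ufnI ub lf) => n [h1 h2]; have [h3 h4] := hsP n h1 h2; split=> //.
  by move=> w /(disc_mono m1); exact: h1.2.
have bnd : locally_bounded hs (disc z rr).
  move=> w wr; have [s s0 sr] := disc_open wr; exists s, (M + 1); split=> //.
  apply: ufnS good => n [h1 h2 h3]; split; first exact: Hol_sub h1.
  move=> y /sr yr; have := h3 y yr; rewrite -(h2 y yr) ncX.
  by have := nc_ge0 (hs n y); nra.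
exists rr => //; exists (ulf hs); first by apply: Hol_ulf => //; exact: disc_open.
move=> w wr; apply: isul_uniq (isul_sqr (ulf_isul bnd wr)) _.
apply: isul_near (ulf_isul bf (rU _ (disc_mono m1 wr))).
by apply: ufnS good => n [_ h2 _] /=; rewrite h2.
Qed.

(** The limit stays in the open disc because |phis n z| <= |z|, which uses the common fixed point
    0. *)
Lemma selfmap_ulf (phis : nat -> C -> C) : ufn [set n | selfmap (phis n) /\ phis n 0 = 0] ->
  [/\ locally_bounded phis D, selfmap (ulf phis) & ulf phis 0 = 0].
Proof.
move=> hp; have oD := @udisc_open R.
have bnd : locally_bounded phis D.
  move=> z Dz; have [r r0 rD] := oD z Dz; exists r, 1; split=> //.
  apply: ufnS hp => n [[Hp pD] _]; split; first exact: Hol_sub Hp.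
  by move=> w /rD /pD; rewrite udiscE => /ltW.
split=> //.
  split; first exact: Hol_ulf.
  move=> z Dz; rewrite udiscE; have z1 : nc z < 1 by rewrite -udiscE.
  apply: le_lt_trans z1; apply: (isul_le (ulf_isul bnd Dz)).
  by apply: ufnS hp => n [sp p0] /=; apply: selfmap_schwarz => //; rewrite -udiscE.
apply: isul_uniq (ulf_isul bnd (@udisc0 R)) _.
by apply: isul_near (isul_cst 0); apply: ufnS hp => n [_ p0] /=; rewrite p0.
Qed.

Lemma ufn_nat_ge (M : R) : ufn [set n | M <= n%:R].
Proof.
apply: ufnS (ufn_ge (Num.truncn M).+1) => n /= h.
by apply: (le_trans (ltW (truncnS_gt M))); rewrite ler_nat.
Qed.

(** The universal property at one base value; only existence of lifts is asked, their uniqueness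
    being [rigid_lift]. *)
Definition universal_at F w0 := [/\ even_over Lat F D, F 0 = w0, dv F 0 != 0 &
  forall G, even_over Lat G D -> G 0 = w0 ->
    exists phi, [/\ selfmap phi, phi 0 = 0 & forall z, D z -> G z = F (phi z)]].

(** The disc of radius [Rn n] about [w0], rescaled, is covered by a tower whose remaining branch
    points are close to the unit circle. Landau's bound gives local bounds on these coverings, and
    [F] is their limit. *)
Lemma universal_exists w0 : ~ Lat w0 -> exists F, universal_at F w0.
Proof.
move=> nw0; have oD := @udisc_open R; have Dz0 := @udisc0 R.
have [dl [dl0 dl4] iso] := lattice_isolated w0.
have iso' l : Lat l -> dl <= nc (l - w0).
  by move=> Ll; apply: iso => //; apply: contra_notN nw0 => /eqP <-.
pose Rn (n : nat) : R := n.+2%:R.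
have Rn1 n : 1 < Rn n by rewrite /Rn ltr1n.
have Rn0 n : 0 < Rn n by have := Rn1 n; lra.
have RnC n : (Rn n)%:C%C != 0 :> C by rewrite -nc_gt0 nc_real gtr0_norm.
have ncR n : nc ((Rn n)%:C%C : C) = Rn n by rewrite nc_real gtr0_norm.
have large2 (e : R) : 0 < e -> ufn [set n | n.+2%:R^-1 < e].
  move=> e0; apply: ufnS (inv_nat_small e0) => n /=; apply: le_lt_trans.
  by rewrite lef_pV2 ?posrE ?ltr0n // ler_nat.
have large (e : R) : 0 < e -> ufn [set n | (Rn n)^-1 < e] by exact: large2.
have Rn_gt n : n%:R < Rn n by rewrite /Rn ltr_nat.
clearbody Rn.
pose Ln n : set C := [set x | nc x < 1 /\ Lat (w0 + (Rn n)%:C%C * x)].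
have ex (n : nat) : exists FB, tower (Ln n) FB.1 FB.2 /\
    forall b : C, FB.2 b -> 1 - (Rn n)^-1 < nc b.
  have q0 : 0 < (Rn n)^-1 by rewrite invr_gt0.
  have q1 : (Rn n)^-1 < 1 by rewrite invf_lt1.
  have [] := @tower_exists _ (Ln n) (dl / Rn n) (1 - (Rn n)^-1).
  - by rewrite divr_gt0.
  - by rewrite ltr_pdivrMr // mul1r; have := Rn1 n; lra.
  - lra.
  - lra.
  - move=> l [l1 Ll]; split=> //; rewrite ler_pdivrMr // mulrC -[X in X * _]ncR -ncM.
    by have := iso' _ Ll; rewrite addrAC subrr add0r.
  by move=> F [B [tw hB]]; exists (F, B).
have [FB FBP] := choice ex.
pose Fn n := (FB n).1; pose Bn n := (FB n).2.
have twn n : tower (Ln n) (Fn n) (Bn n) by exact: (FBP n).1.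
pose fs n z := w0 + (Rn n)%:C%C * Fn n z.
have HF n : Hol D (fs n).
  by apply: HolD => //; [exact: Hol_cst|apply: HolZ => //; exact: (tw_self (twn n)).1].
have F1 n z : D z -> nc (Fn n z) < 1 by move/(tw_self (twn n)).2; rewrite udiscE.
(* Odd multiplicities remain only at points of [Bn n], all of modulus above [1 - (Rn n)^-1]; lattice
   points outside the disc of radius [Rn n] about [w0] are not values of [fs n]. *)
have evF n : even_over Lat (fs n) (disc 0 (1 - (Rn n)^-1)).
  have q0 : 0 < (Rn n)^-1 by rewrite invr_gt0.
  have sub : disc 0 (1 - (Rn n)^-1) `<=` D by apply: disc_mono; lra.
  split; first exact: Hol_sub (HF n).
  move=> l z Ll zr; have Dz := sub z zr; pose x := (l - w0) / (Rn n)%:C%C.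
  have lx : l = w0 + (Rn n)%:C%C * x by rewrite /x mulrC divfK // addrC subrK.
  have [x1|x1] := ltP (nc x) 1; last first.
    apply: (lsq_nz oD _ Dz); first by apply: HolBc.
    rewrite lx /fs opprD addrACA subrr add0r -mulrBr mulf_neq0 // subr_eq0.
    by apply: contraTneq x1 => <-; rewrite -ltNge; exact: F1.
  have Lx : Ln n x by split=> //; rewrite -lx.
  have lF : lsq (fun w => Fn n w - x) z.
    have [//|[Bz _]] := tw_even (twn n) Lx Dz.
    by have := (FBP n).2 z Bz; move: zr; rewrite disc0E; lra.
  apply: (lsq_near ltr01 _ (lsqM (lsq_cst (Rn n)%:C%C z) lF)) => w _.
  by rewrite lx /fs; ring.
have fs0 n : fs n 0 = w0 by rewrite /fs (tw_0 (twn n)) mulr0 addr0.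
have bnd : locally_bounded fs D.
  move=> z; rewrite udiscE => z1; pose r := (1 - nc z) / 4.
  have r0 : 0 < r by rewrite /r; lra.
  have zr : nc z + r + r + r < 1 by rewrite /r; lra.
  exists r, (nc w0 + 48 / r); split=> //.
    by move=> w; rewrite udiscE /disc /=; have := ncB_ge w z; lra.
  apply: ufnS (large _ r0) => n /= nr; split.
    by apply: Hol_sub (HF n) => w; rewrite udiscE /disc /=; have := ncB_ge w z; lra.
  move=> w wr; have w1 : nc w <= nc z + r by rewrite /disc /= in wr; have := ncB_ge w z; lra.
  have lt1 : nc z + r < 1 - (Rn n)^-1 by lra.
  have := landau_growth lt1 (evF n) w1; rewrite fs0 => h.
  have h2 : 48 / (1 - (Rn n)^-1 - (nc z + r)) * nc w <= 48 / r.
    have p1 : 0 < 1 - (Rn n)^-1 - (nc z + r) by lra.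
    apply: (@le_trans _ _ (48 / (1 - (Rn n)^-1 - (nc z + r)) * 1)).
      by apply: ler_wpM2l; [rewrite divr_ge0 // ltW|lra].
    by rewrite mulr1 ler_pM2l // lef_pV2 ?posrE //; lra.
  have := ncD (fs n w - w0) w0; rewrite subrK; lra.
pose F := ulf fs.
have HFl : Hol D F by exact: Hol_ulf.
have F0 : F 0 = w0.
  apply: isul_uniq (ulf_isul bnd Dz0) _.
  by apply: isul_near (isul_cst w0); apply: ufnT => n /=; rewrite fs0.
have evFl : even_over Lat F D.
  split=> // l z Ll Dz.
  have bnd' : locally_bounded (fun n w => fs n w - l) D.
    move=> y /bnd[r [M [r0 rD ub]]]; exists r, (M + nc l); split=> //.
    apply: ufnS ub => n [h1 h2]; split; first by apply: HolBc => //; exact: disc_open.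
    by move=> w /h2; have := ncB (fs n w) l; lra.
  have z1 : nc z < 1 by rewrite -udiscE.
  pose r := (1 - nc z) / 2; have r0 : 0 < r by rewrite /r; lra.
  have lim : lsq (ulf (fun n w => fs n w - l)) z.
    apply: (lsq_ulf bnd' Dz r0); apply: ufnS (large _ r0) => n /= nr w wr.
    apply: (evF n).2 => //; rewrite disc0E; rewrite /disc /= in wr.
    by have := ncB_ge w z; rewrite /r in wr nr; lra.
  have [s s0 sD] := oD z Dz.
  apply: (lsq_near s0 _ lim) => w /sD Dw.
  apply: isul_uniq (ulf_isul bnd' Dw) _.
  by apply: isulB; [exact: (ulf_isul bnd)|exact: isul_cst].
exists F; split=> //.
  (* Rescaling [tower_dv_ge] gives the lower bound [dl] for the derivative of every [fs n] at 0, so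
     the limit does not degenerate. *)
  rewrite -nc_gt0; apply: (lt_le_trans dl0); rewrite (dv_ulf bnd Dz0).
  apply: (isul_ge (ulf_isul (locally_bounded_dv bnd) Dz0)); apply: ufnT => n /=.
  have cd : cdv (fs n) 0 (0 + (Rn n)%:C%C * dv (Fn n) 0).
    apply: cdvD; [exact: cdv_cst|apply: cdvZ; exact: (Hol_cdv (tw_self (twn n)).1 Dz0)].
  rewrite (dvE cd) add0r ncM ncR mulrC -ler_pdivrMr //.
  apply: (@tower_dv_ge _ (Ln n) (Fn n) (Bn n)) => //; first by rewrite divr_gt0.
    by rewrite ltr_pdivrMr // mul1r; have := Rn1 n; lra.
  move=> l [l1 Ll]; rewrite ler_pdivrMr // mulrC -[X in X * _]ncR -ncM.
  by have := iso' _ Ll; rewrite addrAC subrr add0r.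
move=> G evG G0; have [HG _] := evG.
(* On the disc of radius [t < 1] the values of [G] stay within [K] of [w0]; once [Rn n > K] they can
   be lifted through tower [n]. The lifts converge in [n], and after this step [t] tends to 1. *)
have step (m : nat) : exists phi, [/\ selfmap phi, phi 0 = 0 &
    forall z, D z -> G ((1 - m.+2%:R^-1)%:C%C * z) = F (phi z)].
  set t : R := 1 - m.+2%:R^-1.
  have t0 : 0 < t by rewrite /t subr_gt0 invf_lt1 ?ltr0n // ltr1n.
  have t1 : t < 1 by rewrite /t ltrBlDr ltrDl invr_gt0 ltr0n.
  clearbody t.
  have nct z : nc (t%:C%C * z) = t * nc z by rewrite ncM nc_real gtr0_norm.
  have tD z : D z -> nc (t%:C%C * z) <= t.
    by rewrite udiscE nct => z1; rewrite ler_piMr // ltW.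
  have Ht : Hol D (fun z => t%:C%C * z) by apply: HolZ => //; exact: Hol_id.
  have tDD z : D z -> D (t%:C%C * z) by move/tD; rewrite udiscE; lra.
  pose K := 48 / (1 - t).
  have K0 : 0 < K by rewrite divr_gt0 //; lra.
  have GK z : D z -> nc (G (t%:C%C * z) - w0) <= K.
    move=> Dz; have := landau_growth t1 evG (tD z Dz); rewrite G0 => h.
    apply: le_trans h _; rewrite -/K ler_piMr ?(ltW K0) //.
    by have := tD z Dz; lra.
  have lift (n : nat) : exists phi, K < Rn n -> [/\ selfmap phi, phi 0 = 0 &
      forall z, D z -> G (t%:C%C * z) = fs n (phi z)].
    have [Kn|nK] := ltP K (Rn n); last by exists id.
    pose g z := (G (t%:C%C * z) - w0) / (Rn n)%:C%C.
    have evGt := even_over_comp oD oD Ht tDD evG.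
    have Hg : Hol D g.
      apply: (@Hol_ext _ _ (fun z => (Rn n)%:C%C^-1 * (G (t%:C%C * z) - w0))) => //.
        by move=> z _; rewrite mulrC.
      by apply: HolZ => //; apply: HolBc => //; exact: evGt.1.
    have g1 z : D z -> nc (g z) < 1.
      move=> Dz; rewrite /g nc_div ncR ltr_pdivrMr // mul1r.
      exact: le_lt_trans (GK z Dz) Kn.
    have evg : even_over (Ln n) g D.
      split=> // x z [x1 Lx] Dz.
      apply: (lsq_near ltr01 _ (lsqM (lsq_cst (Rn n)%:C%C^-1 z) (evGt.2 _ z Lx Dz))) => w _.
      by rewrite /g; move: (RnC n); set k := (Rn n)%:C%C => k0; field.
    have sg : selfmap g by split=> // z /g1; rewrite udiscE.
    have g0 : g 0 = 0 by rewrite /g mulr0 G0 subrr mul0r.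
    have [phi [_ sphi phi0 phiE]] := tw_lift (twn n) evg sg g0.
    exists phi => _; split=> // z Dz; rewrite /fs -phiE // /g.
    by rewrite [(Rn n)%:C%C * _]mulrC divfK // addrC subrK.
  have [phis phisP] := choice lift.
  have largeK : ufn [set n | K < Rn n].
    apply: ufnS (ufn_nat_ge K) => n /= h.
    exact: le_lt_trans h (Rn_gt n).
  have [bp sp p0] := @selfmap_ulf phis
    ltac:(by apply: ufnS largeK => n /phisP[]).
  exists (ulf phis); split=> // z Dz.
  apply: isul_uniq (isul_ulf_comp bnd (sp.2 _ Dz) (ulf_isul bp Dz)).
  apply: isul_near (isul_cst _).
  by apply: ufnS largeK => n /phisP[_ _] h /=; rewrite h.
have [phis phisP] := choice step.
have [bp sp p0] := @selfmap_ulf phis ltac:(by apply: ufnT => n; have [] := phisP n).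
exists (ulf phis); split=> // z Dz.
have l1 : isul (fun n => F (phis n z)) (F (ulf phis z)).
  by apply: isul_ccont (ulf_isul bp Dz) _; apply: (Hol_cont HFl); exact: sp.2.
apply: isul_uniq l1.
apply: (@isul_near _ (fun n => G ((1 - n.+2%:R^-1)%:C%C * z))).
  by apply: ufnT => n /=; have [_ _ ->] := phisP n.
apply: isul_ccont; last exact: (Hol_cont HG).
move=> e e0; apply: ufnS (large2 _ e0) => n /= h.
have -> : (1 - n.+2%:R^-1)%:C%C * z - z = - (n.+2%:R^-1%:C%C * z).
  by rewrite rmorphB /=; ring.
have z1 : nc z < 1 by rewrite -udiscE.
rewrite ncN ncM nc_real ger0_norm ?invr_ge0 ?ler0n //.
apply: le_lt_trans h; rewrite ler_piMr ?invr_ge0 ?ler0n //; exact: ltW.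
Qed.

End Universal.

(** * Deck transformations *)

Section Biholomorphic.
Variable R : realType.
Local Notation C := (R[i]).
Implicit Types (a b c l x y z w u : C) (f g h : C -> C).
Local Notation D := (@udisc R).

Lemma local_injective f c (r : R) : 0 < r -> Hol (disc c r) f -> dv f c != 0 ->
  exists2 d : R, 0 < d /\ d <= r &
    forall x y, disc c d x -> disc c d y -> f x = f y -> x = y.
Proof.
move=> r0 Hf d0; set a := dv f c; have na : 0 < nc a by rewrite nc_gt0.
have [d dp hd] := Hol_cont (Hol_dv Hf) (disc_center c r0) (e := nc a / 2) ltac:(lra).
have [m1 m2] : Num.min d r <= d /\ Num.min d r <= r by rewrite !ge_min !lexx orbT.
exists (Num.min d r); first by split=> //; rewrite lt_min dp.
move=> x y xd yd fxy.
have : nc ((f x - a * x) - (f y - a * y)) <= nc a / 2 * nc (x - y).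
  have sd t : 0 <= t -> t <= 1 -> disc c (Num.min d r) (seg y x t).
    by move=> t0 t1; apply: disc_convex.
  apply: (@mean_value _ (fun w => f w - a * w) (fun w => dv f w - a)) => t t0 t1.
    apply: cdvB; last exact: cdv_mulc.
    by apply: (Hol_cdv Hf); exact: (disc_mono m2 (sd t t0 t1)).
  by apply/ltW; apply: hd; exact: (disc_mono m1 (sd t t0 t1)).
rewrite fxy; have -> : f y - a * x - (f y - a * y) = - (a * (x - y)) by ring.
rewrite ncN ncM mulrAC => h.
have n0 := nc_ge0 (x - y).
have : nc (x - y) = 0 by apply/eqP; rewrite eq_le n0 andbT; nra.
by move/eqP; rewrite nc_eq0 subr_eq0 => /eqP.
Qed.

(** Near [x0] both lifts run in a disc where [F] is injective; the identity theorem extends the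
    equality past points where [F] is branched. *)
Lemma rigid_lift F f g (U : set C) x0 : Hol D F -> copen U -> cconvex U -> Hol U f -> Hol U g ->
  (forall z, U z -> D (f z)) -> U x0 -> f x0 = g x0 -> dv F (f x0) != 0 ->
  (forall z, U z -> F (f z) = F (g z)) -> forall z, U z -> f z = g z.
Proof.
move=> HF oU cU Hf Hg fD Ux0 fg0 d0 FE z Uz.
have [r r0 rD] := @udisc_open R _ (fD _ Ux0).
have [d [dp dr] inj] := local_injective r0 (Hol_sub rD HF) d0.
have [d1 d10 h1] := Hol_cont Hf Ux0 dp; have [d2 d20 h2] := Hol_cont Hg Ux0 dp.
have [s s0 sU] := oU _ Ux0.
apply/eqP; rewrite -subr_eq0; apply/eqP.
apply: (@identity_convex _ U (fun z => f z - g z) x0 (Num.min s (Num.min d1 d2))) => //.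
- exact: HolB.
- by rewrite !lt_min s0 d10.
move=> w; rewrite /disc /= !lt_min => /and3P[w1 w2 w3].
apply/eqP; rewrite subr_eq0; apply/eqP; apply: inj.
- exact: h1.
- by rewrite /disc /= fg0; exact: h2.
- by apply: FE; exact: sU.
Qed.

Definition bihol f := selfmap f /\ exists g, [/\ selfmap g,
  forall z, D z -> g (f z) = z & forall z, D z -> f (g z) = z].

Lemma bihol_comp f g : bihol f -> bihol g -> bihol (fun z => f (g z)).
Proof.
move=> [sf [f' [sf' f'K fK]]] [sg [g' [sg' g'K gK]]]; split; first exact: selfmap_comp.
exists (fun z => g' (f' z)); split; first exact: selfmap_comp.
  by move=> z Dz; rewrite f'K ?g'K //; exact: sg.2.
by move=> z Dz; rewrite gK ?fK //; exact: sf'.2.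
Qed.

Lemma bihol_mb a : nc a < 1 -> bihol (mb a).
Proof.
move=> a1; split; first exact: selfmap_mb.
exists (mb (- a)); split; first by apply: selfmap_mb; rewrite ncN.
  by move=> z; rewrite udiscE; exact: mbK.
by move=> z; rewrite udiscE; exact: mbNK.
Qed.

Lemma bihol_id : bihol id.
Proof. by split; [exact: selfmap_id|exists id; split=> //; exact: selfmap_id]. Qed.

(** The increments along 1 and i are both real to first order, so [l] and [i l] are real. *)
Lemma real_valued_dv0 f z l (r : R) : 0 < r -> cdv f z l ->
  (forall w, nc (w - z) < r -> complex.Im (f w) = 0) -> l = 0.
Proof.
move=> r0 df fR.
have small e : 0 < e -> `|complex.Im l| <= e /\ `|complex.Re l| <= e.
  move=> e0; have [d d0 hd] := cdv_eps df e0.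
  pose t := Num.min d r / 2.
  have t0 : 0 < t by rewrite divr_gt0 // lt_min d0.
  have [td tr] : t < d /\ t < r.
    have : Num.min d r <= d /\ Num.min d r <= r by rewrite !ge_min !lexx orbT.
    by rewrite /t in t0 *; lra.
  have key k : nc k = t -> `|complex.Im (l * k)| <= e * t.
    move=> kt; have kE : z + k - z = k by rewrite addrAC subrr add0r.
    have := hd (z + k); rewrite kE kt => /(_ td) h.
    have := le_trans (Im_le_nc _) h; rewrite !ImD !ImN !fR ?subrr ?nc0 // ?kE ?kt //.
    by rewrite add0r normrN.
  have k1 := key t%:C%C; rewrite nc_real gtr0_norm // in k1; have {}k1 := k1 erefl.
  have k2 := key (Complex 0 t); rewrite /nc /= expr0n add0r sqrtr_sqr gtr0_norm // in k2.
  have {}k2 := k2 erefl.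
  rewrite ImM /= mulr0 add0r normrM (gtr0_norm t0) in k1.
  rewrite ImM /= mulr0 addr0 normrM (gtr0_norm t0) in k2.
  by split; rewrite -(ler_pM2r t0).
apply: eq_of_nc_small => e e0; rewrite subr0; apply: le_trans (nc_le_ReIm _) _.
by have [] := small (e / 2) ltac:(lra); lra.
Qed.

Lemma bihol_fix0_modulus f z : bihol f -> f 0 = 0 -> D z -> nc (f z) = nc z.
Proof.
move=> [sf [g [sg gK fK]]] f0 Dz.
have g0 : g 0 = 0 by rewrite -[X in g X]f0 gK //; exact: udisc0.
have z1 : nc z < 1 by rewrite -udiscE.
apply/le_anti; rewrite selfmap_schwarz //= -{1}(gK z Dz) selfmap_schwarz //.
by rewrite -udiscE; exact: sf.2.
Qed.

(* f(z)/z has modulus 1, so its real and imaginary parts are holomorphic functions of z. *)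
Lemma bihol_fix0 f : bihol f -> f 0 = 0 ->
  exists2 u, nc u = 1 & forall z, D z -> f z = u * z.
Proof.
move=> bf f0; have [[Hf fD] _] := bf.
have Dz0 := @udisc0 R.
set u := dv f 0.
have E z : D z -> f z = u * z.
  move=> Dz; have [->|z0] := eqVneq z 0; first by rewrite f0 mulr0.
  have nz : 0 < nc z by rewrite nc_gt0.
  have z1 : nc z < 1 by rewrite -udiscE.
  pose q w := f w / w.
  have oA := @annulus_open R 0 1.
  have Hq : Hol (annulus 0 1) q.
    apply: Hol_div => //; [|by apply: Hol_sub Hf => w []; rewrite udiscE|exact: Hol_id].
    by move=> w [w0 _]; rewrite -nc_gt0.
  have nq w : annulus 0 1 w -> q w * cconj (q w) = 1.
    move=> [w0 w1]; rewrite mul_cconj /q nc_div bihol_fix0_modulus ?udiscE //.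
    by rewrite divff ?gt_eqF // expr1n.
  have dq w : annulus 0 1 w -> cdv q w 0.
    move=> Aw; have [r r0 rA] := oA w Aw.
    have q0 y : annulus 0 1 y -> q y != 0.
      by move=> Ay; apply/eqP => e; move: (nq y Ay); rewrite e mul0r => /esym/eqP; rewrite oner_eq0.
    have qV y : annulus 0 1 y -> (q y)^-1 = cconj (q y).
      by move=> Ay; apply: (mulfI (q0 y Ay)); rewrite nq // divff // q0.
    have c1 := Hol_cdv Hq Aw; have c2 := cdvV c1 (q0 w Aw).
    set m := - _ * _ in c2.
    have e1 : dv q w + m = 0.
      apply: (real_valued_dv0 r0 (cdvD c1 c2)) => y yr.
      by rewrite qV; [rewrite ImD; case: (q y) => ? ? /=; rewrite subrr|exact: rA].
    have e2 : (Complex 0 1 : C) * (dv q w - m) = 0.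
      apply: (real_valued_dv0 r0 (cdvZ (Complex 0 1) (cdvB c1 c2))) => y yr.
      rewrite qV; [|exact: rA].
      by case: (q y) => p s; rewrite ImM /= mul0r addrN mulr0 addr0.
    have i0 : (Complex 0 1 : C) != 0.
      by apply/eqP => /(congr1 (@complex.Im R)) /= /eqP; rewrite oner_eq0.
    have e3 : dv q w - m = 0.
      by apply/eqP; move/eqP: e2; rewrite mulf_eq0 (negbTE i0).
    have e4 : dv q w *+ 2 = 0.
      have -> : dv q w *+ 2 = (dv q w + m) + (dv q w - m) by ring.
      by rewrite e1 e3 addr0.
    by move/eqP: e4; rewrite mulrn_eq0 /= => /eqP <-.
  have const s : 0 < s -> s <= 1 -> q z = q (s%:C%C * z).
    move=> s0 s1; apply/eqP; rewrite -subr_eq0 -nc_eq0 eq_le nc_ge0 andbT.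
    rewrite -(mul0r (nc (z - s%:C%C * z))).
    apply: (@mean_value _ q (fun=> 0)) => t t0 t1; last by rewrite nc0.
    apply: dq; have -> : seg (s%:C%C * z) z t = (s + t * (1 - s))%:C%C * z.
      by rewrite /seg rmorphD rmorphM rmorphB /=; ring.
    have p0 : 0 < s + t * (1 - s) by rewrite ltr_wpDr // mulr_ge0 // subr_ge0.
    have p1 : s + t * (1 - s) <= 1 by nra.
    rewrite /annulus /= ncM nc_real gtr0_norm //; split; first by rewrite mulr_gt0.
    by apply: le_lt_trans z1; rewrite ler_piMl // ltW.
  suff : q z = u by move=> <-; rewrite /q divfK.
  apply: eq_of_nc_small => e e0.
  have [d d0 hd] := cdv_eps (Hol_cdv Hf Dz0) e0.
  pose s := Num.min 1 (d / 2).
  have s0 : 0 < s by rewrite lt_min ltr01 divr_gt0.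
  have [s1 s2] : s <= 1 /\ s <= d / 2 by rewrite !ge_min !lexx orbT.
  have sz : nc (s%:C%C * z) = s * nc z by rewrite ncM nc_real gtr0_norm.
  have szd : s * nc z < d.
    have : s * nc z <= s by rewrite ler_piMr // ltW.
    lra.
  have sz0 : 0 < s * nc z by rewrite mulr_gt0.
  rewrite (const s s0 s1); have := hd (s%:C%C * z); rewrite subr0 f0 subr0 sz => /(_ szd) h.
  have nz0 : s%:C%C * z != 0 by rewrite -nc_gt0 sz.
  have -> : q (s%:C%C * z) - u = (f (s%:C%C * z) - u * (s%:C%C * z)) / (s%:C%C * z).
    by rewrite mulrBl mulfK.
  by rewrite nc_div sz ler_pdivrMr.
exists u => //.
pose z : C := (1 / 2)%:C%C.
have nz : nc z = 1 / 2 by rewrite nc_real ger0_norm //; lra.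
have Dz : D z by rewrite udiscE nz; lra.
have := bihol_fix0_modulus bf f0 Dz; rewrite E // ncM nz; lra.
Qed.

Lemma bihol_mob f : bihol f -> exists a u, [/\ nc a < 1, nc u = 1 &
  forall z, D z -> f z = mob a u z].
Proof.
move=> bf; have [sf [g [sg gK fK]]] := bf.
pose a := g 0; have a1 : nc a < 1 by rewrite -udiscE; apply: sg.2; exact: udisc0.
have bt : bihol (fun z => f (mb (- a) z)).
  by apply: bihol_comp => //; apply: bihol_mb; rewrite ncN.
have t0 : f (mb (- a) 0) = 0 by rewrite mb_0 opprK /a fK //; exact: udisc0.
have [u u1 uE] := bihol_fix0 bt t0.
exists a, u; split=> // z Dz; have z1 : nc z < 1 by rewrite -udiscE.
rewrite -{1}(mbK a1 z1) uE /mob /mb ?mulrA //.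
by rewrite udiscE -/(mb a z) mb_lt1.
Qed.

Lemma bihol_dist f a x : bihol f -> D a -> D x -> nc (mb (f a) (f x)) = nc (mb a x).
Proof.
move=> bf Da Dx; have a1 : nc a < 1 by rewrite -udiscE.
have x1 : nc x < 1 by rewrite -udiscE.
have fa1 : nc (f a) < 1 by rewrite -udiscE; exact: bf.1.2.
have bt : bihol (fun z => mb (f a) (f (mb (- a) z))).
  apply: (@bihol_comp (mb (f a)) (fun z => f (mb (- a) z))); first exact: bihol_mb.
  by apply: bihol_comp => //; apply: bihol_mb; rewrite ncN.
have t0 : mb (f a) (f (mb (- a) 0)) = 0 by rewrite mb_0 opprK mb_self.
have Dm : D (mb a x) by rewrite udiscE mb_lt1.
by have := bihol_fix0_modulus bt t0 Dm; rewrite mbK.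
Qed.

Lemma bihol_fix_dv1 f z0 : bihol f -> D z0 -> f z0 = z0 -> dv f z0 = 1 ->
  forall z, D z -> f z = z.
Proof.
move=> bf Dz0 f0 d1 z Dz; have a1 : nc z0 < 1 by rewrite -udiscE.
have z1 : nc z < 1 by rewrite -udiscE.
have aN1 : nc (- z0) < 1 by rewrite ncN.
have bt : bihol (fun z => mb z0 (f (mb (- z0) z))).
  apply: (@bihol_comp (mb z0) (fun z => f (mb (- z0) z))); first exact: bihol_mb.
  by apply: bihol_comp => //; apply: bihol_mb.
have m0 : mb (- z0) 0 = z0 by rewrite mb_0 opprK.
have t0 : mb z0 (f (mb (- z0) 0)) = 0 by rewrite m0 f0 mb_self.
have [u u1 uE] := bihol_fix0 bt t0.
have Du0 := @udisc0 R.
have du : dv (fun z => mb z0 (f (mb (- z0) z))) 0 = u.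
  apply: dvE; apply: (@cdv_near _ (fun z => u * z) _ _ _ 1) => //; last exact: cdv_mulc.
  by move=> w wd; rewrite uE.
have z00 : nc (0 : C) < 1 by rewrite nc0.
have c1 := Hol_cdv (Hol_mb aN1) Du0.
have c2 : cdv f (mb (- z0) 0) 1 by rewrite m0 -d1; exact: (Hol_cdv bf.1.1 Dz0).
have c3 : cdv (mb z0) (f (mb (- z0) 0)) (dv (mb z0) z0).
  by rewrite m0 f0; exact: (Hol_cdv (Hol_mb a1) Dz0).
have := dvE (cdv_comp (cdv_comp c1 c2) c3); rewrite du dv_mb0 // dv_mb_self // cconjN mulrNN mul1r.
rewrite mulVf ?one_sub_aa // => u1E.
have Dm : D (mb z0 z) by rewrite udiscE mb_lt1.
have := uE _ Dm; rewrite mbK // u1E mul1r => e.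
have fz1 : nc (f z) < 1 by rewrite -udiscE; exact: bf.1.2.
by rewrite -(mbK a1 fz1) e mbK.
Qed.

Lemma selfmap_compact f (rho : R) : rho < 1 -> selfmap f ->
  exists2 r : R, 0 <= r /\ r < 1 & forall z, nc z <= rho -> nc (f z) <= r.
Proof.
move=> rho1 [Hf fD]; have [rho0|rho0] := ltP rho 0.
  by exists 0 => // z; have := nc_ge0 z; lra.
have [z0 z0r zmax] := @extreme_value _ [set z | nc z <= rho] (fun z => nc (f z)) rho
  ltac:(by exists 0; rewrite /= nc0) ltac:(by [])
  ltac:(by move=> z h; apply: (nc_closed_le _ h))
  ltac:(by move=> z /= h; apply: ccont_nc; apply: (Hol_cont Hf); rewrite udiscE; lra).
exists (nc (f z0)) => [|z /zmax //]; split; first exact: nc_ge0.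
by rewrite -udiscE; apply: fD; rewrite udiscE; exact: le_lt_trans z0r rho1.
Qed.

End Biholomorphic.

(** * Lifting at arbitrary base points and deck transformations *)

Section Deck.
Variable R : realType.
Local Notation C := (R[i]).
Implicit Types (a b c l t x y z w u : C) (f g h G gam : C -> C).
Local Notation D := (@udisc R).
Local Notation Lat := (@inLat R).
Variables (F : C -> C) (w0 : C).
Hypothesis notLat_w0 : ~ Lat w0.
Hypothesis univF : universal_at F w0.

Let oD := @udisc_open R.
Let Dz0 := @udisc0 R.

Lemma evF : even_over Lat F D. Proof. by case: univF. Qed.
Lemma HolF : Hol D F. Proof. by case: evF. Qed.

Lemma even_over_selfmap G f : even_over Lat G D -> selfmap f -> even_over Lat (fun z => G (f z)) D.
Proof. by move=> eG [Hf fD]; exact: (even_over_comp oD oD Hf fD). Qed.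

Lemma even_over_trans G t : Lat t -> even_over Lat G D -> even_over Lat (fun z => G z + t) D.
Proof.
move=> Lt [HG ev]; split; first by apply: HolD => //; exact: Hol_cst.
move=> l z Ll Dz; apply: (lsq_near ltr01 _ (ev _ z (inLatB Ll Lt) Dz)) => w _; ring.
Qed.

(** Universality is known at the value [w0] only, so [F] is compared with a map [Fw] universal at
    [F z0]. Each lifts through the other, by [phi] and [psi]; the composite [Xi] fixes 0 and is the
    identity by rigidity. Hence [psi 0 = z0], and lifts through [Fw] become lifts through [F] based
    at [z0]. *)
Lemma lift_at G z0 : D z0 -> ~ Lat (F z0) -> even_over Lat G D -> G 0 = F z0 ->
  exists2 phi, selfmap phi & phi 0 = z0 /\ forall z, D z -> G z = F (phi z).
Proof.
move=> Dz nL eG G0; have z1 : nc z0 < 1 by rewrite -udiscE.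
have zN1 : nc (- z0) < 1 by rewrite ncN.
have [_ F0 dF0 liftF] := univF.
have [Fw [evFw Fw0 _ liftw]] := universal_exists nL.
have m0 : mb (- z0) 0 = z0 by rewrite mb_0 opprK.
have [phi [sphi phi0 phiE]] := liftw _ (even_over_selfmap evF (selfmap_mb zN1))
  ltac:(by rewrite /= m0).
pose y := phi (mb z0 0).
have Dy : D y by apply: sphi.2; rewrite udiscE mb_lt1 // nc0.
have y1 : nc y < 1 by rewrite -udiscE.
have yN1 : nc (- y) < 1 by rewrite ncN.
have Fy : Fw y = w0.
  by rewrite /y -phiE; [rewrite mbK ?nc0|rewrite udiscE mb_lt1 // nc0].
have my0 : mb (- y) 0 = y by rewrite mb_0 opprK.
have [chi [schi chi0 chiE]] := liftF _ (even_over_selfmap evFw (selfmap_mb yN1))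
  ltac:(by rewrite /= my0).
pose psi z := chi (mb y z).
have spsi : selfmap psi by apply: selfmap_comp => //; exact: selfmap_mb.
have FwE z : D z -> Fw z = F (psi z).
  move=> Dz'; have z1' : nc z < 1 by rewrite -udiscE.
  by rewrite /psi -chiE ?mbK // udiscE mb_lt1.
pose Xi z := psi (phi (mb z0 z)).
have sXi : selfmap Xi.
  by apply: (selfmap_comp spsi); apply: (selfmap_comp sphi); exact: selfmap_mb.
have Xi0 : Xi 0 = 0 by rewrite /Xi -/y /psi mb_self chi0.
have XiE z : D z -> Xi z = z.
  apply: (rigid_lift HolF oD (@udisc_convex R) sXi.1 (Hol_id oD) sXi.2 Dz0) => //.
    by rewrite Xi0.
  move=> w Dw; have w1 : nc w < 1 by rewrite -udiscE.
  have Dm : D (mb z0 w) by rewrite udiscE mb_lt1.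
  rewrite /Xi -FwE; last exact: sphi.2.
  by rewrite -phiE // mbK.
have psi0 : psi 0 = z0.
  by rewrite -{1}phi0 -[in psi (phi 0)](mb_self z0) -/(Xi z0) XiE.
have [phi1 [sphi1 phi10 phi1E]] := liftw _ eG G0.
exists (fun z => psi (phi1 z)); first exact: selfmap_comp.
split; first by rewrite phi10.
by move=> z Dz'; rewrite phi1E // FwE //; exact: sphi1.2.
Qed.

Lemma lift_pointed G a z0 : D a -> D z0 -> ~ Lat (F z0) -> even_over Lat G D -> G a = F z0 ->
  exists2 phi, selfmap phi & phi a = z0 /\ forall z, D z -> G z = F (phi z).
Proof.
move=> Da Dz nL eG Ga; have a1 : nc a < 1 by rewrite -udiscE.
have aN1 : nc (- a) < 1 by rewrite ncN.
have [phi sphi [phi0 phiE]] := lift_at Dz nL (even_over_selfmap eG (selfmap_mb aN1))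
  ltac:(by rewrite /= mb_0 opprK).
exists (fun z => phi (mb a z)); first by apply: selfmap_comp => //; exact: selfmap_mb.
split; first by rewrite mb_self.
move=> z Dz'; have z1 : nc z < 1 by rewrite -udiscE.
by rewrite -phiE ?mbK // udiscE mb_lt1.
Qed.

(** A small affine disc around [F z] avoids the lattice and lifts through [F]; the chain rule gives
    the claim. *)
Lemma F_regular z : D z -> ~ Lat (F z) -> dv F z != 0.
Proof.
move=> Dz nL; have [d [d0 d4] iso] := lattice_isolated (F z).
pose G w := F z + d%:C%C * w.
have HG : Hol D G.
  by apply: HolD => //; [exact: Hol_cst|apply: HolZ => //; exact: Hol_id].
have eG : even_over Lat G D.
  split=> // l w Ll Dw; apply: (lsq_nz oD _ Dw); first exact: HolBc.
  have ne : l != F z by apply: contra_notN nL => /eqP <-.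
  have := iso l Ll ne; rewrite subr_eq0 => h; apply: contraTneq h => <-.
  rewrite /G [F z + _]addrC addrK ncM nc_real gtr0_norm // -ltNge.
  by rewrite -ltr_pdivlMl // mulVf ?gt_eqF // -udiscE.
have [phi sphi [phi0 phiE]] := lift_at Dz nL eG ltac:(by rewrite /G mulr0 addr0).
have c1 : cdv G 0 (0 + d%:C%C) by apply: cdvD; [exact: cdv_cst|exact: cdv_mulc].
have c2 : cdv (fun w => F (phi w)) 0 (dv F z * dv phi 0).
  apply: cdv_comp; first exact: (Hol_cdv sphi.1 Dz0).
  by rewrite phi0; exact: (Hol_cdv HolF).
have E : d%:C%C = dv F z * dv phi 0.
  rewrite -[LHS]add0r; apply: (cdv_uniq c1); apply: (cdv_near ltr01 _ c2) => w wd.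
  by rewrite -phiE.
apply/eqP => e; move: E; rewrite e mul0r => /eqP.
by rewrite -nc_eq0 nc_real normr_eq0 gt_eqF.
Qed.

Lemma F_not_locally_constant z (d : R) c : D z -> 0 < d -> ~ (forall w, disc z d w -> F w = c).
Proof.
move=> Dz d0 Fc; have [_ _ dF0 _] := univF.
have Fc' w : D w -> F w - c = 0.
  apply: (@identity_convex _ D (fun w => F w - c) z d) => //; [exact: udisc_convex| |].
    by apply: HolBc => //; exact: HolF.
  by move=> y /Fc ->; rewrite subrr.
move/eqP: dF0; apply; apply: dvE.
apply: (cdv_near ltr01 _ (cdv_cst c 0)) => w wd.
by apply/esym/eqP; rewrite -subr_eq0; apply/eqP; exact: Fc'.
Qed.

Lemma near_lattice_eq l m : Lat l -> Lat m -> nc (l - m) < 1 -> l = m.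
Proof.
move=> Ll Lm h; apply/eqP; rewrite -subr_eq0; apply: contraTT h => ne.
by rewrite -leNgt; apply: lattice_norm_ge1 => //; exact: inLatB.
Qed.

Lemma generic_near z (e : R) : D z -> 0 < e ->
  exists2 z', D z' & nc (z' - z) < e /\ ~ Lat (F z').
Proof.
move=> Dz e0; have [Lz|nL] := pselect (Lat (F z)); last first.
  by exists z => //; rewrite subrr nc0.
have [d d0 hd] := Hol_cont HolF Dz (e := 1) ltr01; have [r r0 rD] := oD Dz.
apply: contrapT => none.
apply: (@F_not_locally_constant z (Num.min e (Num.min d r)) (F z) Dz).
  by rewrite !lt_min e0 d0.
move=> w; rewrite /disc /= !lt_min => /and3P[w1 w2 w3].
apply: near_lattice_eq => //; last exact: hd.
by apply: contrapT => nLw; apply: none; exists w => //; exact: rD.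
Qed.

(** The local model of two-sheeted branching over [l]; as k < 1 it reaches no other lattice
    point. *)
Lemma branched_even (k : R) l : 0 < k -> k < 1 -> Lat l ->
  even_over Lat (fun w => l + (k%:C%C * w) * w) D.
Proof.
move=> k0 k1 Ll; have H1 : Hol D (fun w => k%:C%C * w * w).
  by apply: HolM => //; [apply: HolZ => //|]; exact: Hol_id.
have HG : Hol D (fun w => l + (k%:C%C * w) * w) by apply: HolD => //; exact: Hol_cst.
split=> // m w Lm Dw; have w1 : nc w < 1 by rewrite -udiscE.
have [->|ne] := eqVneq m l.
  apply: (lsq_near ltr01 _ (lsqM (lsq_cst k%:C%C w) (lsq_sqr oD (Hol_id oD) Dw))) => y _ /=.
  by ring.
apply: (lsq_nz oD _ Dw); first exact: HolBc.
apply: contraNneq ne => e; apply/eqP; apply: near_lattice_eq => //.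
have -> : m - l = k%:C%C * w * w by rewrite -[LHS]addr0 -e; ring.
rewrite !ncM nc_real gtr0_norm //; have := nc_ge0 w; nra.
Qed.

(** The root [h] of F - l near [z] is a local coordinate: w -> l + w^2 / 4 lifts through [F] to
    [phi], and [phi \o (2 h)] is the identity near [z] by rigidity, so h'(z) is not 0. Then F' = 2 h
    h' vanishes at [z] and F''(z) = 2 h'(z)^2. *)
Lemma F_critical z : D z -> Lat (F z) -> dv F z = 0 /\ dv (dv F) z != 0.
Proof.
move=> Dz Lz; set l := F z.
have [r r0 [h Hh hE]] := evF.2 l z Lz Dz.
have zr := disc_center z r0.
have h0 : h z = 0 by apply/eqP; rewrite -sqrf_eq0 hE // subrr.
have [d d0 hd] := Hol_cont Hh zr (e := 1 / 2) ltac:(lra); have [s s0 sD] := oD Dz.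
pose V := disc z (Num.min r (Num.min d s)).
have v0 : 0 < Num.min r (Num.min d s) by rewrite !lt_min r0 d0.
have oV : copen V by exact: disc_open.
have cV : cconvex V by exact: disc_convex.
have Vz : V z by exact: disc_center.
have VV w : V w -> [/\ disc z r w, nc (h w) < 1 / 2 & D w].
  rewrite /V /disc /= !lt_min => /and3P[w1 w2 w3]; split=> //; last exact: sD.
  by have := hd w w2; rewrite h0 subr0.
have FE w : V w -> F w = l + h w ^+ 2.
  by move=> /VV[wr _ _]; rewrite hE // addrC subrK.
have HhV : Hol V h by apply: Hol_sub Hh => w /VV[].
(* Lifts are started and compared where [F] is outside the lattice. This excludes [z] itself, hence
   the auxiliary point [z'] near it. *)
have [z' Vz' hz'] : exists2 z', V z' & h z' != 0.
  apply: contrapT => none; apply: (@F_not_locally_constant z _ l Dz v0) => w Vw.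
  rewrite FE //; have [->|ne] := eqVneq (h w) 0; first by rewrite expr0n addr0.
  by exfalso; apply: none; exists w.
have [z'r hz'2 Dz'] := VV z' Vz'.
have nLz' : ~ Lat (F z').
  move=> Lz'; have : F z' = l.
    apply: near_lattice_eq => //; rewrite FE // addrC addKr ncX.
    by have := nc_ge0 (h z'); nra.
  rewrite FE // => /eqP; rewrite -subr_eq0 addrAC subrr add0r sqrf_eq0.
  by rewrite (negbTE hz').
have q0 : 0 < (1 / 4 : R) by lra.
have q1 : (1 / 4 : R) < 1 by lra.
pose k w := 2 * h w.
have Hk : Hol V k by exact: HolZ.
have kD w : V w -> D (k w).
  by move=> /VV[_ hw _]; rewrite udiscE /k ncM nc_nat; lra.
have Gk w : V w -> l + (1 / 4)%:C%C * k w * k w = F w.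
  move=> Vw; rewrite FE // /k.
  have -> : (1 / 4)%:C%C * (2 * h w) * (2 * h w) = ((1 / 4)%:C%C * 4) * h w ^+ 2 by ring.
  have -> : (1 / 4)%:C%C * 4 = 1 :> C; last by rewrite mul1r.
  have -> : (4 : C) = (4 : R)%:C%C by rewrite rmorph_nat.
  by rewrite -(rmorphM (real_complex R)) divfK // pnatr_eq0.
have [phi sphi [phiz' phiE]] := lift_pointed (kD _ Vz') Dz' nLz' (branched_even q0 q1 Lz)
  ltac:(by rewrite /= Gk).
have HpkV : Hol V (fun w => phi (k w)) by exact: (Hol_comp oV oD kD Hk sphi.1).
have pk w : V w -> phi (k w) = w.
  apply: (rigid_lift HolF oV cV HpkV (Hol_id oV) _ Vz') => //.
  - by move=> y Vy; apply: sphi.2; exact: kD.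
  - by rewrite phiz'; exact: F_regular.
  - by move=> y Vy; rewrite -phiE ?Gk //; exact: kD.
have dh0 : dv h z != 0.
  have ck : cdv k z (2 * dv h z) by apply: cdvZ; exact: (Hol_cdv HhV Vz).
  have cp := Hol_cdv sphi.1 (kD _ Vz).
  have c1 : cdv (fun w => phi (k w)) z 1.
    by apply: (cdv_near v0 _ (cdv_id z)) => w Vw; rewrite pk.
  have := cdv_uniq (cdv_comp ck cp) c1; apply: contra_eqN => /eqP ->.
  by rewrite mulr0 mulr0 eq_sym oner_eq0.
have dFE w : V w -> cdv F w (2 * (h w * dv h w)).
  move=> Vw; have ch := Hol_cdv HhV Vw.
  have := cdvD (cdv_cst l w) (cdvM ch ch).
  have -> : 0 + (dv h w * h w + h w * dv h w) = 2 * (h w * dv h w) by ring.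
  have [s' s'0 s'V] := oV _ Vw.
  by apply: (cdv_near s'0) => y /s'V Vy; rewrite FE.
split; first by rewrite (dvE (dFE z Vz)) h0 mul0r mulr0.
have cc : cdv (fun w => 2 * (h w * dv h w)) z (2 * (dv h z * dv h z + h z * dv (dv h) z)).
  apply: cdvZ; apply: cdvM; first exact: (Hol_cdv HhV Vz).
  exact: (Hol_cdv (Hol_dv HhV) Vz).
have -> : dv (dv F) z = 2 * (dv h z * dv h z + h z * dv (dv h) z).
  by apply: dvE; apply: (cdv_near v0 _ cc) => w Vw; rewrite (dvE (dFE w Vw)).
by rewrite h0 mul0r addr0 !mulf_neq0 // pnatr_eq0.
Qed.

Definition deck t gam := [/\ bihol gam, Lat t & forall z, D z -> F (gam z) = F z + t].

Lemma deck_comp s t f g : deck s f -> deck t g -> deck (s + t) (fun z => f (g z)).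
Proof.
move=> [bf Ls fE] [bg Lt gE]; split; [exact: bihol_comp|exact: inLatD|].
by move=> z Dz; rewrite fE ?gE //; [rewrite -addrA [t + s]addrC|exact: bg.1.2].
Qed.

Lemma deck_inv t f : deck t f -> exists g, [/\ deck (- t) g,
  forall z, D z -> g (f z) = z & forall z, D z -> f (g z) = z].
Proof.
move=> [[sf [g [sg gK fK]]] Lt fE]; exists g; split=> //; split.
- by split=> //; exists f.
- exact: inLatN.
- by move=> z Dz; rewrite -{2}(fK z Dz) fE ?addrK //; exact: sg.2.
Qed.

(** [F + t] and [F - t] lift through [F] with base points exchanged; by rigidity the two lifts are
    inverse to each other. *)
Lemma deck_exists t z x : D z -> D x -> Lat t -> ~ Lat (F z) -> F x = F z + t ->
  exists2 gam, deck t gam & gam z = x.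
Proof.
move=> Dz Dx Lt nLz Fx.
have nLx : ~ Lat (F x).
  by rewrite Fx => /inLatB/(_ Lt); rewrite addrK.
have [f sf [fz fE]] := lift_pointed Dz Dx nLx (even_over_trans Lt evF) (esym Fx).
have [g sg [gx gE]] := lift_pointed Dx Dz nLz (even_over_trans (inLatN Lt) evF)
  ltac:(by rewrite /= Fx addrK).
have gf y : D y -> g (f y) = y.
  have sgf := selfmap_comp sg sf.
  apply: (rigid_lift HolF oD (@udisc_convex R) sgf.1 (Hol_id oD) sgf.2 Dz).
  - by rewrite fz gx.
  - by rewrite fz gx; exact: F_regular.
  - by move=> w Dw; rewrite -gE ?fE; [rewrite -fE // addrK| exact: sf.2].
have fg y : D y -> f (g y) = y.
  have sfg := selfmap_comp sf sg.
  apply: (rigid_lift HolF oD (@udisc_convex R) sfg.1 (Hol_id oD) sfg.2 Dx).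
  - by rewrite gx fz.
  - by rewrite gx fz; exact: F_regular.
  - by move=> w Dw; rewrite -fE; [rewrite -gE // addrNK|exact: sg.2].
exists f => //; split=> //; last by move=> w Dw; rewrite -fE.
by split=> //; exists g.
Qed.

Lemma deck_unique s f g z : deck s f -> deck s g -> D z -> ~ Lat (F z) -> f z = g z ->
  forall w, D w -> f w = g w.
Proof.
move=> [bf Ls fE] [bg _ gE] Dz nL fg.
apply: (rigid_lift HolF oD (@udisc_convex R) bf.1.1 bg.1.1 bf.1.2 Dz) => //.
- apply: F_regular; first exact: bf.1.2.
  by rewrite fE // => /inLatB/(_ Ls); rewrite addrK.
- by move=> w Dw; rewrite fE ?gE.
Qed.

Hypothesis nc_w0 : nc w0 <= 3 / 4.

(** The model w -> 7/8 w^2 lifts through [F]. Since 7/8 (19/20)^2 > 3/4, the compact disc of radius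
    19/20 already covers |w| <= 3/4, and its lift stays in a compact disc. As 3/4 exceeds the
    covering radius, this is the starting point for cocompactness. *)
Lemma small_values : exists2 r : R, 0 <= r /\ r < 1 &
  forall w, nc w <= 3 / 4 -> exists2 x, nc x <= r & F x = w.
Proof.
have k0 : 0 < (7 / 8 : R) by lra.
have k1 : (7 / 8 : R) < 1 by lra.
pose k : C := (7 / 8)%:C%C.
have nk : nc k = 7 / 8 by rewrite nc_real gtr0_norm.
have kn : k != 0 by rewrite -nc_gt0 nk.
pose s w := sqrtc (w / k).
have sE w : k * s w * s w = w.
  by rewrite -mulrA -expr2 sqr_sqrtc mulrC divfK.
have ns w : nc w <= 3 / 4 -> nc (s w) <= 19 / 20.
  move=> w34; rewrite leNgt; apply/negP => h.
  have : nc (k * s w * s w) <= 3 / 4 by rewrite sE.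
  rewrite !ncM nk; nra.
have [_ F0 _ _] := univF.
have Ds : D (s w0) by rewrite udiscE; have := ns _ nc_w0; lra.
have [phi sphi [phi0 phiE]] := lift_pointed Ds Dz0 ltac:(by rewrite F0)
  (branched_even k0 k1 (@inLat0 R)) ltac:(by rewrite /= add0r sE F0).
have [r r01 br] := @selfmap_compact _ phi (19 / 20) ltac:(lra) sphi.
exists r => // w w34; exists (phi (s w)); first by apply: br; exact: ns.
rewrite -phiE ?add0r ?sE // udiscE; have := ns w w34; lra.
Qed.

End Deck.

(** * Cocompactness, and the contraction caused by division *)

Section Contraction.
Variable R : realType.
Local Notation C := (R[i]).
Implicit Types (a b c l t x y z w u : C) (f g h G gam : C -> C).
Local Notation D := (@udisc R).
Local Notation Lat := (@inLat R).

(** This base value stays within 3/4 of 0 after translation by -1 or by -i, so [deck_small] yields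
    deck transformations over generators of the lattice. *)
Definition cell_center : C := Complex (1 / 2) (1 / 2).

Lemma nc_cell_center : nc cell_center <= 3 / 4.
Proof.
have p0 : 0 <= 3 / 4 :> R by lra.
by rewrite -(@ler_pXn2r _ 2) ?nnegrE ?nc_ge0 // nc_sqr /=; lra.
Qed.

Lemma cell_center_neq0 : cell_center != 0.
Proof.
by apply/eqP => /(congr1 (@complex.Re R)) /= /eqP; rewrite gt_eqF //; lra.
Qed.

Lemma small_notLat l : l != 0 -> nc l <= 3 / 4 -> ~ Lat l.
Proof. by move=> l0 ls Ll; have := lattice_norm_ge1 Ll l0; lra. Qed.

Lemma cell_center_notLat : ~ Lat cell_center.
Proof. by apply: small_notLat; [exact: cell_center_neq0|exact: nc_cell_center]. Qed.

Variable F : C -> C.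
Hypothesis univF : universal_at F cell_center.

Let oD := @udisc_open R.
Let Dz0 := @udisc0 R.
Let HF := HolF univF.

Lemma F0 : F 0 = cell_center. Proof. by case: univF. Qed.

Lemma deck_small t : Lat t -> nc (cell_center + t) <= 3 / 4 -> exists gam, deck F t gam.
Proof.
move=> Lt ct; have [r [r0 r1] sv] := small_values cell_center_notLat univF nc_cell_center.
have [x xr Fx] := sv _ ct.
have Dx : D x by rewrite udiscE; lra.
have [||gam dg _] := @deck_exists _ F cell_center univF t 0 x Dz0 Dx Lt.
- by rewrite F0; exact: cell_center_notLat.
- by rewrite F0.
by exists gam.
Qed.

Lemma deck_id : deck F 0 id.
Proof. by split=> [||z _]; [exact: bihol_id|exact: inLat0|rewrite addr0]. Qed.

Lemma deck_mulz t gam (a : int) : deck F t gam -> exists gam', deck F (t *~ a) gam'.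
Proof.
move=> dg.
have pos n : exists gam', deck F (t *+ n) gam'.
  elim: n => [|n [g dg']]; first by exists id; exact: deck_id.
  by exists (fun z => gam (g z)); rewrite mulrS; exact: deck_comp.
case: a => n; first exact: pos.
have [g dg'] := pos n.+1; have [g' [dg'' _ _]] := deck_inv dg'.
by exists g'; rewrite NegzE mulrNz.
Qed.

Lemma deck_lattice t : Lat t -> exists gam, deck F t gam.
Proof.
move=> [a [b ->]].
have unit_deck (v : C) : Lat (- v) -> nc (cell_center - v) <= 3 / 4 -> exists gam, deck F v gam.
  move=> Lv cv; have [g dg] := deck_small Lv cv; have [g' [dg' _ _]] := deck_inv dg.
  by exists g'; rewrite -(opprK v).
have half v : complex.Re v ^+ 2 <= 1 / 4 -> complex.Im v ^+ 2 <= 1 / 4 -> nc v <= 3 / 4.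
  move=> h1 h2; have p0 : 0 <= 3 / 4 :> R by lra.
  by rewrite -(@ler_pXn2r _ 2) ?nnegrE ?nc_ge0 // nc_sqr; lra.
have [g1 d1] : exists gam, deck F 1 gam.
  apply: unit_deck; first by exists (-1), 0; rewrite rmorphN /= /GRing.opp /= oppr0.
  by apply: half => /=; lra.
have [g2 d2] : exists gam, deck F (Complex 0 1) gam.
  apply: unit_deck; first by exists 0, (-1); rewrite rmorphN /= /GRing.opp /= oppr0.
  by apply: half => /=; lra.
have [g3 d3] := deck_mulz a d1; have [g4 d4] := deck_mulz b d2.
exists (fun z => g3 (g4 z)).
suff -> : Complex a%:~R b%:~R = 1 *~ a + (Complex 0 1 : C) *~ b by exact: deck_comp.
rewrite -[Complex 0 1 *~ b]mulrzr.
have e (k : int) : (k%:~R : C) = (k%:~R : R)%:C%C by rewrite rmorph_int.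
by rewrite !e; apply/eqP; rewrite eq_complex /= !mul0r !mul1r ?subr0 ?addr0 ?add0r !eqxx.
Qed.

Lemma finite_bound (f : nat -> R) N : (forall i, f i < 1) ->
  exists2 r : R, 0 <= r /\ r < 1 & forall i, (i < N)%N -> f i <= r.
Proof.
move=> f1; elim: N => [|N [r [r0 r1] hr]]; first by exists 0.
exists (Num.max r (f N)).
  by split; [rewrite le_max r0|rewrite gt_max r1 f1].
move=> i; rewrite ltnS leq_eqVlt => /orP[/eqP ->|/hr]; first by rewrite le_max lexx orbT.
by rewrite le_max => ->.
Qed.

Definition multLat (N : nat) t := exists2 s, Lat s & t = N%:R * s.

Lemma multLatB N s t : multLat N s -> multLat N t -> multLat N (s - t).
Proof. by move=> [s' Ls ->] [t' Lt ->]; exists (s' - t'); rewrite ?mulrBr //; exact: inLatB. Qed.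

Lemma multLat0 N : multLat N 0.
Proof. by exists 0; rewrite ?mulr0 //; exact: inLat0. Qed.

Lemma multLatN N t : multLat N t -> multLat N (- t).
Proof. by rewrite -sub0r; apply: multLatB; exact: multLat0. Qed.

Lemma multLatD N s t : multLat N s -> multLat N t -> multLat N (s + t).
Proof. by move=> hs /multLatN ht; rewrite -(opprK t); exact: multLatB. Qed.

Lemma multLat_Lat N t : multLat N t -> Lat t.
Proof.
move=> [s [a [b ->]] ->]; exists (a *+ N), (b *+ N).
by rewrite mulr_natl !rmorphMn /=; elim: N => //= N IH; rewrite !mulrS IH.
Qed.

Lemma lattice_residue N t : (0 < N)%N -> Lat t ->
  exists i j : nat, [/\ (i < N)%N, (j < N)%N & multLat N (t - Complex i%:R j%:R)].
Proof.
move=> N0 [a [b ->]].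
have nz : (N : int) != 0 by rewrite eqz_nat -lt0n.
have res (k : int) : exists2 i : nat, (i < N)%N & (k %% N)%Z = i.
  exists `|(k %% N)%Z|%N; last by rewrite gez0_abs // modz_ge0.
  by rewrite -ltz_nat gez0_abs ?modz_ge0 // ltz_pmod.
have [i iN ei] := res a; have [j jN ej] := res b.
exists i, j; split=> //; exists (Complex (a %/ N)%Z%:~R (b %/ N)%Z%:~R).
  by exists (a %/ N)%Z, (b %/ N)%Z.
have div (k : int) (m : nat) : (k %% N)%Z = m -> (k%:~R : R) - m%:R = N%:R * ((k %/ N)%Z)%:~R.
  move=> em; rewrite {1}(divz_eq k N) em rmorphD rmorphM /=.
  by rewrite addrK mulrC.
have -> : (N%:R : C) = (N%:R : R)%:C%C by rewrite rmorph_nat.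
by apply/eqP; rewrite eq_complex /= !mul0r subr0 addr0 !div // !eqxx.
Qed.

(** In [one_sub_mb], 1 - |w|^2 is at least 3/4 and the denominator at most 4, whence 3/16. *)
Lemma mb_le x w (r s : R) : nc x <= r -> r < 1 -> nc w <= 1 / 2 ->
  s = Num.sqrt (1 - (1 - r ^+ 2) * (3 / 16)) -> nc (mb x w) <= s.
Proof.
move=> xr r1 w2 ->; have x0 := nc_ge0 x; have r0 : 0 <= r by lra.
have q : r ^+ 2 < 1 by nra.
have x1 : nc x < 1 by lra.
have w1 : nc w < 1 by lra.
rewrite -(@ler_pXn2r _ 2) ?nnegrE ?nc_ge0 ?sqrtr_ge0 // sqr_sqrtr; last by nra.
rewrite lerBrDr -lerBrDl one_sub_mb // ler_pdivlMr; last first.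
  by rewrite exprn_gt0 // nc_gt0 mb_den.
have d2 : nc (1 - cconj x * w) ^+ 2 <= 4.
  have : nc (1 - cconj x * w) <= 2.
    apply: le_trans (ncB _ _) _; rewrite nc1 ncM nc_conj.
    have := nc_ge0 w; nra.
  by have := nc_ge0 (1 - cconj x * w); nra.
have a1 : 1 - r ^+ 2 <= 1 - nc x ^+ 2 by rewrite lerD2l lerN2 ler_pXn2r ?nnegrE.
have a2 : 3 / 4 <= 1 - nc w ^+ 2 by have := nc_ge0 w; nra.
have a3 : 0 <= nc (1 - cconj x * w) ^+ 2 by rewrite sqr_ge0.
have a4 : (1 - r ^+ 2) * (3 / 4) <= (1 - nc x ^+ 2) * (1 - nc w ^+ 2).
  by apply: ler_pM => //; lra.
have a5 : (1 - r ^+ 2) * (3 / 16) * nc (1 - cconj x * w) ^+ 2 <= (1 - r ^+ 2) * (3 / 16) * 4.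
  by apply: ler_wpM2l => //; nra.
lra.
Qed.

(** After subtraction of the nearest lattice point, [F] takes a value covered by [small_values].
    Reducing that lattice point modulo [N] leaves finitely many translates of one compact disc, and
    a translation in N L for the deck transformation sought. *)
Lemma cocompact N : (0 < N)%N -> exists2 r : R, 0 <= r /\ r < 1 &
  forall z, D z -> exists gam t, [/\ deck F t gam, multLat N t & nc (gam z) <= r].
Proof.
move=> N0; have [r0 [r00 r01] sv] := small_values cell_center_notLat univF nc_cell_center.
have ex (p : nat * nat) : exists cr : (C -> C) * R,
    [/\ deck F (Complex p.1%:R p.2%:R) cr.1, cr.2 < 1 &
        forall x, nc x <= r0 -> nc (cr.1 x) <= cr.2].
  have [gam dg] := @deck_lattice (Complex p.1%:R p.2%:R) ltac:(by exists (p.1 : int), (p.2 : int)).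
  have [bg _ _] := dg.
  have [r [_ r1] hr] := selfmap_compact r01 bg.1.
  by exists (gam, r).
have [cr crP] := choice ex.
have row (i : nat) : exists r : R, r < 1 /\ forall j, (j < N)%N -> (cr (i, j)).2 <= r.
  have [r [_ r1] hr] := @finite_bound (fun j => (cr (i, j)).2) N
    ltac:(by move=> j; have [] := crP (i, j)).
  by exists r.
have [rr rrP] := choice row.
have [r1 [r10 r11] hr1] := @finite_bound rr N (fun i => (rrP i).1).
pose r2 := Num.sqrt (1 - (1 - r1 ^+ 2) * (3 / 16)).
have q : 0 <= r1 ^+ 2 /\ r1 ^+ 2 < 1 by split; nra.
exists r2.
  split; first exact: sqrtr_ge0.
  by rewrite /r2 -[X in _ < X]sqrtr1 ltr_sqrt //; lra.
move=> z Dz; have z1 : nc z < 1 by rewrite -udiscE.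
(* [deck_exists] needs a value outside the lattice. The radius puts [z'] at pseudo-hyperbolic
   distance at most 1/2 from [z], which [mb_le] absorbs. *)
have [z' Dz' [zz' nL]] := generic_near univF Dz (e := (1 - nc z) / 2) ltac:(lra).
have z'1 : nc z' < 1 by rewrite -udiscE.
have [t Lt tn] := nearest_lattice (F z').
have [i [j [iN jN mt]]] := lattice_residue N0 Lt.
have [x' x'r Fx'] := sv _ tn.
have Dx' : D x' by rewrite udiscE; lra.
have [[bc Lc cE] c1 cb] := crP (i, j).
set c := (cr (i, j)).1 in bc cE cb.
have Dcx : D (c x') by exact: bc.1.2.
have cx : nc (c x') <= r1.
  by apply: le_trans (hr1 i iN); apply: le_trans ((rrP i).2 j jN); exact: cb.
have mt' := multLatN mt.
have Fc : F (c x') = F z' + - (t - Complex i%:R j%:R) by rewrite cE // Fx'; ring.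
have [gam dg gz'] := deck_exists univF Dz' Dcx (multLat_Lat mt') nL Fc.
exists gam, (- (t - Complex i%:R j%:R)); split=> //.
have [bg _ _] := dg.
have gz1 : nc (gam z) < 1 by rewrite -udiscE; exact: bg.1.2.
have cx1 : nc (c x') < 1 by rewrite -udiscE.
rewrite -(mbK cx1 gz1); apply: (mb_le _ r11 _ erefl); first by rewrite ncN.
rewrite -gz' bihol_dist // /mb nc_div ler_pdivrMr; last by rewrite nc_gt0 mb_den.
rewrite nc_distC; have := ncB_ge 1 (cconj z' * z); rewrite nc1 ncM nc_conj.
have := nc_ge0 z'; have := nc_ge0 z; nra.
Qed.

Definition divides_by (n : nat) f := selfmap f /\ forall z, D z -> F (f z) = F z / n%:R.

Lemma natC_neq0 n : (0 < n)%N -> (n%:R : C) != 0.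
Proof. by move=> n0; rewrite pnatr_eq0 -lt0n. Qed.

Lemma base_div_notLat n : (0 < n)%N -> ~ Lat (cell_center / n%:R).
Proof.
move=> n0; apply: small_notLat.
  by rewrite mulf_neq0 ?cell_center_neq0 // invr_neq0 // natC_neq0.
rewrite nc_div nc_nat; apply: le_trans nc_cell_center.
by rewrite ler_pdivrMr ?ltr0n // ler_peMr ?nc_ge0 // ler1n.
Qed.

Lemma division_exists n : (0 < n)%N -> exists f, divides_by n f.
Proof.
move=> n0; have nz := natC_neq0 n0.
have [r [r0 r1] sv] := small_values cell_center_notLat univF nc_cell_center.
have [x xr Fx] : exists2 x, nc x <= r & F x = cell_center / n%:R.
  apply: sv; rewrite nc_div nc_nat; apply: le_trans nc_cell_center.
  by rewrite ler_pdivrMr ?ltr0n // ler_peMr ?nc_ge0 // ler1n.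
have Dx : D x by rewrite udiscE; lra.
have eG : even_over Lat (fun z => F z / n%:R) D.
  split.
    apply: (@Hol_ext _ _ (fun z => n%:R^-1 * F z)) => // [z _|]; first by rewrite mulrC.
    exact: HolZ.
  move=> l z Ll Dz.
  have Lnl : Lat (n%:R * l) by apply: (@multLat_Lat n); exists l.
  apply: (lsq_near ltr01 _ (lsqM (lsq_cst n%:R^-1 z) ((evF univF).2 _ z Lnl Dz))) => w _.
  by field.
have [f sf [_ fE]] := lift_pointed univF Dz0 Dx
  ltac:(by rewrite Fx; exact: base_div_notLat) eG ltac:(by rewrite /= F0 Fx).
by exists f; split=> // z Dz; rewrite -fE.
Qed.

Lemma division_equivariant n f s gam : (0 < n)%N -> divides_by n f -> Lat s ->
  deck F (n%:R * s) gam ->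
  exists2 gam', deck F s gam' & forall z, D z -> f (gam z) = gam' (f z).
Proof.
move=> n0 [sf fE] Ls [bg _ gE]; have nz := natC_neq0 n0.
have Df0 : D (f 0) by exact: sf.2.
have Dfg : D (f (gam 0)) by apply: sf.2; exact: bg.1.2.
have Dg0 : D (gam 0) by exact: bg.1.2.
have nL : ~ Lat (F (f 0)) by rewrite fE // F0; exact: base_div_notLat.
have E : F (f (gam 0)) = F (f 0) + s by rewrite !fE // gE //; field.
have [gam' dg' g0] := deck_exists univF Df0 Dfg Ls nL E.
exists gam' => //; have [bg' _ g'E] := dg'.
have s1 := selfmap_comp sf bg.1; have s2 := selfmap_comp bg'.1 sf.
apply: (rigid_lift HF oD (@udisc_convex R) s1.1 s2.1 s1.2 Dz0) => //.
  apply: (F_regular univF Dfg).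
  by rewrite E => /inLatB/(_ Ls); rewrite addrK.
move=> z Dz; rewrite fE; last exact: bg.1.2.
rewrite gE // g'E; last exact: sf.2.
by rewrite fE //; field.
Qed.

Lemma F_isolated a : D a -> exists2 d : R, 0 < d & forall y, nc (y - a) < d -> F y = F a -> y = a.
Proof.
move=> Da; have [r r0 rD] := oD Da.
have [La|nL] := pselect (Lat (F a)); last first.
  have [d [d0 _] inj] := local_injective r0 (Hol_sub rD HF)
    (F_regular univF Da nL).
  by exists d => // y yd; apply: inj => //; exact: disc_center.
have [d1 d2] := F_critical univF Da La.
set k := dv (dv F) a / 2; have k0 : k != 0 by rewrite mulf_neq0 // invr_neq0 // pnatr_eq0.
have nk : 0 < nc k by rewrite nc_gt0.
have [d d0 hd] := taylor_young r0 (Hol_sub rD HF) (e := nc k / 2) ltac:(lra).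
exists d => // y yd Fy; have := hd y yd; rewrite Fy d1 mul0r addr0 -/k.
have -> : F a - (F a + k * (y - a) ^+ 2) = - (k * (y - a) ^+ 2) by ring.
rewrite ncN ncM ncX mulrAC => h.
apply/eqP; rewrite -subr_eq0 -nc_eq0 -sqrf_eq0 eq_le sqr_ge0 andbT.
by have := sqr_ge0 (nc (y - a)); nra.
Qed.

(* Along an ultrafilter, normalised counterexamples would converge to a map g with
   F o g constant, hence constant. *)
Lemma division_contracts (eta rho : R) : 0 < eta -> rho < 1 ->
  exists2 n, (1 < n)%N & forall f z ze, divides_by n f -> D z -> nc ze <= rho ->
    nc (mb (f z) (f (mb (- z) ze))) <= eta.
Proof.
move=> eta0 rho1; apply: contrapT => none.
have [r1 [r10 r11] coc] := cocompact (ltn0Sn 0).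
have ex (n : nat) : exists d : (C -> C) * C * C,
    [/\ selfmap d.1.1, d.1.1 0 = d.1.2, nc d.1.2 <= r1 &
     [/\ nc d.2 <= rho, eta < nc (mb d.1.2 (d.1.1 d.2)) &
      forall ze, D ze -> nc (F (d.1.1 ze) - F d.1.2) <= 48 / (1 - nc ze) * nc ze / n.+2%:R]].
  (* The counterexample is normalised on both sides: [mb (- z)] moves 0 to [z], and a deck
     transformation brings [f z] back to a fixed compact disc. Landau's bound then makes F o g vary
     by O(1/n). *)
  have [f [z [ze [[sf fE] [Dz [zer bad]]]]]] : exists f z ze, divides_by n.+2 f /\
      (D z /\ (nc ze <= rho /\ eta < nc (mb (f z) (f (mb (- z) ze))))).
    apply: contrapT => nex; apply: none; exists n.+2 => // f z ze df Dz zer.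
    by rewrite leNgt; apply/negP => lt; apply: nex; exists f, z, ze.
  have z1 : nc z < 1 by rewrite -udiscE.
  have zN1 : nc (- z) < 1 by rewrite ncN.
  have Dfz : D (f z) by exact: sf.2.
  have [gam [t [[bg Lt gE] _ gr]]] := coc _ Dfz.
  have m0 : mb (- z) 0 = z by rewrite mb_0 opprK.
  have smb := selfmap_mb zN1.
  have Dm y : D y -> D (mb (- z) y) by exact: smb.2.
  have Dfm y : D y -> D (f (mb (- z) y)) by move=> /Dm /sf.2.
  have Dze : D ze by rewrite udiscE; lra.
  exists ((fun y => gam (f (mb (- z) y))), gam (f z), ze); split=> /=.
  - by apply: (selfmap_comp bg.1); exact: selfmap_comp.
  - by rewrite m0.
  - exact: gr.
  split=> //; first by rewrite bihol_dist //; exact: Dfm.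
  move=> y Dy; have y1 : nc y < 1 by rewrite -udiscE.
  rewrite !gE //; last exact: Dfm.
  rewrite !fE //; last exact: Dm.
  have -> : F (mb (- z) y) / n.+2%:R + t - (F z / n.+2%:R + t) =
     (F (mb (- z) y) - F z) / n.+2%:R by ring.
  rewrite nc_div nc_nat ler_pM2r ?invr_gt0 ?ltr0n //.
  have eG := even_over_selfmap (evF univF) smb.
  by have := landau_growth y1 eG (lexx (nc y)); rewrite m0.
have [d dP] := choice ex.
pose gs n := (d n).1.1; pose as_ n := (d n).1.2; pose zs n := (d n).2.
have sgs n : selfmap (gs n) by have [] := dP n.
have gs0 n : gs n 0 = as_ n by have [] := dP n.
have asr n : nc (as_ n) <= r1 by have [] := dP n.
have bnd : locally_bounded gs D.
  move=> z Dz; have [r r0 rD] := oD Dz; exists r, 1; split=> //.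
  apply: ufnT => n; split; first exact: Hol_sub (sgs n).1.
  by move=> w /rD /(sgs n).2; rewrite udiscE => /ltW.
pose g := ulf gs; have Hg : Hol D g by exact: Hol_ulf.
have la : isul as_ (g 0).
  by apply: isul_near (ulf_isul bnd Dz0); apply: ufnT => n /=; rewrite gs0.
have ga : nc (g 0) <= r1 by apply: (isul_le la); apply: ufnT => n; exact: asr.
have Da : D (g 0) by rewrite udiscE; lra.
have cF : ccont F (g 0) by exact: (Hol_cont HF).
(* The limit [g] is known to map into the closed disc only; near 0 its values are in [D], and this
   suffices for the identity theorem. *)
have Fg z : D z -> D (g z) -> F (g z) = F (g 0).
  move=> Dz Dgz; have z1 : nc z < 1 by rewrite -udiscE.
  have l1 := isul_ccont (ulf_isul bnd Dz) (Hol_cont HF Dgz).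
  have l2 := isul_ccont la cF.
  apply/eqP; rewrite -subr_eq0; apply/eqP; apply: (isul_uniq (isulB l1 l2)).
  set K := 48 / (1 - nc z) * nc z.
  have K0 : 0 <= K by rewrite mulr_ge0 ?nc_ge0 // divr_ge0 //; lra.
  move=> e e0; have e1 : 0 < e / (K + 1) by rewrite divr_gt0 //; lra.
  apply: ufnS (inv_nat_small e1) => n /= hn; rewrite subr0.
  have [_ _ _ [_ _ hb]] := dP n; apply: le_lt_trans (hb z Dz) _; rewrite -/K.
  have hn' : n.+2%:R^-1 < e / (K + 1).
    by apply: le_lt_trans hn; rewrite lef_pV2 ?posrE ?ltr0n // ler_nat.
  have p0 : 0 < n.+2%:R^-1 :> R by rewrite invr_gt0 ltr0n.
  move: hn' p0; set q := n.+2%:R^-1; rewrite ltr_pdivlMr; last lra.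
  nra.
have gconst z : D z -> g z = g 0.
  have [d1 d10 iso] := F_isolated Da.
  have [r r0 rD] := oD Da.
  have [e e0 he] := Hol_cont Hg Dz0 (e := Num.min d1 r) ltac:(by rewrite lt_min d10).
  move=> Dz; apply/eqP; rewrite -subr_eq0; apply/eqP.
  apply: (@identity_convex _ D (fun z => g z - g 0) 0 (Num.min e 1)) => //.
  - exact: udisc_convex.
  - exact: HolBc.
  - by rewrite lt_min e0 ltr01.
  move=> w; rewrite /disc /= lt_min => /andP[w1 w2].
  have := he w w1; rewrite lt_min => /andP[v1 v2].
  by rewrite (iso (g w)) ?subrr //; apply: Fg => //; exact: rD.
have zsr n : nc (zs n) <= rho by have [_ _ _ []] := dP n.
have lz := @ulimP _ zs rho ltac:(by apply: ufnT => n; exact: zsr).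
have zr : nc (ulim zs) <= rho by apply: (isul_le lz); apply: ufnT => n; exact: zsr.
have Dzl : D (ulim zs) by rewrite udiscE; lra.
have lg := isul_ulf_comp bnd Dzl lz.
rewrite -[ulf gs]/g gconst // in lg.
have ldiff := isulB lg la; rewrite subrr in ldiff.
have e0 : 0 < eta * (1 - r1) by rewrite mulr_gt0 //; lra.
have [n /= hn] := ufn_ex (ldiff _ e0); rewrite subr0 in hn.
have [_ _ _ [_ bad _]] := dP n; rewrite -/(as_ n) -/(zs n) -[(d n).1.1]/(gs n) in bad.
have Dzn : D (zs n) by rewrite udiscE; have := zsr n; lra.
have y1 : nc (gs n (zs n)) < 1 by rewrite -udiscE; exact: (sgs n).2.
have a1 : nc (as_ n) < 1 by have := asr n; lra.
move: bad; rewrite /mb nc_div ltr_pdivlMr; last by rewrite nc_gt0 mb_den.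
have := ncB_ge 1 (cconj (as_ n) * gs n (zs n)); rewrite nc1 ncM nc_conj.
have := asr n; have := nc_ge0 (as_ n); have := nc_ge0 (gs n (zs n)).
move: hn y1; set p := nc (gs n _); set q := nc (as_ n); set m := nc (1 - _); set k := nc (_ - _).
move=> hn p1 p0 q0 qr hm bad.
have : 1 - r1 <= m by nra.
by nra.
Qed.

End Contraction.

(** * Parity of finitely supported families *)

Section Parity.

Implicit Types (s : int * int -> bool) (r : seq (int * int)).

(** A sum over an infinite index set; it is meaningful as a parity under [finsupp]. *)
Definition par s : bool := \big[addb/false]_(i \in [set: int * int]) s i.

Definition finsupp s := exists r, forall i, s i -> i \in r.

Lemma parE s r : uniq r -> (forall i, s i -> i \in r) -> par s = \big[addb/false]_(i <- r) s i.
Proof.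
move=> ur sr; rewrite /par (@fsbigE _ false addb _ _ r) //.
  by apply: eq_bigl => i; rewrite in_setT.
by move=> i _ ir; apply/negbTE; apply: contra ir; exact: sr.
Qed.

Lemma par_addb s1 s2 : finsupp s1 -> finsupp s2 ->
  par (fun i => s1 i (+) s2 i) = par s1 (+) par s2.
Proof.
move=> [r1 h1] [r2 h2]; pose r := undup (r1 ++ r2).
have ur : uniq r by exact: undup_uniq.
have k1 i : s1 i -> i \in r by move=> /h1 h; rewrite mem_undup mem_cat h.
have k2 i : s2 i -> i \in r by move=> /h2 h; rewrite mem_undup mem_cat h orbT.
rewrite !(@parE _ r) // => [|i]; first by rewrite big_split.
by case E: (s1 i) => /= h; [exact: k1|apply: k2; move: h; case: (s2 i)].
Qed.

Lemma par_shift s p : finsupp s -> par (fun i => s (i - p)) = par s.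
Proof.
move=> [r0 h0]; pose r := undup r0.
have ur : uniq r by exact: undup_uniq.
have k i : s i -> i \in r by move=> /h0; rewrite mem_undup.
rewrite (@parE s r) // (@parE _ [seq i + p | i <- r]).
- by rewrite big_map; apply: eq_bigr => i _; rewrite addrK.
- by rewrite map_inj_uniq //; exact: addIr.
- by move=> i /k h; apply/mapP; exists (i - p) => //; rewrite subrK.
Qed.

Lemma par_false s : (forall i, s i = false) -> par s = false.
Proof. by move=> h; rewrite (@parE _ [::]) ?big_nil // => i; rewrite h. Qed.

Lemma par_single s i0 : s i0 -> (forall i, i != i0 -> s i = false) -> par s = true.
Proof.
move=> h0 h; rewrite (@parE _ [:: i0]) ?big_seq1 // => i si.
by rewrite inE; apply: contraTT si => /h ->.
Qed.

Lemma finsupp_box s (K : nat) : (forall i, s i -> (`|i.1| <= K)%N /\ (`|i.2| <= K)%N) -> finsupp s.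
Proof.
move=> h; pose rg := [seq Posz k - Posz K | k <- iota 0 (2 * K).+1].
have mem (a : int) : (`|a| <= K)%N -> a \in rg.
  move=> aK; apply/mapP; exists (`|(a + Posz K)%R|%N); last first.
    by lia.
  by rewrite mem_iota add0n; lia.
exists [seq (a, b) | a <- rg, b <- rg] => -[a b] /h[ha hb].
by apply/allpairsPdep; exists a, b; split=> //; exact: mem.
Qed.

End Parity.

(** * Disc automorphisms of finite order have a fixed point *)

Section FiniteOrder.
Variable R : realType.
Local Notation C := (R[i]).
Implicit Types (a b c x y z w u xi : C) (f : C -> C).
Local Notation D := (@udisc R).

Lemma quadratic_roots a b c : a != 0 -> exists x y : C,
  [/\ a * x ^+ 2 + b * x + c = 0, a * y ^+ 2 + b * y + c = 0 & a * (x * y) = c].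
Proof.
move=> a0; pose d := sqrtc (b ^+ 2 - 4 * a * c).
have d2 : d ^+ 2 = b ^+ 2 - 4 * a * c by rewrite sqr_sqrtc.
have n2 : (2 : C) != 0 by rewrite pnatr_eq0.
have cE : c = (b ^+ 2 - d ^+ 2) / (4 * a).
  by rewrite d2; field.
exists ((- b + d) / (2 * a)), ((- b - d) / (2 * a)).
by rewrite cE; split; field.
Qed.

Lemma iter_selfmap f m z : selfmap f -> D z -> D (iter m f z).
Proof. by move=> sf Dz; elim: m => //= m; exact: sf.2. Qed.

(* In the coordinate 1/(xi - z) at a boundary fixed point xi, a disc automorphism is
   w |-> k w + c with k > 0, and such a map has finite order only if it is the identity. *)
Lemma finite_order_fixed f (m : nat) : bihol f -> (0 < m)%N ->
  (forall z, D z -> iter m f z = z) -> exists2 z, D z & f z = z.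
Proof.
move=> bf m0 fm; have [a [u [a1 u1 fE]]] := bihol_mob bf.
have [a0|a0] := eqVneq a 0.
  exists 0; first exact: udisc0.
  by rewrite fE ?udiscE ?nc0 // a0 /mob subr0 mulr0 mul0r.
have ca0 : cconj a != 0 by rewrite -nc_gt0 nc_conj nc_gt0.
have [x [y [xE yE xyE]]] := quadratic_roots (u - 1) (- (u * a)) ca0.
have nxy : nc x * nc y = 1.
  have : nc (cconj a * (x * y)) = nc (- (u * a)) by rewrite xyE.
  rewrite ncN !ncM nc_conj u1 mul1r => h; apply: (mulfI (x := nc a)).
    by rewrite nc_eq0.
  by rewrite h mulr1.
(* The product of the two fixed points has modulus 1, so one of them lies in the closed disc. *)
have [xi xiE xi1] : exists2 xi, cconj a * xi ^+ 2 + (u - 1) * xi + - (u * a) = 0 & nc xi <= 1.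
  have [x1|x1] := leP (nc x) 1; first by exists x.
  exists y => //; have := nc_ge0 y; nra.
have fixE : u * (xi - a) = xi * (1 - cconj a * xi).
  apply/eqP; rewrite -subr_eq0 -xiE; apply/eqP; ring.
have [lt1|ge1] := ltP (nc xi) 1.
  have Dxi : D xi by rewrite udiscE.
  by exists xi => //; rewrite fE // /mob fixE mulfK // mb_den.
have {ge1 xi1} nxi : nc xi = 1 by apply/le_anti; rewrite xi1.
have xi0 : xi != 0 by rewrite -nc_gt0 nxi.
pose p := 1 - cconj a * xi.
have p0 : p != 0.
  rewrite -nc_gt0; have := ncB_ge 1 (cconj a * xi).
  by rewrite nc1 ncM nc_conj nxi mulr1 -/p; lra.
have u0 : u != 0 by rewrite -nc_gt0 u1.
have e0 := one_sub_aa a1.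
have ex (z : C) : D z -> xi - z != 0.
  by rewrite udiscE => z1; rewrite subr_eq0; apply: contraTneq z1 => <-; rewrite nxi ltxx.
pose k := p ^+ 2 / (u * (1 - a * cconj a)).
pose c := cconj a * p / (u * (1 - a * cconj a)).
pose L z := (xi - z)^-1.
have LE z : D z -> L (f z) = k * L z + c.
  move=> Dz; have z1 : nc z < 1 by rewrite -udiscE.
  have dz := mb_den a1 z1; have xz := ex z Dz.
  have E : xi - f z = u * (1 - a * cconj a) * (xi - z) / (p * (1 - cconj a * z)).
    have xiE' : xi = u * (xi - a) / p by rewrite fixE mulfK.
    have key : (xi - a) * (1 - cconj a * z) - (z - a) * p = (1 - a * cconj a) * (xi - z).
      by rewrite /p; ring.
    rewrite fE // /mob {1}xiE' -[u * _ * (xi - z)]mulrA -key.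
    by move: dz; move: (1 - cconj a * z) => q q0; field; rewrite q0 p0.
  rewrite /L E /k /c invf_div.
  have -> : 1 - cconj a * z = p + cconj a * (xi - z) by rewrite /p; ring.
  move: xz e0; move: (xi - z) (1 - a * cconj a) => v e v0 e0'.
  by field; rewrite u0 v0 e0'.
(* With |xi| = 1 the fixed point equation gives u = p / conj(p), and then k = |p|^2 / (1 -
   |a|^2). *)
have kR : exists2 kr : R, 0 < kr & k = kr%:C%C.
  have uE : u = p / cconj p.
    have cp0 : cconj p != 0 by rewrite -nc_gt0 nc_conj nc_gt0.
    have : xi * cconj p = xi - a.
      rewrite /p; have -> : cconj (1 - cconj a * xi) = 1 - a * cconj xi.
        by rewrite /cconj rmorphB rmorphM rmorph1 /= conjcK.
      rewrite mulrBr mulr1 mulrCA mul_cconj nxi expr1n mulr1 //.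
    move=> h; apply: (mulIf cp0); rewrite divfK //.
    apply: (mulfI xi0); rewrite mulrCA h fixE /p //.
  exists (nc p ^+ 2 / (1 - nc a ^+ 2)).
    by rewrite divr_gt0 ?exprn_gt0 ?nc_gt0 // subr_gt0 nc_sqr_lt1.
  have cp0 : cconj p != 0 by rewrite -nc_gt0 nc_conj nc_gt0.
  rewrite /k uE fmorph_div rmorphB rmorph1 /= -!mul_cconj.
  move: cp0 e0; move: (cconj p) (1 - a * cconj a) => cp e cp0' e0'.
  by field; rewrite p0 cp0' e0'.
have [kr kr0 kE] := kR.
have diff j x1 y1 : D x1 -> D y1 -> L (iter j f x1) - L (iter j f y1) = k ^+ j * (L x1 - L y1).
  move=> Dx Dy; elim: j => [|j IH]; first by rewrite expr0 mul1r.
  rewrite /= !LE; [|exact: iter_selfmap bf.1 _|exact: iter_selfmap bf.1 _].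
  by rewrite opprD addrACA subrr addr0 -mulrBr IH exprS mulrA.
have D0 := @udisc0 R.
pose h : C := (1 / 2)%:C%C.
have nh : nc h = 1 / 2 by rewrite nc_real ger0_norm //; lra.
have Dh : D h by rewrite udiscE nh; lra.
have Lh : L 0 - L h != 0.
  rewrite subr_eq0; apply/eqP => /(congr1 (@GRing.inv _)); rewrite /L !invrK subr0 => e.
  have : xi - (xi - h) = 0 by rewrite -e subrr.
  have -> : xi - (xi - h) = h by ring.
  by move/eqP; rewrite -nc_eq0 nh gt_eqF //; lra.
(* Iterating [f] multiplies differences of [L] by powers of [k]; positivity then forces k = 1, [L]
   is translated by [c *+ m], and c = 0 is impossible. *)
have km : kr ^+ m = 1.
  have := diff m 0 h D0 Dh; rewrite !fm // -{1}(mul1r (L 0 - L h)) => /(mulIf Lh) /esym.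
  by rewrite kE -rmorphXn => /(congr1 (@complex.Re R)) /=.
have k1 : k = 1.
  rewrite kE; suff -> : kr = 1 by [].
  apply/eqP; rewrite -(@eqrXn2 _ m) // ?ltW // km ?expr1n //.
have c0 : c = 0.
  have it j : L (iter j f 0) = L 0 + c *+ j.
    elim: j => [|j IH]; first by rewrite addr0.
    rewrite /= LE; last exact: iter_selfmap bf.1 _.
    by rewrite k1 mul1r IH mulrSr addrA.
  have := it m; rewrite fm // -{1}(addr0 (L 0)) => /addrI /esym /eqP.
  by rewrite mulrn_eq0 gtn_eqF //= => /eqP.
exfalso; move/eqP: c0; rewrite /c !mulf_eq0 invr_eq0 !mulf_eq0.
by rewrite (negbTE ca0) (negbTE p0) (negbTE u0) (negbTE e0).
Qed.

End FiniteOrder.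

(** * The sign character and the torsion-free subgroup *)

Section TorsionFree.
Variable R : realType.
Local Notation C := (R[i]).
Implicit Types (a b c l t x y z w u : C) (f g h gam : C -> C) (i p q : int * int).
Local Notation D := (@udisc R).
Local Notation Lat := (@inLat R).
Local Notation cell_center := (@cell_center R).

Variable F : C -> C.
Hypothesis univF : universal_at F cell_center.

Let oD := @udisc_open R.
Let Dz0 := @udisc0 R.
Let HF := HolF univF.
Let F0 := F0 univF.

(* The lattice is cut into the pairs {lam i, lam i + 1}.  As |lam i| grows, the square root of
   (F - lam i)(F - lam i - 1) chosen near F - lam i - 1/2 at 0 stays near it, so a deck
   transformation changes the sign of finitely many of these square roots only; [eps] is the
   parity of their number. *)
Definition lam i : C := Complex (2 * i.1)%:~R (i.2)%:~R.

Lemma lamB i p : lam (i - p) = lam i - lam p.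
Proof. by rewrite /lam /= mulrBr !rmorphB. Qed.

Lemma lamD i p : lam (i + p) = lam i + lam p.
Proof. by rewrite /lam /= mulrDr !rmorphD. Qed.

Lemma lamN p : lam (- p) = - lam p.
Proof. by rewrite /lam /= mulrN !rmorphN. Qed.

Lemma lam0 : lam 0 = 0.
Proof. by []. Qed.

Lemma lam_inj : injective lam.
Proof.
move=> [a b] [a' b'] [] /intr_inj e1 /intr_inj -> ; congr pair.
by move: e1 => /=; lia.
Qed.

Lemma lamLat i : Lat (lam i).
Proof. by exists (2 * i.1), i.2. Qed.

Lemma lam1Lat i : Lat (lam i + 1).
Proof. by exists (2 * i.1 + 1), i.2; rewrite /lam intrD /GRing.add /= addr0. Qed.

Definition pairpol i z := (F z - lam i) * (F z - lam i - 1).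

Lemma pair_sqrt_exists i : exists k, [/\ Hol D k, forall z, D z -> k z ^+ 2 = pairpol i z &
  nc (k 0 - (F 0 - lam i - 1 / 2)) <= nc (k 0 + (F 0 - lam i - 1 / 2))].
Proof.
have [] := @global_sqrt _ (pairpol i) 0 1.
- by apply: HolM => //; do ?apply: HolBc.
- move=> z Dz; apply: lsqM; first exact: (evF univF).2 _ z (lamLat i) Dz.
  apply: (lsq_near ltr01 _ ((evF univF).2 _ z (lam1Lat i) Dz)) => w _; ring.
move=> k Hk kE; set V := F 0 - _ - _.
have [le|gt] := leP (nc (k 0 - V)) (nc (k 0 + V)); first by exists k.
exists (fun z => - k z); split=> [|z Dz|]; first exact: HolN.
  by rewrite sqrrN kE.
have -> : - k 0 - V = - (k 0 + V) by ring.
have -> : - k 0 + V = - (k 0 - V) by ring.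
by rewrite !ncN; exact: ltW.
Qed.

Definition pair_sqrt i := projT1 (cid (pair_sqrt_exists i)).

Lemma Hol_pair_sqrt i : Hol D (pair_sqrt i).
Proof. by have [] := projT2 (cid (pair_sqrt_exists i)). Qed.

Lemma pair_sqrtE i z : D z -> pair_sqrt i z ^+ 2 = pairpol i z.
Proof. by have [_ h _] := projT2 (cid (pair_sqrt_exists i)); exact: h. Qed.

Lemma pair_sqrt_sign i :
  nc (pair_sqrt i 0 - (F 0 - lam i - 1 / 2)) <= nc (pair_sqrt i 0 + (F 0 - lam i - 1 / 2)).
Proof. by have [] := projT2 (cid (pair_sqrt_exists i)). Qed.

Lemma pair_sqrt0 i : pair_sqrt i 0 != 0.
Proof.
rewrite -sqrf_eq0 pair_sqrtE // /pairpol F0 mulf_neq0 //.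
  by rewrite subr_eq0; apply: contra_notN (@cell_center_notLat R) => /eqP ->; exact: lamLat.
rewrite -addrA -opprD subr_eq0.
by apply: contra_notN (@cell_center_notLat R) => /eqP ->; exact: lam1Lat.
Qed.

(** With V = F - lam i - 1/2 the pair polynomial is V^2 - 1/4, so its root is within 1/2 of V or of
    -V, and for large V of only one of them. *)
Lemma pair_sqrt_factor i z : D z ->
  (pair_sqrt i z - (F z - lam i - 1 / 2)) * (pair_sqrt i z + (F z - lam i - 1 / 2)) = - (1 / 4).
Proof.
by move=> Dz; rewrite -subr_sqr pair_sqrtE // /pairpol; field.
Qed.

Lemma nc_quarter : nc (- (1 / 4) : C) = 1 / 4.
Proof. by rewrite ncN nc_div nc1 nc_nat. Qed.

Lemma pair_sqrt_near0 i : nc (pair_sqrt i 0 - (F 0 - lam i - 1 / 2)) <= 1 / 2.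
Proof.
have := pair_sqrt_sign i; have := congr1 (@nc R) (pair_sqrt_factor i Dz0).
rewrite ncM nc_quarter; set A := nc _; set B := nc _ => AB le.
have A0 : 0 <= A by exact: nc_ge0.
by rewrite leNgt; apply/negP => lt; nra.
Qed.

(** For [gam] over the translation [lam p], both [pair_sqrt i \o gam] and [pair_sqrt (i - p)] are
    roots of [pairpol (i - p)]; their relative sign is constant on the disc and is read at 0. *)
Definition sg gam p i : bool := pair_sqrt i (gam 0) != pair_sqrt (i - p) 0.

Lemma neq_opp x : x != 0 -> - x != x.
Proof.
by move=> x0; rewrite -subr_eq0 -opprD oppr_eq0 -mulr2n mulrn_eq0.
Qed.

Lemma sgP gam p i z : deck F (lam p) gam -> D z ->
  pair_sqrt i (gam z) = if sg gam p i then - pair_sqrt (i - p) z else pair_sqrt (i - p) z.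
Proof.
move=> [bg _ gE] Dz; have k0 := pair_sqrt0 (i - p).
have Hg : Hol D (fun z => pair_sqrt i (gam z)).
  exact: (Hol_comp oD oD bg.1.2 bg.1.1 (Hol_pair_sqrt i)).
have sq y : D y -> pair_sqrt i (gam y) ^+ 2 = pair_sqrt (i - p) y ^+ 2.
  move=> Dy; rewrite !pair_sqrtE //; last exact: bg.1.2.
  by rewrite /pairpol gE // lamB; ring.
have [e|e] := sqrt_unique (@udisc_convex R) oD Hg (Hol_pair_sqrt (i - p)) sq.
  by rewrite /sg (e 0 Dz0) eqxx /= e.
by rewrite /sg (e 0 Dz0) neq_opp // e.
Qed.

(** For large [lam i] the difference [m] of the root and V is followed along the segment from 0 to
    [gam 0]: it starts at modulus at most 1/2, a short move keeps it below 3/4, and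
    [pair_sqrt_factor] with |V| > 5 brings this back to 1/2. A sign change would put the root near
    both V and -V at [gam 0]. *)
Lemma sg_bound gam p : deck F (lam p) gam -> exists M : R, forall i, sg gam p i -> nc (lam i) <= M.
Proof.
move=> dg; have [bg _ gE] := dg.
have Dg : D (gam 0) by exact: bg.1.2.
have g1 : nc (gam 0) < 1 by rewrite -udiscE.
have [M M0 bM] := Hol_bounded g1 HF.
exists (M + 10) => i; apply: contraTT; rewrite -ltNge => big.
pose V z := F z - lam i - 1 / 2.
have nhalf : nc (1 / 2 : C) = 1 / 2 by rewrite nc_div nc1 nc_nat.
have gs (t : R) : 0 <= t -> t <= 1 -> nc (seg 0 (gam 0) t) <= nc (gam 0).
  by move=> t0 t1; apply: nc_seg_le => //; rewrite nc0 nc_ge0.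
have Vbig z : nc z <= nc (gam 0) -> 5 < nc (V z).
  move=> zg; have := bM z; rewrite subr0 => /(_ zg) b1.
  have := ncB_ge (lam i) (F z - 1 / 2); have := ncB (F z) (1 / 2); rewrite nhalf.
  have -> : lam i - (F z - 1 / 2) = - V z by rewrite /V; ring.
  rewrite ncN; lra.
pose m z := pair_sqrt i z - V z.
have Hm : Hol D m by apply: HolB => //; [exact: Hol_pair_sqrt|do ?apply: HolBc].
have near : nc (m (gam 0)) <= 1 / 2.
  pose P (s t : R) := nc (m (seg 0 (gam 0) s)) <= 1 / 2 -> nc (m (seg 0 (gam 0) t)) <= 1 / 2.
  have : P 0 1.
    apply: cousin => // [s c t _ _ h1 h2 /h1 /h2 //|v v0 v1].
    have gv := gs v v0 v1.
    have Dv : D (seg 0 (gam 0) v) by rewrite udiscE; lra.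
    have [d d0 hd] := Hol_cont Hm Dv (e := 1 / 8) ltac:(lra).
    exists d => // s t s1 s2 t1 t2 s0 t1'; rewrite /P.
    have L0 := nc_ge0 (gam 0).
    have close (r : R) : `|r - v| < d -> nc (m (seg 0 (gam 0) r) - m (seg 0 (gam 0) v)) < 1 / 8.
      move=> rv; apply: hd; rewrite nc_segB subr0; apply: le_lt_trans rv.
      by rewrite ler_piMr // ltW.
    have hs := close s ltac:(by rewrite ltr_norml; apply/andP; split; lra).
    have ht := close t ltac:(by rewrite ltr_norml; apply/andP; split; lra).
    set zs := seg 0 (gam 0) s in hs *; set zt := seg 0 (gam 0) t in ht *.
    set zv := seg 0 (gam 0) v in hs ht.
    move=> ms; have gt := gs t ltac:(lra) ltac:(lra).
    have Dt : D zt by rewrite udiscE /zt; lra.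
    have mt : nc (m zt) <= 3 / 4.
      have := nc_triangle (m zt) (m zv) (m zs); rewrite (nc_distC (m zv)).
      by have := ncB_ge (m zt) (m zs); lra.
    have fac := congr1 (@nc R) (pair_sqrt_factor i Dt).
    rewrite ncM nc_quarter -/(V zt) -/(m zt) in fac.
    have := ncB_ge (V zt + V zt) (- m zt); rewrite ncN opprK.
    have -> : V zt + V zt + m zt = pair_sqrt i zt + V zt by rewrite /m; ring.
    have : nc (V zt + V zt) = 2 * nc (V zt).
      have -> : V zt + V zt = 2 * V zt by ring.
      by rewrite ncM nc_nat.
    have := Vbig zt gt; have := nc_ge0 (m zt); move: fac mt.
    set A := nc (m zt); set B := nc (_ + V zt); set X := nc (V zt + V zt) => *.
    have B9 : 9 < B by lra.
    by rewrite leNgt; apply/negP => A2; nra.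
  by rewrite /P seg0 seg1; apply; exact: pair_sqrt_near0.
apply/negP => sgt; move: near; rewrite /m (sgP i dg Dz0) sgt.
have -> : V (gam 0) = F 0 - lam (i - p) - 1 / 2 by rewrite /V gE // lamB; ring.
have := pair_sqrt_near0 (i - p); set k := pair_sqrt _ 0; set v := F 0 - _ - _ => h1 h2.
have v5 : 5 < nc v.
  by have := Vbig (gam 0) (lexx _); rewrite /V gE // /v lamB; congr (5 < nc _); ring.
have : nc (v + v) <= 1.
  have -> : v + v = - (k - v) - (- k - v) by ring.
  by apply: le_trans (ncB _ _) _; rewrite ncN; lra.
have -> : v + v = 2 * v by ring.
by rewrite ncM nc_nat; lra.
Qed.

Lemma sg_finsupp gam p : deck F (lam p) gam -> finsupp (sg gam p).
Proof.
move=> /sg_bound[M bM]; pose K := (Num.truncn M).+1.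
have MK : M < K%:R by exact: truncnS_gt.
have int_le (a : int) : `|a%:~R| <= M -> (`|a| <= K)%N.
  move=> h; rewrite -(ler_nat R) -[(`|a|%N)%:R]/((`|a|%N : int)%:~R) abszE intr_norm; lra.
apply: (@finsupp_box _ K) => i /bM h; split; apply: int_le; last first.
  exact: le_trans (Im_le_nc (lam i)) h.
have := le_trans (Re_le_nc (lam i)) h; rewrite /= intrM normrM ger0_norm ?ler0z //.
by have := normr_ge0 (i.1%:~R : R); lra.
Qed.

Definition eps gam p := par (sg gam p).

(** The signs form a cocycle up to a shift of the index by [p], and the parity is additive and
    invariant under shifts. *)
Lemma eps_comp f g p q : deck F (lam p) f -> deck F (lam q) g ->
  eps (fun z => f (g z)) (p + q) = eps f p (+) eps g q.
Proof.
move=> df dg; rewrite /eps.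
have E : sg (fun z => f (g z)) (p + q) = (fun i => sg f p i (+) sg g q (i - p)).
  apply/funext => i; rewrite {1}/sg.
  have Dg0 : D (g 0) by have [bg _ _] := dg; exact: bg.1.2.
  rewrite (sgP i df Dg0) (sgP (i - p) dg Dz0) opprD addrA.
  have k0 := pair_sqrt0 (i - p - q); have kn := neq_opp k0.
  by case: (sg f p i); case: (sg g q (i - p)) => /=; rewrite ?opprK ?eqxx ?kn.
have fg : finsupp (fun i => sg g q (i - p)).
  have [r hr] := sg_finsupp dg; exists [seq j + p | j <- r] => i /hr h.
  by apply/mapP; exists (i - p) => //; rewrite subrK.
rewrite E par_addb //; last exact: sg_finsupp.
by rewrite (@par_shift (sg g q)) //; exact: sg_finsupp.
Qed.

Lemma eps_fix0 gam : gam 0 = 0 -> eps gam 0 = false.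
Proof. by move=> g0; apply: par_false => i; rewrite /sg g0 subr0 eqxx. Qed.

(** Translations have the form [lam p] because they must respect the pairing of lattice points on
    which [eps] rests; those in n L make [f] equivariant. *)
Definition Hgrp n gam := exists p, [/\ deck F (lam p) gam, multLat n (lam p) & eps gam p = false].

Lemma Hgrp_id n : Hgrp n id.
Proof.
exists 0; rewrite lam0; split; [exact: deck_id|exact: multLat0|exact: eps_fix0].
Qed.

Lemma Hgrp_comp n f g : Hgrp n f -> Hgrp n g -> Hgrp n (fun z => f (g z)).
Proof.
move=> [p [dp mp ep]] [q [dq mq eq]]; exists (p + q); split.
- by rewrite lamD; exact: deck_comp.
- by rewrite lamD; exact: multLatD.
- by rewrite eps_comp // ep eq.
Qed.

Lemma Hgrp_inv n f : Hgrp n f -> exists g, [/\ Hgrp n g,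
  forall z, D z -> g (f z) = z & forall z, D z -> f (g z) = z].
Proof.
move=> [p [dp mp ep]]; have [g [dg gK fK]] := deck_inv dp.
exists g; split=> //; exists (- p); rewrite -lamN in dg; split=> //.
  by rewrite lamN; exact: multLatN.
have := eps_comp dg dp; rewrite ep addbF addNr => <-.
by apply: eps_fix0; rewrite gK.
Qed.

Lemma pairpol_zero z : D z -> Lat (F z) -> exists i0, pairpol i0 z = 0 /\
  forall i, i != i0 -> pairpol i z != 0.
Proof.
move=> Dz [a [b E]]; pose i0 : int * int := ((a %/ 2)%Z, b).
have pp i : (pairpol i z == 0) = (i.2 == b) && ((a == 2 * i.1) || (a == 2 * i.1 + 1)).
  rewrite /pairpol mulf_eq0 subr_eq0 -addrA -opprD subr_eq0 E.
  have -> : lam i + 1 = Complex (2 * i.1 + 1)%:~R (i.2)%:~R.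
    by rewrite /lam intrD /GRing.add /= addr0.
  rewrite /lam !eq_complex /= !eqr_int; rewrite [b == _]eq_sym.
  by case: (i.2 == b); rewrite ?andbT ?andbF.
exists i0; split; first by apply/eqP; rewrite pp /= eqxx /=; lia.
move=> [i1 i2]; rewrite pp /=; apply: contra => /andP[/eqP -> h].
by apply/eqP; congr pair; lia.
Qed.

(** Differentiating [k ^+ 2 = pairpol i] twice at [z] gives 2 k'(z)^2 = F''(z) (2 (F z - lam i) -
    1), where the last factor is 1 or -1. *)
Lemma pair_sqrt_simple i z : D z -> Lat (F z) -> pairpol i z = 0 -> dv (pair_sqrt i) z != 0.
Proof.
move=> Dz Lz pz; have [d1 d2] := F_critical univF Dz Lz.
set k := pair_sqrt i; have Hk : Hol D k by exact: Hol_pair_sqrt.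
have k0 : k z = 0 by apply/eqP; rewrite -sqrf_eq0 pair_sqrtE // pz.
have [r r0 rD] := oD Dz.
have dk2 w : D w -> cdv (fun y => k y * k y) w (2 * (k w * dv k w)).
  move=> Dw; have := cdvM (Hol_cdv Hk Dw) (Hol_cdv Hk Dw).
  by have -> : dv k w * k w + k w * dv k w = 2 * (k w * dv k w) by ring.
have cF w : D w -> cdv F w (dv F w) by move=> Dw; exact: (Hol_cdv HF).
have c1 w c : D w -> cdv (fun y => F y - c) w (dv F w).
  by move=> Dw; have := cdvB (cF w Dw) (cdv_cst c w); rewrite subr0.
have dp w : D w -> cdv (pairpol i) w (dv F w * (2 * (F w - lam i) - 1)).
  move=> Dw; have c2 : cdv (fun y => F y - lam i - 1) w (dv F w).
    by have := cdvB (c1 w (lam i) Dw) (cdv_cst 1 w); rewrite subr0.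
  have := cdvM (c1 w (lam i) Dw) c2.
  suff -> : dv F w * (F w - lam i - 1) + (F w - lam i) * dv F w =
    dv F w * (2 * (F w - lam i) - 1) by [].
  by ring.
have eqd w : D w -> 2 * (k w * dv k w) = dv F w * (2 * (F w - lam i) - 1).
  move=> Dw; have [s s0 sD] := oD Dw; apply: (cdv_uniq (dk2 w Dw)).
  by apply: (cdv_near s0 _ (dp w Dw)) => y /sD Dy; rewrite -expr2 pair_sqrtE.
have e1 : cdv (fun w => 2 * (k w * dv k w)) z (2 * (dv k z * dv k z + k z * dv (dv k) z)).
  by apply: cdvZ; apply: cdvM; [exact: (Hol_cdv Hk)|exact: (Hol_cdv (Hol_dv Hk))].
have e2 : cdv (fun w => dv F w * (2 * (F w - lam i) - 1)) z
    (dv (dv F) z * (2 * (F z - lam i) - 1) + dv F z * (2 * dv F z - 0)).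
  apply: cdvM; first exact: (Hol_cdv (Hol_dv HF)).
  by apply: cdvB; [apply: cdvZ; exact: c1|exact: cdv_cst].
have := cdv_uniq e1 (cdv_near r0 (fun w wd => esym (eqd w (rD w wd))) e2).
rewrite d1 k0 mul0r addr0 mul0r addr0 => E.
have u0 : 2 * (F z - lam i) - 1 != 0.
  move/eqP: pz; rewrite /pairpol mulf_eq0 => /orP[/eqP -> |/eqP e].
    by rewrite mulr0 sub0r oppr_eq0 oner_eq0.
  have -> : F z - lam i = 1 by apply/eqP; rewrite -subr_eq0 e.
  by rewrite mulr1 -[2]/(1 + 1) addrK oner_eq0.
apply: contraTneq (mulf_neq0 d2 u0) => kz0.
by rewrite -E kz0 !mulr0 eqxx.
Qed.

(* A nontrivial element with a fixed point z0 has F z0 in the lattice; the square root attached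
   to the pair of F z0 has a simple zero at z0 and changes sign, the other ones do not vanish at
   z0 and do not: the parity is odd. *)
Lemma Hgrp_torsion n gam m : Hgrp n gam -> (0 < m)%N ->
  (forall z, D z -> iter m gam z = z) -> forall z, D z -> gam z = z.
Proof.
move=> [p [dg _ ep]] m0 fin; have [bg _ gE] := dg.
have Fit j : F (iter j gam 0) = F 0 + lam p *+ j.
  elim: j => [|j IH]; first by rewrite addr0.
  by rewrite /= gE; [rewrite IH mulrSr addrA|exact: iter_selfmap bg.1 _].
have p0 : p = 0.
  apply: lam_inj; rewrite lam0; apply/eqP.
  have := Fit m; rewrite fin // -{1}(addr0 (F 0)) => /addrI /esym/eqP.
  by rewrite mulrn_eq0 gtn_eqF.
rewrite p0 in dg gE ep.
have [z0 Dz g0] := finite_order_fixed bg m0 fin.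
have [d1|d1] := eqVneq (dv gam z0) 1; first exact: bihol_fix_dv1 bg Dz g0 d1.
have cg := Hol_cdv bg.1.1 Dz.
have [r r0 rD] := oD Dz.
have dF0 : dv F z0 = 0.
  have c1 : cdv (fun w => F (gam w)) z0 (dv F z0 * dv gam z0).
    by apply: (cdv_comp cg); rewrite g0; exact: (Hol_cdv HF).
  have c2 : cdv (fun w => F (gam w)) z0 (dv F z0).
    apply: (cdv_near r0 _ (Hol_cdv HF Dz)) => w /rD Dw.
    by rewrite gE // lam0 addr0.
  have := cdv_uniq c1 c2 => /eqP; rewrite -subr_eq0 -{2}[dv F z0]mulr1 -mulrBr mulf_eq0.
  by rewrite subr_eq0 (negbTE d1) orbF => /eqP.
have Lz : Lat (F z0).
  apply: contrapT => nL; have := F_regular univF Dz nL; by rewrite dF0 eqxx.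
have [i0 [pi0 pi]] := pairpol_zero Dz Lz.
have kE i := sgP i dg Dz; rewrite g0 in kE.
suff : eps gam 0 = true by rewrite ep.
apply: (@par_single _ i0).
  apply: contraT => nsg.
  have Hk := Hol_pair_sqrt i0.
  have c1 : cdv (fun w => pair_sqrt i0 (gam w)) z0 (dv (pair_sqrt i0) z0 * dv gam z0).
    by apply: (cdv_comp cg); rewrite g0; exact: (Hol_cdv Hk).
  have c2 : cdv (fun w => pair_sqrt i0 (gam w)) z0 (dv (pair_sqrt i0) z0).
    apply: (cdv_near r0 _ (Hol_cdv Hk Dz)) => w /rD Dw.
    by rewrite (sgP i0 dg Dw) (negbTE nsg) subr0.
  have := cdv_uniq c1 c2 => /eqP.
  rewrite -subr_eq0 -{2}[dv (pair_sqrt i0) z0]mulr1 -mulrBr mulf_eq0.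
  by rewrite (negbTE (pair_sqrt_simple Dz Lz pi0)) subr_eq0 (negbTE d1).
move=> i /pi ne; apply/negbTE/negP => sgi; have := kE i; rewrite sgi subr0 => /eqP.
rewrite eq_sym; apply/negP; apply: neq_opp.
by rewrite -sqrf_eq0 pair_sqrtE.
Qed.

(** The kernel of the sign has index at most two: an element of odd sign is corrected by one fixed
    odd element [gs], at the price of one more compact disc. *)
Lemma Hgrp_cocompact n : (0 < n)%N -> exists2 r : R, 0 <= r /\ r < 1 &
  forall z, D z -> exists2 gam, Hgrp n gam & nc (gam z) <= r.
Proof.
move=> n0; have [r [r0 r1] coc] := @cocompact _ F univF (2 * n) ltac:(by rewrite muln_gt0).
(* Translations in 2n L have even real part, hence respect the pairs, and lie in n L. *)
have lamE t : multLat (2 * n) t -> exists p, t = lam p /\ multLat n (lam p).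
  move=> [s [a [b ->]] ->]; exists (n%:Z * a, (2 * n)%:Z * b).
  have e : ((2 * n)%:R * Complex a%:~R b%:~R : C) = lam (n%:Z * a, (2 * n)%:Z * b).
    have -> : ((2 * n)%:R : C) = ((2 * n)%:R : R)%:C%C by rewrite rmorph_nat.
    apply/eqP; rewrite eq_complex /= !mul0r subr0 addr0.
    by rewrite !intrM -!pmulrn natrM -mulrA !eqxx.
  split=> //; rewrite -e; exists (2 * Complex a%:~R b%:~R); last first.
    by rewrite natrM mulrCA mulrA.
  by rewrite mulr_natl mulr2n; apply: inLatD; exists a, b.
have [[gs [ps [ds ms es]]]|none] := pselect (exists gs ps,
   [/\ deck F (lam ps) gs, multLat n (lam ps) & eps gs ps = true]); last first.
  exists r => // z Dz; have [gam [t [dg mt gr]]] := coc z Dz.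
  have [p [tE mp]] := lamE t mt; exists gam => //; exists p; rewrite -tE; split=> //.
    by rewrite tE.
  apply/negbTE/negP => ep; apply: none; exists gam, p; split=> //.
  by rewrite -tE.
have [bgs _ _] := ds; have [r' [r'0 r'1] hr'] := selfmap_compact r1 bgs.1.
exists (Num.max r r'); first by split; [rewrite le_max r0|rewrite gt_max r1].
move=> z Dz; have [gam [t [dg mt gr]]] := coc z Dz.
have [p [tE mp]] := lamE t mt; rewrite tE in dg.
case ep : (eps gam p); last first.
  by exists gam; [exists p|rewrite le_max gr].
exists (fun z => gs (gam z)); last by rewrite le_max hr' ?orbT.
exists (ps + p); rewrite lamD; split; [exact: deck_comp|exact: multLatD|].
by rewrite eps_comp // es ep.
Qed.

(** A small displacement at 0 forces |t| < 1, so t = 0; [F] being injective near 0, [gam] is then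
    the identity near 0, hence everywhere. *)
Lemma deck_isolated : exists2 d : R, 0 < d & forall t gam, deck F t gam ->
  (forall z, nc z <= 1 / 2 -> nc (gam z - z) < d) -> forall z, D z -> gam z = z.
Proof.
have [_ _ dF0 _] := univF.
have [d1 [d10 d11] inj] := local_injective ltr01 HF dF0.
have [d2 d20 h2] := Hol_cont HF Dz0 (e := 1) ltr01.
exists (Num.min (d1 / 2) d2); first by rewrite lt_min d20 andbT; lra.
move=> t gam [bg Lt gE] small.
have close z : nc z <= 1 / 2 -> nc (gam z - z) < d1 / 2 /\ nc (gam z - z) < d2.
  by move=> /small; rewrite lt_min => /andP.
have n0 : nc (0 : C) <= 1 / 2 by rewrite nc0; lra.
have t0 : t = 0.
  apply/eqP; apply: contraT => tn; have := lattice_norm_ge1 Lt tn.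
  have := h2 (gam 0) (close 0 n0).2; rewrite gE // [F 0 + t]addrC addrK; lra.
have fix_near z : nc z < d1 / 2 -> gam z = z.
  move=> zd; have z2 : nc z <= 1 / 2 by lra.
  have Dz : D z by rewrite udiscE; lra.
  apply: inj.
  - rewrite /disc /= subr0; have := (close z z2).1; have := ncB_ge (gam z) z; lra.
  - by rewrite /disc /= subr0; lra.
  - by rewrite gE // t0 addr0.
apply: (bihol_fix_dv1 bg Dz0); first by apply: fix_near; rewrite nc0; lra.
apply: dvE; apply: (@cdv_near _ id _ _ _ (d1 / 2)); first lra.
  by move=> w; rewrite subr0 => /fix_near ->.
exact: cdv_id.
Qed.

End TorsionFree.

(** * The graph and its second fundamental form *)

Section SecondFundamentalForm.
Variable R : realType.
Local Notation C := (R[i]).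
Implicit Types (a b c l t x y z w u : C) (f g h : C -> C).

Lemma normcE z : `|z| = (nc z)%:C%C.
Proof. by []. Qed.

Lemma posc_real (e : C) : 0 < e -> exists2 r : R, 0 < r & e = r%:C%C.
Proof. by case: e => r s; rewrite ltcE /= => /andP[/eqP -> r0]; exists r. Qed.

(** With [cdv_derivable], the bridge between [cdv] and the derivative over [C^o] in which [holo_on]
    and [sff_sq] are expressed. *)
Lemma derivable_cdv f z : derivable (f : C^o -> C^o) z 1 -> cdv f z (d1 f z).
Proof.
move=> df; apply: eps_cdv => e e0.
have e0' : 0 < e%:C%C :> C by rewrite ltcR.
have /cvgrPdist_lt/(_ _ e0') := df.
move=> /nbhs_ballP[r /= /posc_real[d d0 ->]] hr.
exists d => // w wd.
have [->|nz] := eqVneq w z.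
  by rewrite !subrr mulr0 subr0 nc0 mulr0.
have wz : w - z != 0 by rewrite subr_eq0.
have nwz : 0 < nc (w - z) by rewrite nc_gt0.
have := hr (w - z); rewrite /ball /= sub0r normrN normcE ltcR => /(_ wd wz).
rewrite -[(w - z) *: 1]/((w - z) * 1) mulr1 subrK normcE ltcR => h.
rewrite -/(d1 f z) -[_ *: _]/((w - z)^-1 * (f w - f z)) in h.
have -> : f w - f z - d1 f z * (w - z) = - ((d1 f z - (w - z)^-1 * (f w - f z)) * (w - z)).
  by field.
by rewrite ncN ncM ler_wpM2r // ltW.
Qed.

Lemma cdv_derivable f z l : cdv f z l -> derivable (f : C^o -> C^o) z 1 /\ d1 f z = l.
Proof.
move=> df.
have cv : (h^-1 *: ((f \o shift z) (h *: (1 : C^o)) - f z : C^o)) @[h --> (0 : (C : numFieldType))^'] --> (l : C^o).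
  apply/cvgrPdist_lt => _ /posc_real[e e0 ->].
  have [d d0 hd] := cdv_eps df (e := e / 2) ltac:(lra).
  apply/nbhs_ballP; exists d%:C%C => /=; first by rewrite ltcR.
  move=> h; rewrite /ball /= sub0r normrN normcE ltcR => hd' h0.
  rewrite -[h *: 1]/(h * 1) mulr1 -[_ *: _]/(h^-1 * (f (h + z) - f z)) normcE ltcR.
  have nh : 0 < nc h by rewrite nc_gt0.
  have := hd (h + z); rewrite addrK => /(_ hd').
  have -> : f (h + z) - f z - l * h = - ((l - h^-1 * (f (h + z) - f z)) * h) by field.
  rewrite ncN ncM ler_pM2r //; lra.
split; first by apply/cvg_ex; exists l.
exact: (cvg_lim (@norm_hausdorff _ _) cv).
Qed.

Lemma holo_on_cdv c (rho : R) f w : holo_on c rho f -> nc (w - c) < rho ->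
  cdv f w (d1 f w) /\ cdv (d1 f) w (d2 f w).
Proof. by move=> H /H[/derivable_cdv ? /derivable_cdv ?]. Qed.

Lemma Hol_d1 U f w : Hol U f -> U w -> derivable (f : C^o -> C^o) w 1 /\ d1 f w = dv f w.
Proof. by move=> Hf Uw; apply: cdv_derivable; exact: Hol_cdv Hf Uw. Qed.

Lemma Hol_holo_on c (rho : R) f : Hol (disc c rho) f -> holo_on c rho f.
Proof.
move=> Hf w wr; split; first by have [] := Hol_d1 Hf wr.
have [r r0 rD] := @disc_open _ c rho w wr.
suff : cdv (d1 f) w (dv (dv f) w) by move=> /cdv_derivable[].
apply: (cdv_near r0 _ (Hol_cdv (Hol_dv Hf) wr)) => y /rD yr.
by have [_ ->] := Hol_d1 Hf yr.
Qed.

Definition hden z : R := (1 - nc z ^+ 2) ^- 2.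

Lemma hden_gt0 z : nc z < 1 -> 0 < hden z.
Proof. by move=> /nc_sqr_lt1 h; rewrite invr_gt0 exprn_gt0 //; lra. Qed.

Lemma hinner_self (Z X : C * C) :
  hinner Z X X = (hden Z.1 * nc X.1 ^+ 2 + hden Z.2 * nc X.2 ^+ 2)%:C%C.
Proof. by rewrite /hinner -!mulrA !mul_cconj /hmet -!rmorphM -rmorphD. Qed.

(** The second covariant derivative of [f] for the Poincare metrics of source and target. *)
Definition gcurv f z : C :=
  dv (dv f) z + chr (f z) * dv f z ^+ 2 - dv f z * chr z.

(* A horizontal curve has T = a(1, f') and A = alpha (1, f') + (0, a^2 B) with B = gcurv f,
   so only (0, a^2 B) contributes to the normal part. *)
Lemma sff_graph f f1 f2 (rho : R) w : selfmap f -> holo_on 0 rho f1 -> holo_on 0 rho f2 ->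
  nc w < rho -> (forall y, nc y < rho -> nc (f1 y) < 1 /\ f2 y = f (f1 y)) ->
  (d1 f1 w, d1 f2 w) != (0, 0) ->
  sff_sq f1 f2 w = nc (gcurv f (f1 w)) ^+ 2 * (hden (f1 w) * hden (f (f1 w))) /
    (hden (f1 w) + hden (f (f1 w)) * nc (dv f (f1 w)) ^+ 2) ^+ 3.
Proof.
move=> [Hf fD] h1 h2 wr gr T0.
have [c1 c1'] := holo_on_cdv h1 (w := w) ltac:(by rewrite subr0).
have D1 y : nc y < rho -> d1 f2 y = dv f (f1 y) * d1 f1 y.
  move=> yr; have yr' : nc (y - 0) < rho by rewrite subr0.
  have [e1 _] := holo_on_cdv h1 yr'; have [e2 _] := holo_on_cdv h2 yr'.
  have Dy : udisc (f1 y) by rewrite udiscE; exact: (gr y yr).1.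
  apply: (cdv_uniq e2).
  have [r r0 rD] := @disc_open _ 0 rho y yr'.
  apply: (cdv_near r0 _ (cdv_comp e1 (Hol_cdv Hf Dy))) => x /rD.
  by rewrite disc0E => /gr[_ ->].
have [z1 z2] := gr w wr.
have Dz : udisc (f1 w) by rewrite udiscE.
have D2 : d2 f2 w = dv (dv f) (f1 w) * d1 f1 w * d1 f1 w + dv f (f1 w) * d2 f1 w.
  have wr' : nc (w - 0) < rho by rewrite subr0.
  have [_ e2] := holo_on_cdv h2 wr'.
  have [r r0 rD] := @disc_open _ 0 rho w wr'.
  apply: (cdv_uniq e2); apply: (cdv_near r0 _ (cdvM (cdv_comp c1 (Hol_cdv (Hol_dv Hf) Dz)) c1')).
  by move=> x /rD; rewrite disc0E => /D1 ->.
have fz1 : nc (f (f1 w)) < 1 by rewrite -udiscE; exact: fD.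
rewrite /sff_sq z2 D1 // D2 /=.
move: T0; rewrite D1 //.
have H1 := hden_gt0 z1; have H2 := hden_gt0 fz1.
rewrite !hinner_self /= /gcurv.
move: (dv (dv f) _) (chr (f _)) (chr (f1 w)) (d2 f1 w) (d1 f1 w) (dv f (f1 w)) => q x2 x1 a' a p T0.
rewrite /hinner /= /hmet -/(hden (f1 w)) -/(hden (f (f1 w))).
move: (hden (f1 w)) (hden (f (f1 w))) H1 H2 => k1 k2 H1 H2.
have a0 : a != 0.
  by apply: contraNneq T0 => ->; rewrite mulr0.
set al := a' + x1 * a ^+ 2.
set B := q + _ - _.
have -> : q * a * a + p * a' + x2 * (p * a) ^+ 2 = p * al + a ^+ 2 * B.
  by rewrite /al /B; ring.
have H0 : 0 < k1 + k2 * nc p ^+ 2 by have := mulr_ge0 (ltW H2) (sqr_ge0 (nc p)); lra.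
set H := k1 + _ in H0 *.
have HE : H%:C%C = k1%:C%C + k2%:C%C * (p * cconj p) :> C.
  by rewrite mul_cconj -rmorphM -rmorphD.
have HC : H%:C%C != 0 :> C by rewrite eq_complex /= eqxx andbT gt_eqF.
have TT : k1 * nc a ^+ 2 + k2 * nc (p * a) ^+ 2 = nc a ^+ 2 * H.
  by rewrite /H ncM; ring.
rewrite TT.
have cM x y : cconj (x * y) = cconj x * cconj y by exact: rmorphM.
have ca : cconj a != 0 by rewrite -nc_gt0 nc_conj nc_gt0.
set c := _ / (nc a ^+ 2 * H)%:C%C.
have cE : c = al / a + k2%:C%C * a * B * cconj p / H%:C%C.
  have -> : c = (k1%:C%C * al * cconj a + k2%:C%C * (p * al + a ^+ 2 * B) * (cconj p * cconj a)) /
      (a * cconj a * H%:C%C).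
    rewrite /c cM mul_cconj; congr (_ / _).
    exact: rmorphM.
  move: HC; rewrite HE.
  by move: (cconj a) (cconj p) ca => ? ? ? ?; field; apply/and3P; split.
have N1 : al - c * a = - (k2%:C%C * a ^+ 2 * B * cconj p / H%:C%C).
  by rewrite cE; field; apply/andP; split.
have N2 : p * al + a ^+ 2 * B - c * (p * a) = k1%:C%C * a ^+ 2 * B / H%:C%C.
  rewrite cE; move: HC; rewrite HE.
  by move: (cconj a) (cconj p) ca => ? ? ? ?; field; apply/andP; split.
rewrite N1 N2 ncN !nc_div !ncM ?ncX !nc_real nc_conj !gtr0_norm //.
have na : nc a != 0 by rewrite nc_eq0.
rewrite /H in H0 *; move: (nc a) (nc p) (nc B) na H0 => A P b A0 H0.
by field; rewrite A0 gt_eqF.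
Qed.

End SecondFundamentalForm.

(** * Curvature bounds from recentred maps *)

Section Curvature.
Variable R : realType.
Local Notation C := (R[i]).
Implicit Types (a b c l t x y z w u : C) (f g h : C -> C).
Local Notation D := (@udisc R).

Definition dmb a z : C := (1 - a * cconj a) / (1 - cconj a * z) ^+ 2.

Lemma cdv_dmb a z : nc a < 1 -> nc z < 1 ->
  cdv (dmb a) z (2 * cconj a * (1 - a * cconj a) / (1 - cconj a * z) ^+ 3).
Proof.
move=> a1 z1; have d := mb_den a1 z1.
have h2 : cdv (fun w => 1 - cconj a * w) z (0 - cconj a).
  by apply: cdvB; [exact: cdv_cst|exact: cdv_mulc].
have := cdvZ (1 - a * cconj a) (cdvV (cdvM h2 h2) (mulf_neq0 d d)).
set l := (_ - _) * _; set l' := _ / _ ^+ 3; suff -> : l = l' by [].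
rewrite /l /l'.
by move: (cconj a) d => k d; field.
Qed.

Lemma chrE z : nc z < 1 -> chr z = 2 * cconj z / (1 - z * cconj z).
Proof.
move=> z1; rewrite /chr mul_cconj.
have h := nc_sqr_lt1 z1.
have -> : 1 - (nc z ^+ 2)%:C%C = (1 - nc z ^+ 2)%:C%C :> C by rewrite rmorphB rmorph1.
by rewrite rmorphM fmorphV rmorph_nat mulrAC.
Qed.

(* f recentred so that the point (z, f z) of its graph moves to the origin *)
Definition recentre f z ze : C := mb (f z) (f (mb (- z) ze)).

Lemma selfmap_recentre f z : selfmap f -> D z -> selfmap (recentre f z).
Proof.
move=> sf Dz; have z1 : nc (- z) < 1 by rewrite ncN -udiscE.
have fz : nc (f z) < 1 by rewrite -udiscE; exact: sf.2.
apply: (@selfmap_comp _ (mb (f z)) (fun ze => f (mb (- z) ze))); first exact: selfmap_mb.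
by apply: selfmap_comp => //; exact: selfmap_mb.
Qed.

(** [chr] vanishes at 0, where the ordinary second derivative is thus the covariant one; the
    recentring isometries only rescale it. *)
Lemma recentre_dv2 f z : selfmap f -> D z ->
  dv (dv (recentre f z)) 0 =
    (1 - z * cconj z) ^+ 2 / (1 - f z * cconj (f z)) * gcurv f z.
Proof.
move=> sf Dz; have [Hf fD] := sf.
have z1 : nc z < 1 by rewrite -udiscE.
have zN1 : nc (- z) < 1 by rewrite ncN.
have f1 : nc (f z) < 1 by rewrite -udiscE; exact: fD.
have Dm y : D y -> D (mb (- z) y) by exact: (selfmap_mb zN1).2.
have m0 : mb (- z) 0 = z by rewrite mb_0 opprK.
have D0 := @udisc0 R; have n0 : nc (0 : C) < 1 by rewrite nc0.
have e1 y : D y -> cdv (fun y => f (mb (- z) y)) y (dv f (mb (- z) y) * dmb (- z) y).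
  move=> Dy; apply: cdv_comp; first by apply: cdv_mb; rewrite // -udiscE.
  by apply: (Hol_cdv Hf); exact: Dm.
have dE y : D y -> dv (recentre f z) y =
    dmb (f z) (f (mb (- z) y)) * (dv f (mb (- z) y) * dmb (- z) y).
  move=> Dy; apply: dvE; apply: (cdv_comp (e1 y Dy)).
  by apply: cdv_mb => //; rewrite -udiscE; apply: fD; exact: Dm.
apply: dvE; have [r r0 rD] := @udisc_open R 0 D0.
have c1 : cdv (mb (- z)) 0 (dmb (- z) 0) by exact: cdv_mb.
have c2 : cdv (fun y => dv f (mb (- z) y)) 0 (dv (dv f) z * dmb (- z) 0).
  by apply: (cdv_comp c1); rewrite m0; exact: (Hol_cdv (Hol_dv Hf)).
have c3 := cdvM c2 (cdv_dmb zN1 n0).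
have c4 : cdv (fun y => dmb (f z) (f (mb (- z) y))) 0
   (2 * cconj (f z) * (1 - f z * cconj (f z)) / (1 - cconj (f z) * f z) ^+ 3 *
    (dv f z * dmb (- z) 0)).
  have := e1 0 D0; rewrite m0 => e0; apply: (cdv_comp e0); rewrite m0.
  exact: cdv_dmb.
apply: (cdv_near r0 (fun y yr => esym (dE y (rD y yr)))).
have := cdvM c4 c3; rewrite m0; set l := _ + _; set l' := _ * gcurv f z.
suff -> : l = l' by [].
rewrite /l /l' /gcurv !chrE // /dmb cconjN mulr0 subr0 !expr1n !divr1 mulrNN.
have := one_sub_aa f1; have := one_sub_aa z1; rewrite [cconj (f z) * f z]mulrC.
move: (dv (dv f) z) (dv f z) (cconj z) (cconj (f z)) => q p zb fb h1 h2.
by field; rewrite h1 h2.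
Qed.

(** Two Cauchy estimates on discs of radius 1/4, each costing a factor 8. *)
Lemma gcurv_bound f z (eta : R) : selfmap f -> D z ->
  (forall ze, nc ze <= 1 / 2 -> nc (recentre f z ze) <= eta) ->
  nc (dv (dv (recentre f z)) 0) <= 64 * eta.
Proof.
move=> sf Dz small; have [Hr _] := selfmap_recentre sf Dz.
have sub c : nc c <= 1 / 4 -> disc c (1 / 4) `<=` [set y | nc y <= 1 / 2].
  by move=> c4 y; rewrite /disc /= => yc; have := ncB_ge y c; lra.
have subD c : nc c <= 1 / 4 -> disc c (1 / 4) `<=` D.
  by move=> c4 y /(sub c c4) /= h; rewrite udiscE; lra.
have n0 : nc (0 : C) <= 1 / 4 by rewrite nc0; lra.
have b1 c : disc 0 (1 / 4) c -> nc (dv (recentre f z) c) <= 8 * eta.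
  rewrite disc0E => /ltW c4.
  have := @cauchy_estimate _ (recentre f z) c (1 / 4) eta ltac:(lra) (Hol_sub (subD c c4) Hr).
  by move=> /(_ (fun y yc => small y (sub c c4 y yc))); lra.
have := @cauchy_estimate _ (dv (recentre f z)) 0 (1 / 4) (8 * eta) ltac:(lra)
  (Hol_sub (subD 0 n0) (Hol_dv Hr)) b1.
by lra.
Qed.

(** Dropping the nonnegative term with [dv f z] from the denominator leaves exactly the squared
    modulus of the second derivative of [recentre f z] at 0. *)
Lemma sff_bound f z (eta : R) : selfmap f -> D z ->
  (forall ze, nc ze <= 1 / 2 -> nc (recentre f z ze) <= eta) ->
  nc (gcurv f z) ^+ 2 * (hden z * hden (f z)) /
    (hden z + hden (f z) * nc (dv f z) ^+ 2) ^+ 3 <= (64 * eta) ^+ 2.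
Proof.
move=> sf Dz small; have := gcurv_bound sf Dz small.
have z1 : nc z < 1 by rewrite -udiscE.
have f1 : nc (f z) < 1 by rewrite -udiscE; exact: sf.2.
rewrite recentre_dv2 // !mul_cconj ncM nc_div ncX.
have r1 x : nc x < 1 -> nc (1 - (nc x ^+ 2)%:C%C : C) = 1 - nc x ^+ 2.
  move=> /nc_sqr_lt1 h; rewrite (_ : 1 - _ = (1 - nc x ^+ 2)%:C%C); last first.
    by rewrite rmorphB rmorph1.
  by rewrite nc_real ger0_norm //; lra.
rewrite !r1 //.
have := nc_sqr_lt1 z1; have := nc_sqr_lt1 f1; rewrite /hden.
have := nc_ge0 (gcurv f z).
move: (nc (gcurv f z)) (nc (dv f z)) (nc z ^+ 2) (nc (f z) ^+ 2) => B p s t B0 t1 s1.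
set u := 1 - t; set v := 1 - s => h.
have u0 : 0 < u by rewrite /u; lra.
have v0 : 0 < v by rewrite /v; lra.
have h0 : 0 <= v ^+ 2 / u * B by rewrite mulr_ge0 // divr_ge0 ?sqr_ge0 // ltW.
apply: (@le_trans _ _ ((v ^+ 2 / u * B) ^+ 2)); last first.
  by rewrite ler_pXn2r ?nnegrE //; exact: le_trans h.
have k1 : 0 < v ^- 2 by rewrite invr_gt0 exprn_gt0.
have k2 : 0 < u ^- 2 by rewrite invr_gt0 exprn_gt0.
have -> : (v ^+ 2 / u * B) ^+ 2 = B ^+ 2 * (v ^- 2 * u ^- 2) / (v ^- 2) ^+ 3.
  by field; rewrite !gt_eqF.
have pos : 0 <= u ^- 2 * p ^+ 2 by rewrite mulr_ge0 ?sqr_ge0 // ltW.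
apply: ler_wpM2l; first by rewrite mulr_ge0 ?sqr_ge0 // mulr_ge0 // ltW.
rewrite lef_pV2 ?posrE ?exprn_gt0 //; last by lra.
by rewrite ler_pXn2r ?nnegrE //; lra.
Qed.

(** [pdist0 t < 1] means that (1 + t) / (1 - t) < exp 2, so the radius is tanh 1. *)
Lemma geo_ball_radius : exists2 r : R, r < 1 & forall p : C * C, geo_ball p -> nc p.1 <= r.
Proof.
pose E := expR 2 : R; have E0 : 0 < E by exact: expR_gt0.
exists ((E - 1) / (E + 1)); first by rewrite ltr_pdivrMr; lra.
move=> p [[p1 _] h].
have t0 := nc_ge0 p.1; move: (nc p.1) t0 p1 h => t t0 t1 h.
have h1 : pdist0 t < 1.
  have := sqr_ge0 (pdist0 (nc p.2)) => s0; rewrite ltNge; apply/negP => h1.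
  have : 1 <= pdist0 t ^+ 2 by nra.
  by lra.
rewrite /pdist0 in h1.
have d0 : 0 < 1 - t by lra.
have q0 : 0 < (1 + t) / (1 - t) by rewrite divr_gt0 //; lra.
have : (1 + t) / (1 - t) < E.
  by rewrite -ltr_ln ?posrE // expRK; lra.
rewrite ltr_pdivrMr // ler_pdivlMr; nra.
Qed.

End Curvature.

(** * The graph of the division map and its group *)

Section GraphCurve.
Variable R : realType.
Local Notation C := (R[i]).
Implicit Types (a b c l t x y z w u : C) (h gam : C -> C).
Local Notation D := (@udisc R).
Local Notation Lat := (@inLat R).

Variable F : C -> C.
Hypothesis univF : universal_at F (@cell_center R).
Variables (n : nat) (f : C -> C).
Hypothesis n1 : (1 < n)%N.
Hypothesis divf : divides_by F n f.

Let n0 : (0 < n)%N := ltnW n1.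
Let sf : selfmap f := divf.1.
Let Dz0 := @udisc0 R.
Let oD := @udisc_open R.
Let HF := HolF univF.

Definition graph : set (C * C) := [set q | D q.1 /\ q.2 = f q.1].

(** The second component is a deck transformation, not necessarily in [Hgrp], through which [f] is
    equivariant. Members are prescribed on the bidisk only. *)
Definition graph_group : set (C * C -> C * C) := [set g |
  exists gam gam', [/\ Hgrp univF n gam, exists s, deck F s gam',
    forall z, D z -> f (gam z) = gam' (f z) &
    forall p, bidisk p -> g p = (gam p.1, gam' p.2)]].

Lemma bidiskE (p : C * C) : bidisk p <-> D p.1 /\ D p.2.
Proof. by rewrite !udiscE. Qed.

Lemma Hgrp_deck gam : Hgrp univF n gam -> exists t, deck F t gam.
Proof. by move=> [p [dg _ _]]; exists (lam R p). Qed.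

Lemma Hgrp_bihol gam : Hgrp univF n gam -> bihol gam.
Proof. by move=> /Hgrp_deck[t []]. Qed.

Lemma Hgrp_lift gam : Hgrp univF n gam ->
  exists gam', (exists s, deck F s gam') /\ forall z, D z -> f (gam z) = gam' (f z).
Proof.
move=> [p [dg [s Ls E] _]]; rewrite E in dg.
by have [gam' dg' fE] := division_equivariant univF n0 divf Ls dg; exists gam'; split=> //; exists s.
Qed.

Lemma graph_group_aut : aut_group graph_group.
Proof.
split.
- move=> g [gam [gam' [hg [s [bg' _ _]] _ gE]]].
  have [a1 [u1 [na1 nu1 E1]]] := bihol_mob (Hgrp_bihol hg).
  have [a2 [u2 [na2 nu2 E2]]] := bihol_mob bg'.
  exists false, a1, u1, a2, u2; split=> // p bp.
  by have /bidiskE[p1 p2] := bp; rewrite gE // /aut_formula /= E1 // E2.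
- exists id, id; split=> //; first exact: Hgrp_id.
    by exists 0; exact: deck_id.
  by case.
- move=> g h [gam [gam' [hg [s dg] fg gE]]] [del [del' [hd [t dd] fd hE]]].
  exists (fun z => gam (del z)), (fun z => gam' (del' z)); split.
  + exact: Hgrp_comp.
  + by exists (s + t); exact: deck_comp.
  + move=> z Dz; rewrite fg ?fd //; exact: (Hgrp_bihol hd).1.2.
  + move=> p bp; rewrite /= hE //; have /bidiskE[p1 p2] := bp.
    rewrite gE //; apply/bidiskE; split; first exact: (Hgrp_bihol hd).1.2.
    by have [bd _ _] := dd; exact: bd.1.2.
- move=> g [gam [gam' [hg [s dg'] fg gE]]].
  have [del [hd dK gK]] := Hgrp_inv hg; have [del' [dd' dK' gK']] := deck_inv dg'.
  have dD := (Hgrp_bihol hd).1.2; have gD := (Hgrp_bihol hg).1.2.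
  have [bd' _ _] := dd'; have [bg' _ _] := dg'.
  exists (fun p => (del p.1, del' p.2)); split.
  + exists del, del'; split=> //; first by exists (- s).
    move=> z Dz; rewrite -{2}(gK z Dz) fg; last exact: dD.
    by rewrite dK' //; apply: sf.2; exact: dD.
  + by move=> p bp; have /bidiskE[p1 p2] := bp; rewrite /= gE // dK // dK' //; case: p {bp p1 p2}.
  + move=> p /bidiskE[p1 p2]; rewrite /= gE; first by rewrite /= gK // gK' //; case: p {p1 p2}.
    by apply/bidiskE; split; [exact: dD|exact: bd'.1.2].
Qed.

Lemma f0_notLat : ~ Lat (F (f 0)).
Proof. by rewrite divf.2 // (F0 univF); exact: base_div_notLat. Qed.

(** Once the first component is trivial, the second one fixes [f 0], where [F] is outside the
    lattice; it is therefore trivial, although deck transformations may have finite order. *)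
Lemma graph_group_torsion_free : torsion_free graph_group.
Proof.
move=> g m [gam [gam' [hg [s dg'] fg gE]]] m0 fin.
have gD := (Hgrp_bihol hg).1.2; have [bg' Ls g'E] := dg'.
have it k p : bidisk p -> bidisk (iter k g p) /\ (iter k g p).1 = iter k gam p.1.
  move=> bp; elim: k => [|k [IH IH1]] //=.
  rewrite gE //=; have /bidiskE[p1 p2] := IH.
  by split; [apply/bidiskE; split; [exact: gD|exact: bg'.1.2]|rewrite IH1].
have gid z : D z -> gam z = z.
  apply: (Hgrp_torsion hg m0) => y Dy.
  have by0 : bidisk (y, 0 : C) by apply/bidiskE.
  by have [_ <-] := it m _ by0; rewrite fin.
have g'f : gam' (f 0) = f 0 by rewrite -fg // gid.
have Df0 : D (f 0) by exact: sf.2.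
have s0 : s = 0.
  by have := g'E _ Df0; rewrite g'f -{1}[F (f 0)]addr0 => /addrI.
rewrite s0 in dg'.
have g'id z (Dz : D z) := deck_unique univF dg' (deck_id F) Df0 f0_notLat g'f Dz.
move=> p bp; have /bidiskE[p1 p2] := bp.
by rewrite gE // gid // g'id //; case: p {bp p1 p2}.
Qed.

Lemma graph_group_discrete : discrete_group graph_group.
Proof.
have [d d0 iso] := deck_isolated univF.
exists (1 / 2), d; split; [lra|lra|exact: d0|].
move=> g [gam [gam' [hg [s dg'] _ gE]]] small.
have [t dg] := Hgrp_deck hg.
have nz : nc (0 : C) <= 1 / 2 by rewrite nc0; lra.
have Dh x : nc x <= 1 / 2 -> D x by move=> h; rewrite udiscE; lra.
have gid : forall z, D z -> gam z = z.
  apply: (iso _ _ dg) => z zh; have := (small (z, 0) zh nz).1.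
  by rewrite gE //; apply/bidiskE; split=> //; exact: Dh.
have g'id : forall z, D z -> gam' z = z.
  apply: (iso _ _ dg') => z zh; have := (small (0, z) nz zh).2.
  by rewrite gE //; apply/bidiskE; split=> //; exact: Dh.
move=> p bp; have /bidiskE[p1 p2] := bp.
by rewrite gE // gid // g'id //; case: p {bp p1 p2}.
Qed.

Lemma graph_bidisk p : graph p -> bidisk p.
Proof. by move=> [p1 p2]; apply/bidiskE; rewrite p2; split=> //; exact: sf.2. Qed.

Lemma graph_cplx_curve : cplx_curve graph.
Proof.
split; first exact: graph_bidisk.
- move=> p /bidiskE[p1 p2] cl; split=> //.
  apply: eq_of_nc_small => e e0; have [d d0 hd] := Hol_cont sf.1 p1 (e := e / 2) ltac:(lra).
  have [q [[q1 q2] [c1 c2]]] := cl (Num.min d (e / 2)) ltac:(by rewrite lt_min d0; lra).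
  move: c1 c2; rewrite !lt_min => /andP[/hd c1 _] /andP[_ c2]; rewrite q2 in c2.
  have := nc_triangle p.2 (f q.1) (f p.1); rewrite (nc_distC p.2 (f q.1)); lra.
- move=> p [p1 p2]; exists (1 - nc p.1), f, true.
  have n1' : nc p.1 < 1 by rewrite -udiscE.
  have sub : disc p.1 (1 - nc p.1) `<=` D.
    by move=> y; rewrite /disc /= udiscE => h; have := ncB_ge y p.1; lra.
  split; first lra.
  split; first by apply: Hol_holo_on; exact: Hol_sub sf.1.
  move=> q qd _; split=> [[]//|E]; split=> //; exact: sub.
Qed.

Lemma graph_compact : compact_curve_lift graph_group graph.
Proof.
split; first exact: graph_cplx_curve.
- by exists (0, f 0).
- move=> g p [gam [gam' [hg _ fg gE]]] gp; rewrite gE; last exact: graph_bidisk.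
  have [p1 p2] := gp; split=> /=; first exact: (Hgrp_bihol hg).1.2.
  by rewrite p2 fg.
have [r [r0 r1] coc] := Hgrp_cocompact univF n0.
have [r' [r'0 r'1] hr'] := selfmap_compact r1 sf.
exists (Num.max r r'); split; first by rewrite gt_max r1.
move=> [z y] [/= Dz ->]; have [gam hg gr] := coc z Dz.
have [del [hd dK gK]] := Hgrp_inv hg; have [del' [dd' fd]] := Hgrp_lift hd.
have Dg : D (gam z) by exact: (Hgrp_bihol hg).1.2.
exists (fun p => (del p.1, del' p.2)), (gam z, f (gam z)); split=> //=.
- by exists del, del'; split.
- by rewrite le_max gr.
- by rewrite le_max hr' ?orbT.
- by rewrite -fd // dK.
Qed.

Lemma graph_eps_geodesic (eps eta : R) : 64 * eta <= eps ->
  (forall z ze, D z -> nc ze <= 1 / 2 -> nc (recentre f z ze) <= eta) ->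
  eps_geodesic eps graph.
Proof.
move=> le small rho f1 f2 w [rho0 h1 h2 gr] wr.
have gr' y : nc y < rho -> nc (f1 y) < 1 /\ f2 y = f (f1 y).
  by move=> /gr[[]]; rewrite udiscE.
have Dw : D (f1 w) by rewrite udiscE; exact: (gr' w wr).1.
rewrite (sff_graph sf h1 h2 wr gr' (gr w wr).2).
apply: le_trans (sff_bound sf Dw (fun ze => small _ ze Dw)) _.
have eta0 : 0 <= eta.
  apply: le_trans (nc_ge0 _) (small 0 0 Dz0 _); rewrite nc0; lra.
by rewrite ler_pXn2r ?nnegrE //; lra.
Qed.

Lemma graph_modeled (d eta rho : R) : 0 < d -> eta < d -> rho < 1 ->
  (forall p : C * C, geo_ball p -> nc p.1 <= rho) ->
  (forall z ze, D z -> nc ze <= rho -> nc (recentre f z ze) <= eta) ->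
  modeled_horizontal d graph.
Proof.
move=> d0 ed rho1 ball small [z y] [/= Dz ->].
have z1 : nc z < 1 by rewrite -udiscE.
have fz1 : nc (f z) < 1 by rewrite -udiscE; exact: sf.2.
have mobE a x : mob a 1 x = mb a x by rewrite /mob mul1r.
exists (fun p => (mob z 1 p.1, mob (f z) 1 p.2)); split.
- by exists false, z, 1, (f z), 1; split=> //; rewrite nc1.
- by rewrite /= !mobE !mb_self.
- move=> [x y'] [/= Dx ->] /ball; rewrite /= !mobE => h.
  have x1 : nc x < 1 by rewrite -udiscE.
  by have := small z _ Dz h; rewrite /recentre mbK // => /le_lt_trans; apply.
- move=> x /ball /= xr; have Dx : D x by rewrite udiscE; lra.
  have x1 : nc x < 1 by rewrite -udiscE.
  have zN1 : nc (- z) < 1 by rewrite ncN.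
  exists (mb (- z) x, f (mb (- z) x)); split=> /=.
  + by split=> //=; rewrite udiscE mb_lt1.
  + by rewrite mobE mbNK // subrr nc0.
  + by rewrite mobE; apply: le_lt_trans ed; exact: small.
Qed.

Lemma division_critical z : D z -> F z = 1 -> dv f z = 0 /\ dv (dv f) z != 0.
Proof.
move=> Dz Fz; have nz := natC_neq0 R n0.
have L1 : Lat (F z) by rewrite Fz; exists 1, 0.
have [c1 c2] := F_critical univF Dz L1.
have fD := sf.2; have Hf := sf.1.
have nL : ~ Lat (F (f z)).
  rewrite divf.2 // Fz; apply: small_notLat; first by rewrite mulf_neq0 ?oner_neq0 // invr_neq0.
  rewrite nc_div nc1 nc_nat ler_pdivrMr ?ltr0n //.
  have : (2 : R) <= n%:R by rewrite ler_nat.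
  lra.
have reg := F_regular univF (fD z Dz) nL.
have e y : D y -> dv F (f y) * dv f y = n%:R^-1 * dv F y.
  move=> Dy; have [r r0 rD] := oD Dy.
  apply: (cdv_uniq (cdv_comp (Hol_cdv Hf Dy) (Hol_cdv HF (fD y Dy)))).
  apply: (cdv_near r0 _ (cdvZ n%:R^-1 (Hol_cdv HF Dy))) => x /rD Dx.
  by rewrite divf.2 // mulrC.
have f'0 : dv f z = 0.
  by have /eqP := e z Dz; rewrite c1 mulr0 mulf_eq0 (negbTE reg) => /eqP.
split=> //.
have l1 := cdvM (cdv_comp (Hol_cdv Hf Dz) (Hol_cdv (Hol_dv HF) (fD z Dz)))
  (Hol_cdv (Hol_dv Hf) Dz).
have [r r0 rD] := oD Dz.
have l2 : cdv (fun w => dv F (f w) * dv f w) z (n%:R^-1 * dv (dv F) z).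
  by apply: (cdv_near r0 _ (cdvZ n%:R^-1 (Hol_cdv (Hol_dv HF) Dz))) => x /rD /e ->.
have := cdv_uniq l1 l2; rewrite f'0 !mulr0 add0r => E.
have : n%:R^-1 * dv (dv F) z != 0 by rewrite mulf_neq0 ?invr_neq0.
by rewrite -E mulf_eq0 negb_or => /andP[].
Qed.

Lemma graph_not_totally_geodesic : ~ totally_geodesic graph.
Proof.
move=> tg.
have [r [r0 r1] sv] := small_values (@cell_center_notLat R) univF (@nc_cell_center R).
(* A point over 1 is obtained from a point over 0 by a deck transformation. *)
have [x xr Fx] := sv 0 ltac:(rewrite nc0; lra).
have Dx : D x by rewrite udiscE; lra.
have L1 : Lat 1 by exists 1, 0.
have [gam [bg _ gE]] := deck_lattice univF L1.
pose z := gam x; have Dz : D z by exact: bg.1.2.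
have Fz : F z = 1 by rewrite gE // Fx add0r.
have [d1z d2z] := division_critical Dz Fz.
have z1 : nc z < 1 by rewrite -udiscE.
pose rho := 1 - nc z; have rho0 : 0 < rho by rewrite /rho; lra.
pose f1 w := w + z; pose f2 w := f (f1 w).
have in1 w : nc w < rho -> D (f1 w).
  by move=> wr; rewrite udiscE; have := ncD w z; rewrite /rho in wr; rewrite /f1; lra.
have oR : copen (disc (0 : C) rho) by exact: disc_open.
have H1 : Hol (disc 0 rho) f1 by apply: HolD => //; [exact: Hol_id|exact: Hol_cst].
have H2 : Hol (disc 0 rho) f2.
  by apply: (Hol_comp oR oD _ H1 sf.1) => w; rewrite disc0E; exact: in1.
have D1 w : nc w < rho -> d1 f1 w = 1.
  move=> wr; have [_ ->] := Hol_d1 H1 (w := w) ltac:(by rewrite disc0E).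
  by apply: dvE; have := cdvD (cdv_id w) (cdv_cst z w); rewrite addr0.
have par : curve_param graph rho f1 f2.
  split=> //; [exact: Hol_holo_on|exact: Hol_holo_on|].
  move=> w wr; split; first by split=> //; exact: in1.
  by rewrite D1 //; apply/eqP => -[] /eqP; rewrite oner_eq0.
have nr : nc (0 : C) < rho by rewrite nc0.
have := tg rho f1 f2 0 par nr.
have gr w : nc w < rho -> nc (f1 w) < 1 /\ f2 w = f (f1 w).
  by move=> /in1; rewrite udiscE.
have [_ _ _ pr] := par.
rewrite (sff_graph sf (Hol_holo_on H1) (Hol_holo_on H2) nr gr (pr 0 nr).2).
have -> : f1 0 = z by rewrite /f1 add0r.
rewrite /gcurv d1z expr0n /= mulr0 mul0r subr0 addr0 nc0 expr0n /= mulr0 addr0.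
have h1 := hden_gt0 z1; have h2 : 0 < hden (f z) by apply: hden_gt0; rewrite -udiscE; exact: sf.2.
have q0 : 0 < nc (dv (dv f) z) by rewrite nc_gt0.
apply/eqP; rewrite gt_eqF //.
by apply: divr_gt0; rewrite ?exprn_gt0 // !mulr_gt0.
Qed.

End GraphCurve.

Theorem theorem1 (R : realType) (eps d : R) :
  0 < eps -> 0 < d ->
  exists (G : set (R[i] * R[i] -> R[i] * R[i])) (S : set (R[i] * R[i])),
    [/\ aut_group G, torsion_free G & discrete_group G] /\
    [/\ compact_curve_lift G S, eps_geodesic eps S,
        modeled_horizontal d S & ~ totally_geodesic S].
Proof.
move=> eps0 d0.
have [F univF] := universal_exists (@cell_center_notLat R).
have [r r1 ball] := geo_ball_radius R.
(* [r] is needed for closeness in the geodesic ball, 1/2 for the curvature estimate. *)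
pose rho := Num.max r (1 / 2).
have rho1 : rho < 1 by rewrite gt_max r1 /=; lra.
(* 64 is the constant of [sff_bound]; d / 2 makes the closeness strict. *)
pose eta := Num.min (eps / 64) (d / 2).
have eta0 : 0 < eta by rewrite lt_min; apply/andP; split; lra.
have eta1 : eta <= eps / 64 by rewrite ge_min lexx.
have eta2 : eta <= d / 2 by rewrite ge_min lexx orbT.
have [n n1 contr] := division_contracts univF eta0 rho1.
have [f divf] := division_exists univF (ltnW n1).
exists (graph_group univF n f), (graph f); split.
  split; [exact: graph_group_aut|exact: graph_group_torsion_free|exact: graph_group_discrete].
split.
- exact: graph_compact.
- apply: (graph_eps_geodesic divf (eta := eta)); first lra.
  by move=> z ze Dz zh; apply: contr => //; rewrite le_max zh orbT.
- apply: (graph_modeled divf (eta := eta) (rho := rho)) => //; first lra.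
    by move=> p /ball h; rewrite le_max h.
  by move=> z ze Dz zr; exact: contr.
- exact: (graph_not_totally_geodesic univF n1 divf).
Qed.
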